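(* Let $\Omega\subset\mathbb R^n$ be a bounded domain with $\partial\Omega\in C^{4+\alpha}$, $0<\alpha<1$, and let $0\leqslant l<m\leqslant n$. Assume $\mathbf k_{m-1}[\partial\Omega]>0$. Let $w$, $w\leqslant0$, be the solution of the problem $$\frac{T_m[w]}{T_l[w]}=1\ \text{ in }\Omega,\qquad w|_{\partial\Omega}=0 .$$ Then for every $u\in W^{1,2}_0(\Omega)$ $$\frac{m-l}{I_m[w]}\left(\int_\Omega u\,T_m[w]\,dx\right)^2+\int_\Omega T_l^{ij}[w]u_iu_j\,dx\leqslant\int_\Omega T_m^{ij}[w]u_iu_j\,dx .$$
   Context: For a symmetric $n\times n$ matrix $S$, $T_0(S)\equiv1$ and $T_p(S)$, $1\leqslant p\leqslant n$, is the $p$-trace of $S$, i.e. the sum of all principal minors of order $p$. For $u\in C^2$, $T_p[u]=T_p(u_{xx})$, where $u_{xx}=(u_{ij})$ is the Hesse matrix, and $T_p^{ij}[u]=\partial T_p(u_{xx})/\partial u_{ij}$, all $n^2$ entries being regarded as independent variables (so $T_0^{ij}=0$). $u_i=\partial u/\partial x^i$; repeated indices $i,j$ are summed from $1$ to $n$. $I_m[w]=\int_\Omega(-w)T_m[w]\,dx$. $W^{1,2}_0(\Omega)$ is the Sobolev space of functions with square integrable first derivatives and zero boundary values. $\mathbf k_p[\partial\Omega]$ is the $p$-curvature of $\partial\Omega$: the elementary symmetric function of order $p$ of the principal curvatures of $\partial\Omega$ (positive for a sphere bounding a ball), with $\mathbf k_0\equiv1$. The condition $\mathbf k_{m-1}[\partial\Omega]>0$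 expresses $(m-1)$-convexity of the closed hypersurface $\partial\Omega$, equivalently uniform $(m-1)$-convexity of $\Omega$, i.e. at every point of $\partial\Omega$ the elementary symmetric functions of orders $1,\dots,m-1$ of the principal curvatures are positive. Under these hypotheses the problem for $w$ is known to have a unique solution in $\{v\in C^2(\bar\Omega): v|_{\partial\Omega}=0,\ v\leqslant0\}$; it belongs to $C^{4+\alpha}(\bar\Omega)$ and satisfies $T_p[w]>0$ in $\bar\Omega$ for $p=1,\dots,m$. This solution is $w$. *)

(* Defs.v *)
From HB Require Import structures.
From mathcomp Require Import all_boot all_order all_algebra.
From mathcomp Require Import all_classical all_reals all_analysis.

Set Implicit Arguments.
Unset Strict Implicit.
Unset Printing Implicit Defensive.

Import Order.TTheory GRing.Theory Num.Theory.
Import numFieldNormedType.Exports.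

Local Open Scope classical_set_scope.
Local Open Scope ring_scope.

(** * Lebesgue measure and integral on R^n *)

(* Points of R^n are row vectors, which carry the library's topology and (max)
   norm; measures live on tuples, which carry the library's product
   sigma-algebra (the Borel sets).  [row_of_tuple] identifies the two. *)
Definition row_of_tuple (R : realType) (n : nat)
    (t : n.-tuple (measurableTypeR R)) : 'rV[R]_n :=
  \row_i tnth t i.

Definition cons_pair (R : realType) (n : nat)
    (p : measurableTypeR R * n.-tuple (measurableTypeR R)) :
    n.+1.-tuple (measurableTypeR R) :=
  [the n.+1.-tuple (measurableTypeR R) of p.1 :: p.2].

Lemma measurable_cons_pair (R : realType) (n : nat) :
  measurable_fun [set: measurableTypeR R * n.-tuple (measurableTypeR R)]
    (@cons_pair R n).
Proof.
exact: (measurable_cons (f := fst) (g := snd) measurable_fst measurable_snd).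
Qed.

Definition leb_step (R : realType) (n : nat)
    (m : {measure set (n.-tuple (measurableTypeR R)) -> \bar R}) :
    set (n.+1.-tuple (measurableTypeR R)) -> \bar R :=
  pushforward (@lebesgue_measure R \x^ m)%E (@cons_pair R n).

Section leb_step_measure.
Local Open Scope ereal_scope.
Context (R : realType) (n : nat)
        (m : {measure set (n.-tuple (measurableTypeR R)) -> \bar R}).

Let leb_step0 : leb_step m set0 = 0.
Proof. by rewrite /leb_step /pushforward preimage_set0 measure0. Qed.

Let leb_step_ge0 A : 0 <= leb_step m A.
Proof. by rewrite /leb_step /pushforward measure_ge0. Qed.

Let leb_step_sigma_additive : semi_sigma_additive (leb_step m).
Proof.
move=> F mF tF mUF; rewrite /leb_step /pushforward preimage_bigcup.
have mc := @measurable_cons_pair R n.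
apply: measure_semi_sigma_additive.
- by move=> k; rewrite -[X in measurable X]setTI; exact: mc.
- apply/trivIsetP => /= i j _ _ ij; rewrite -preimage_setI.
  by move/trivIsetP : tF => /(_ _ _ _ _ ij) ->//; rewrite preimage_set0.
- by rewrite -preimage_bigcup -[X in measurable X]setTI; exact: mc.
Qed.

HB.instance Definition _ := isMeasure.Build _ _ _ (leb_step m)
  leb_step0 leb_step_ge0 leb_step_sigma_additive.
End leb_step_measure.

(* n-fold product of the one-dimensional Lebesgue measure. *)
Fixpoint leb (R : realType) (n : nat) :
    {measure set (n.-tuple (measurableTypeR R)) -> \bar R} :=
  match n with
  | 0%N => @dirac _ _ [tuple] R
  | n'.+1 => leb_step (leb R n')
  end.

Definition eintRn (R : realType) (n : nat) (Om : set 'rV[R]_n)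
    (f : 'rV[R]_n -> R) : \bar R :=
  (\int[leb R n]_(t in @row_of_tuple R n @^-1` Om) (f (row_of_tuple t))%:E)%E.

Definition intRn (R : realType) (n : nat) (Om : set 'rV[R]_n)
    (f : 'rV[R]_n -> R) : R :=
  \int[leb R n]_(t in @row_of_tuple R n @^-1` Om) f (row_of_tuple t).

(** * Partial derivatives and regularity classes *)

Definition partial (R : realType) (n : nat) (i : 'I_n) (f : 'rV[R]_n -> R) :
    'rV[R]_n -> R :=
  'D_(delta_mx 0 i) f.

Definition partials (R : realType) (n : nat) (s : seq 'I_n)
    (f : 'rV[R]_n -> R) : 'rV[R]_n -> R :=
  foldr (@partial R n) f s.

Definition hessian (R : realType) (n : nat) (f : 'rV[R]_n -> R)
    (x : 'rV[R]_n) : 'M[R]_n :=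
  \matrix_(i, j) partials [:: i; j] f x.

(* All partial derivatives of order at most k exist in U. *)
Definition has_partials (R : realType) (n k : nat) (U : set 'rV[R]_n)
    (f : 'rV[R]_n -> R) : Prop :=
  forall (s : seq 'I_n) (i : 'I_n) (x : 'rV[R]_n), (size s < k)%N -> U x ->
    derivable (partials s f) x (delta_mx 0 i).

(* C^k(U), U open *)
Definition Ck (R : realType) (n k : nat) (U : set 'rV[R]_n)
    (f : 'rV[R]_n -> R) : Prop :=
  has_partials k U f /\
  forall (s : seq 'I_n) (x : 'rV[R]_n), (size s <= k)%N -> U x ->
    {for x, continuous (partials s f)}.

(* C^(k+alpha), uniformly in U, for U open and bounded *)
Definition Ckalpha (R : realType) (n k : nat) (alpha : R) (U : set 'rV[R]_n)
    (f : 'rV[R]_n -> R) : Prop :=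
  Ck k U f /\
  forall s : seq 'I_n, size s = k ->
    exists C : R, forall x y : 'rV[R]_n, U x -> U y ->
      `|partials s f x - partials s f y| <= C * `|x - y| `^ alpha.

(* C^k of the closure of U, U open: f is continuous up to the boundary, and its
   partial derivatives in U of order at most k extend continuously to the
   closure. *)
Definition Ck_closure (R : realType) (n k : nat) (U : set 'rV[R]_n)
    (f : 'rV[R]_n -> R) : Prop :=
  [/\ {within closure U, continuous f},
      has_partials k U f &
      forall s : seq 'I_n, (size s <= k)%N ->
        exists g : 'rV[R]_n -> R, {within closure U, continuous g} /\
          forall x, U x -> g x = partials s f x].

(** * Domains, boundary regularity and curvatures *)

Definition bounded_domain (R : realType) (n : nat) (Om : set 'rV[R]_n) : Prop :=
  [/\ Om !=set0, open Om, connected Om & bounded_set Om].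

Definition boundary (R : realType) (n : nat) (Om : set 'rV[R]_n) :
    set 'rV[R]_n :=
  closure Om `\` interior Om.

Definition chart_dom (R : realType) (k : nat) (r : R) : set 'rV[R]_k :=
  [set y | `|y| < r].

(* In the orthonormal frame centred at x0 made of the rows of E and of nu, Om is
   near x0 the set above the graph of g: nu points into Om. *)
Definition local_graph (R : realType) (n : nat) (Om : set 'rV[R]_n)
    (x0 : 'rV[R]_n) (E : 'M[R]_(n.-1, n)) (nu : 'rV[R]_n) (r : R)
    (g : 'rV[R]_n.-1 -> R) : Prop :=
  [/\ [/\ E *m E^T = 1%:M, E *m nu^T = 0 & nu *m nu^T = 1%:M],
      0 < r, g 0 = 0 &
      forall (y : 'rV[R]_n.-1) (t : R), `|y| < r -> `|t| < r ->
        (Om (x0 + y *m E + t *: nu) <-> g y < t)].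

Definition Ckalpha_boundary (R : realType) (n k : nat) (alpha : R)
    (Om : set 'rV[R]_n) : Prop :=
  forall x0, boundary Om x0 ->
    exists E nu r g,
      local_graph Om x0 E nu r g /\ Ckalpha k alpha (@chart_dom R n.-1 r) g.

(* The principal curvatures of the boundary at x0, with multiplicity: the
   eigenvalues at 0 of the Hessian of a graph function whose gradient vanishes
   there, so that nu is the inner unit normal; they are all 1/r on a sphere of
   radius r bounding a ball. *)
Definition principal_curvatures (R : realType) (n : nat) (Om : set 'rV[R]_n)
    (x0 : 'rV[R]_n) (kappa : 'I_n.-1 -> R) : Prop :=
  exists E nu r g,
    [/\ local_graph Om x0 E nu r g,
        Ck 2 (@chart_dom R n.-1 r) g,
        forall i, partial i g 0 = 0 &
        char_poly (hessian g 0) = \prod_i ('X - (kappa i)%:P)].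

Definition elem_sym (R : realType) (k p : nat) (kappa : 'I_k -> R) : R :=
  \sum_(A : {set 'I_k} | #|A| == p) \prod_(i in A) kappa i.

(* The p-curvature at x0; it does not depend on the choice of the frame and of
   the ordering hidden in [principal_curvatures]. *)
Definition p_curvature (R : realType) (n p : nat) (Om : set 'rV[R]_n)
    (x0 : 'rV[R]_n) : R :=
  xget 0 [set c | exists2 kappa,
    principal_curvatures Om x0 kappa & c = elem_sym p kappa].

(** * p-traces *)

Definition principal_minor (R : realType) (n : nat) (S : 'M[R]_n)
    (A : {set 'I_n}) : R :=
  \det (mxsub (fun i : 'I_#|A| => enum_val i) (fun i => enum_val i) S).

Definition ptrace (R : realType) (n p : nat) (S : 'M[R]_n) : R :=
  \sum_(A : {set 'I_n} | #|A| == p) principal_minor S A.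

(* dT_p/du_ij, the n^2 entries being independent variables. *)
Definition ptrace_deriv (R : realType) (n p : nat) (i j : 'I_n)
    (S : 'M[R]_n) : R :=
  'D_(delta_mx i j) (@ptrace R n p : 'M[R]_n -> R) S.

Definition T_ (R : realType) (n p : nat) (w : 'rV[R]_n -> R)
    (x : 'rV[R]_n) : R :=
  ptrace p (hessian w x).

Definition Tij_ (R : realType) (n p : nat) (i j : 'I_n) (w : 'rV[R]_n -> R)
    (x : 'rV[R]_n) : R :=
  ptrace_deriv p i j (hessian w x).

Definition I_ (R : realType) (n m : nat) (Om : set 'rV[R]_n)
    (w : 'rV[R]_n -> R) : R :=
  intRn Om (fun x => - w x * T_ m w x).

Definition dirichlet_solution (R : realType) (n m l : nat) (Om : set 'rV[R]_n)
    (w : 'rV[R]_n -> R) : Prop :=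
  [/\ Ck_closure 2 Om w,
      forall x, Om x -> T_ m w x / T_ l w x = 1,
      forall x, boundary Om x -> w x = 0 &
      forall x, closure Om x -> w x <= 0].

(** * Sobolev spaces *)

Definition test_function (R : realType) (n : nat) (Om : set 'rV[R]_n)
    (phi : 'rV[R]_n -> R) : Prop :=
  (forall k, Ck k setT phi) /\
  exists K : set 'rV[R]_n,
    [/\ compact K, K `<=` Om & forall x, ~ K x -> phi x = 0].

Definition L2 (R : realType) (n : nat) (Om : set 'rV[R]_n)
    (u : 'rV[R]_n -> R) : Prop :=
  measurable_fun (@row_of_tuple R n @^-1` Om) (u \o @row_of_tuple R n) /\
  (eintRn Om (fun x => (u x ^+ 2)%R) < +oo)%E.

(* u is in W^{1,2}(Om), with weak gradient Du *)
Definition W12 (R : realType) (n : nat) (Om : set 'rV[R]_n)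
    (u : 'rV[R]_n -> R) (Du : 'I_n -> 'rV[R]_n -> R) : Prop :=
  [/\ L2 Om u, forall i, L2 Om (Du i) &
      forall i phi, test_function Om phi ->
        intRn Om (fun x => u x * partial i phi x) =
        - intRn Om (fun x => Du i x * phi x)].

(* u is in W^{1,2}_0(Om), the closure of the test functions in W^{1,2}(Om) *)
Definition W12_0 (R : realType) (n : nat) (Om : set 'rV[R]_n)
    (u : 'rV[R]_n -> R) (Du : 'I_n -> 'rV[R]_n -> R) : Prop :=
  W12 Om u Du /\
  exists phi : nat -> 'rV[R]_n -> R,
    [/\ forall k, test_function Om (phi k),
        eintRn Om (fun x => (phi k x - u x) ^+ 2) @[k --> \oo] --> 0%E &
        forall i, eintRn Om (fun x => (partial i (phi k) x - Du i x) ^+ 2)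
                    @[k --> \oo] --> 0%E].

(* Main.v *)
Require Import Defs.
From HB Require Import structures.
From mathcomp Require Import all_boot all_order all_algebra.
From mathcomp Require Import all_classical all_reals all_analysis.
From mathcomp.real_closed Require Import complex.
From mathcomp Require Import measurable_realfun perm ring lra zify.

Set Implicit Arguments.
Unset Strict Implicit.
Unset Printing Implicit Defensive.

Import Order.TTheory GRing.Theory Num.Theory.
Import numFieldNormedType.Exports.

Local Open Scope classical_set_scope.
Local Open Scope ring_scope.

(** The inequality is a Cauchy-Schwarz inequality for the quadratic form with
    coefficients F^ij = T_m^ij[w] - T_l^ij[w]. Put f = T_m[w] = T_l[w]. By
    Piola's identity the rows of the matrix T_p^ij[w] are divergence free, and
    T_p is homogeneous of degree p, so the divergence of T_p^ij[w] w_i is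
    T_p^ij[w] w_ij = p T_p[w]. Tested with functions phi that vanish near the
    boundary this reads
      int T_p^ij[w] w_i phi_j = - p int phi T_p[w]    ([weak_identity]),
    whence int F^ij w_i phi_j = - (m - l) int phi f. Formally phi = w gives
    int F^ij w_i w_j = (m - l) I_m[w]. If F is nonnegative, the square of the
    integral of F^ij w_i phi_j is at most the product of those of F^ij w_i w_j
    and F^ij phi_i phi_j, which is the theorem for phi; the general u follows by
    density, the coefficients being bounded.

    Ellipticity of F is the algebraic part. For a real symmetric matrix S and a
    real vector xi the polynomial det(X + S + i xi xi^T) has no zero in the
    upper half-plane. Its real and imaginary parts have as coefficients the
    p-traces T_p(S) and their derivatives D_p along xi xi^T, and a
    Hermite-Biehler argument gives D_p T_(p+1) <= T_p D_(p+1)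
    ([minor_sum_newton]). Where T_0, ..., T_m are positive, D_p / T_p therefore
    increases with p up to m, and T_l = T_m yields D_l <= D_m. The positivity
    of all T_p[w] with p <= m holds at an interior minimum of w, where the
    Hessian is positive semidefinite, and it spreads over the connected domain
    since T_m[w] never vanishes ([solution_T_pos]); in particular w is
    subharmonic, so w < 0 inside.

    Two approximations make this rigorous. The divergence of T_p^ij[w] w_i
    contains third derivatives of w, so the identity is proved for smoothed
    functions, by repeated Steklov means, and passes to the limit because its
    two sides contain only two derivatives. And w is not admissible itself,
    being regular only inside the domain: it is replaced by a C^2 function v of
    w that vanishes where w > -d and differs from w by a constant where
    w < -2d, a set that contains the support of phi when d is small. Since the
    gradient of v is a multiple of that of w by a factor in [0, 1] and
    0 <= -v <= -w, the integral of F^ij w_i v_j is at most (m - l) I_m[w], which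
    is all that the Cauchy-Schwarz argument needs ([energy_inequality_test]). *)

(** * Principal minors as determinants of the full size *)

(** Sylvester's identity. One unipotent block matrix, multiplied to B on
    either side, makes B block triangular with one or the other of the two
    determinants. *)
Lemma det_add1_mulmxC (K : comNzRingType) (n k : nat)
    (X : 'M[K]_(n, k)) (Y : 'M[K]_(k, n)) :
  \det (1%:M + X *m Y) = \det (1%:M + Y *m X).
Proof.
pose B : 'M[K]_(n + k) := block_mx 1%:M (- X) Y 1%:M.
have -> : \det (1%:M + X *m Y) = \det B.
  have -> : \det B = \det (B *m block_mx 1%:M 0 (- Y) 1%:M).
    by rewrite det_mulmx det_lblock !det1 !mulr1.
  rewrite mulmx_block !mulmx1 !mulmx0 !mul1mx mulNmx mulmxN opprK addrN !add0r.
  by rewrite det_ublock det1 mulr1.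
have -> : \det B = \det (block_mx 1%:M 0 (- Y) 1%:M *m B).
  by rewrite det_mulmx det_lblock !det1 !mul1r.
rewrite mulmx_block !mul1mx !mul0mx !addr0 mulmx1 mulNmx mulmxN opprK addNr.
by rewrite det_ublock det1 mul1r addrC.
Qed.

(** Replacing the rows outside A by those of the identity keeps the size n, so
    that the principal minors of all orders are determinants of n x n matrices
    depending on S entry by entry. *)
Definition trunc_mx (K : comNzRingType) (n : nat) (A : {set 'I_n})
    (S : 'M[K]_n) : 'M[K]_n :=
  \matrix_(i, j) if i \in A then S i j else (i == j)%:R.

(** With P the 0-1 matrix selecting the rows in A, the truncated matrix is [1
    + P^T (P (S - 1))], and Sylvester's identity moves P^T to the other side,
    where only a matrix of size #|A| is left. *)
Lemma det_trunc_mx (K : comNzRingType) (n : nat) (A : {set 'I_n})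
    (S : 'M[K]_n) :
  \det (trunc_mx A S) =
  \det (mxsub (fun i : 'I_#|A| => enum_val i) (fun i => enum_val i) S).
Proof.
pose P : 'M[K]_(#|A|, n) := \matrix_(i, j) (enum_val i == j)%:R.
have PE k (M : 'M[K]_(n, k)) i j : (P *m M) i j = M (enum_val i) j.
  rewrite mxE (bigD1 (enum_val i)) //= mxE eqxx mul1r big1 ?addr0 // => l nl.
  by rewrite mxE eq_sym (negPf nl) mul0r.
have PTE k (M : 'M[K]_(k, n)) i j : (M *m P^T) i j = M i (enum_val j).
  have -> : (M *m P^T) i j = (M *m P^T)^T j i by rewrite [RHS]mxE.
  by rewrite trmx_mul trmxK PE mxE.
have -> : trunc_mx A S = 1%:M + P^T *m (P *m (S - 1%:M)).
  apply/matrixP => i j; rewrite !mxE; case: ifPn => iA.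
    rewrite (bigD1 (enum_rank_in iA i)) //= PE !mxE enum_rankK_in // eqxx mul1r.
    rewrite big1 ?addr0; first by rewrite addrCA addrN addr0.
    move=> k nk; rewrite !mxE; case: eqP => [e|]; last by rewrite mul0r.
    by case/negP: nk; apply/eqP/enum_val_inj; rewrite enum_rankK_in.
  rewrite big1 ?addr0 // => k _; rewrite mxE [P _ _]mxE; case: eqP => [e|].
    by move: iA; rewrite -e enum_valP.
  by rewrite mul0r.
rewrite det_add1_mulmxC; congr (\det _); apply/matrixP => i j.
rewrite mxE PTE PE !mxE; have -> : (enum_val i == enum_val j) = (i == j).
  by apply/eqP/eqP => [/enum_val_inj|->].
by rewrite addrCA addrN addr0.
Qed.

(** In the Leibniz formula each factor is a sum of an entry of z and an entry
    of S; A is the set of the rows where the entry of S is taken. *)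
Lemma det_scalar_add (K : comNzRingType) (n : nat) (z : K) (S : 'M[K]_n) :
  \det (z%:M + S) =
  \sum_(A : {set 'I_n}) z ^+ (n - #|A|) * \det (trunc_mx A S).
Proof.
rewrite {1}/determinant.
under eq_bigr => s _ do
  (under eq_bigr => i _ do rewrite mxE addrC; rewrite bigA_distr mulr_sumr).
rewrite exchange_big; apply: eq_bigr => A _.
rewrite /determinant mulr_sumr; apply: eq_bigr => s _; rewrite mulrCA.
congr (_ * _).
rewrite (eq_bigr (fun i => (if i \in A then 1 else z) * trunc_mx A S i (s i)));
  last first.
  move=> i _; rewrite !mxE; case: ifP => _; first by rewrite mul1r.
  by rewrite mulr_natr.
rewrite big_split /=; congr (_ * _); rewrite (bigID (mem A)) /=.
rewrite big1 ?mul1r => [|i ->//].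
rewrite (eq_bigr (fun=> z)) => [|i /negPf ->//].
rewrite prodr_const; congr (_ ^+ _); rewrite -[X in (X - _)%N]card_ord -(cardC A).
by rewrite addnC addnK; apply: eq_card.
Qed.

Lemma cofactor_delta_mx (K : comNzRingType) (n : nat) (A : 'M[K]_n) (t : K)
    (i j k : 'I_n) : cofactor (A + t *: delta_mx i j) i k = cofactor A i k.
Proof.
congr (_ * \det _); apply/matrixP => a b; rewrite !mxE.
by rewrite eq_sym (negPf (neq_lift _ _)) /= mulr0 addr0.
Qed.

Lemma det_delta_mx (K : comNzRingType) (n : nat) (A : 'M[K]_n) (t : K)
    (i j : 'I_n) :
  \det (A + t *: delta_mx i j) = \det A + t * cofactor A i j.
Proof.
rewrite !(expand_det_row _ i).
under eq_bigr => k _ do rewrite cofactor_delta_mx !mxE eqxx /= mulrDl.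
rewrite big_split /=; congr (_ + _).
rewrite (bigD1 j) //= eqxx mulr1 big1 ?addr0 // => k /negPf ->.
by rewrite mulr0 mul0r.
Qed.

(** The matrix determinant lemma; the cofactors come from the inverse of M. *)
Lemma det_rank1 (K : fieldType) (n : nat) (M : 'M[K]_n) (xi : 'I_n -> K)
    (c : K) : \det M != 0 ->
  \det (M + \matrix_(i, j) (c * xi i * xi j)) =
  \det M + c * \sum_i \sum_j cofactor M i j * xi i * xi j.
Proof.
move=> dM; have uM : M \in unitmx by rewrite unitmxE unitfE.
have -> : M + \matrix_(i, j) (c * xi i * xi j) =
    M *m (1%:M + (c *: (invmx M *m (\col_i xi i))) *m (\row_j xi j)).
  rewrite mulmxDr mulmx1 -scalemxAl -scalemxAr !mulmxA mulmxV // mul1mx.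
  congr (_ + _); apply/matrixP => i j.
  by rewrite !mxE big_ord1 !mxE mulrA.
rewrite det_mulmx det_add1_mulmxC det_mx11 mxE mulrDr mxE eqxx mulr1.
congr (_ + _); rewrite -scalemxAr mxE mulrCA; congr (_ * _).
rewrite /invmx uM -scalemxAl -scalemxAr mxE mulrA divff // mul1r.
rewrite mxE; under eq_bigr => j _ do rewrite mxE [X in _ * X]mxE mulr_sumr.
rewrite exchange_big /=; apply: eq_bigr => i _; apply: eq_bigr => j _.
rewrite !mxE; ring.
Qed.

(** * Polynomials without zeros in the upper half-plane *)

Lemma Im_inv_ge0 (C : numClosedFieldType) (z : C) :
  0 <= 'Im z -> 'Im z^-1 <= 0.
Proof.
move=> z0; rewrite invC_norm ImMl ?realV ?realX ?normr_real //.
by rewrite Im_conj mulrN oppr_le0 mulr_ge0 // invr_ge0 exprn_ge0.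
Qed.

Lemma Im_inv_gt0 (C : numClosedFieldType) (z : C) :
  0 < 'Im z -> 'Im z^-1 < 0.
Proof.
move=> z0; rewrite invC_norm ImMl ?realV ?realX ?normr_real //.
rewrite Im_conj mulrN oppr_lt0 mulr_gt0 // invr_gt0 exprn_gt0 // normr_gt0.
by apply: contraTneq z0 => ->; rewrite raddf0 ltxx.
Qed.

Lemma horner_prod_logderiv (K : fieldType) (s : seq K) (z : K) :
  let f := \prod_(r <- s) ('X - r%:P) in
  f.[z] != 0 -> f^`().[z] / f.[z] = \sum_(r <- s) (z - r)^-1.
Proof.
move=> /=; elim: s => [|r s IH]; first by rewrite !big_nil derivC horner0 mul0r.
rewrite !big_cons derivM !hornerE; rewrite derivXsubC hornerC mul1r.
rewrite mulf_eq0 negb_or => /andP[rz fz]; rewrite -IH //.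
by field; rewrite rz fz.
Qed.

(** Stability in the sense of Hermite and Biehler. *)
Definition uhp_stable (C : numClosedFieldType) (f : {poly C}) : Prop :=
  forall z, 0 < 'Im z -> f.[z] != 0.

(** [f'/f] is the sum of [1/(z - r)] over the roots r of f, and Im r <= 0 for
    each of them. *)
Lemma uhp_stable_logderiv (C : numClosedFieldType) (f : {poly C}) (z : C) :
  uhp_stable f -> 0 <= 'Im z -> f.[z] != 0 -> 'Im (f^`().[z] / f.[z]) <= 0.
Proof.
move=> st z0 fz; have [s Es] := closed_field_poly_normal f.
have lf : lead_coef f != 0 by apply: contraNneq fz => l0; rewrite Es l0 scale0r horner0.
move: (fz); rewrite Es derivZ !hornerZ mulf_eq0 negb_or => /andP[_ gz].
rewrite -mulf_div divff // mul1r horner_prod_logderiv // raddf_sum /=.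
rewrite big_seq sumr_le0 // => r rs; apply: Im_inv_ge0.
rewrite raddfB /= subr_ge0 (le_trans _ z0) // real_leNgt ?Creal_Im //.
by apply/negP => /st /negP; apply; rewrite -rootE Es rootZ // root_prod_XsubC.
Qed.

(** The theorem of Gauss and Lucas for a half-plane: in [f'/f], the sum of the
    [1/(z - r)], every term has negative imaginary part. *)
Lemma uhp_stable_deriv (C : numClosedFieldType) (f : {poly C}) :
  (1 < size f)%N -> uhp_stable f -> uhp_stable f^`().
Proof.
move=> sf st z z0; have fz := st z z0.
have [s Es] := closed_field_poly_normal f.
have lf : lead_coef f != 0 by apply: contraNneq fz => l0; rewrite Es l0 scale0r horner0.
apply/negP => /eqP dz.
have : 'Im (f^`().[z] / f.[z]) = 0 by rewrite dz mul0r raddf0.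
move: (fz); rewrite Es derivZ !hornerZ mulf_eq0 negb_or => /andP[_ gz].
rewrite -mulf_div divff // mul1r horner_prod_logderiv // raddf_sum /=.
have: (0 < size s)%N.
  by move: sf; rewrite Es size_scale // size_prod_XsubC ltnS.
have rs r : r \in s -> 'Im (z - r)^-1 < 0.
  move=> rs; apply: Im_inv_gt0.
  rewrite raddfB /= subr_gt0 (le_lt_trans _ z0) // real_leNgt ?Creal_Im //.
  by apply/negP => /st /negP; apply; rewrite -rootE Es rootZ // root_prod_XsubC.
case: s rs {Es gz} => // r s rs _ /eqP; apply/negP.
rewrite big_cons lt_eqF // ltr_wnDr ?rs ?mem_head //.
by rewrite big_seq sumr_le0 // => q qs; rewrite ltW // rs // in_cons qs orbT.
Qed.

Lemma derivn_horner0 (K : comNzRingType) (f : {poly K}) k :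
  f^`(k).[0] = f`_k *+ k`!.
Proof. by rewrite horner_coef0 coef_derivn addn0 ffactnn. Qed.

Lemma size_derivn_gt (K : numDomainType) (f : {poly K}) j k :
  (j + k < size f)%N -> (j < size f^`(k))%N.
Proof.
move=> jk; have sf : (0 < size f)%N by exact: leq_ltn_trans jk.
have kf : (k <= (size f).-1)%N.
  by rewrite -ltnS prednK // (leq_ltn_trans _ jk) // leq_addl.
rewrite ltnNge; apply/negP => /leq_sizeP /(_ ((size f).-1 - k)%N).
rewrite coef_derivn subnKC // leq_subRL // addnC -ltnS prednK // jk.
move=> /(_ isT) /eqP; rewrite mulrn_eq0 -/(lead_coef f) lead_coef_eq0.
by rewrite -size_poly_eq0 (gtn_eqF sf) orbF -leqn0 leqNgt ffact_gt0 kf.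
Qed.

Lemma uhp_stable_derivn (C : numClosedFieldType) (f : {poly C}) k :
  (k < size f)%N -> uhp_stable f -> uhp_stable f^`(k).
Proof.
elim: k => [|k IH] sf st; first by rewrite derivn0.
rewrite derivnS; apply: uhp_stable_deriv; last by apply: IH => //; exact: ltnW.
by apply: size_derivn_gt; rewrite add1n.
Qed.

(** The logarithmic derivative at 0 of the k-th derivative of f is (k+1)
    f_(k+1) / f_k. *)
Lemma uhp_stable_coef (C : numClosedFieldType) (f : {poly C}) k :
  (k < size f)%N -> uhp_stable f -> 'Im (f`_k.+1 * (f`_k)^*) <= 0.
Proof.
move=> sf st; have [->|fk0] := eqVneq f`_k 0.
  by rewrite rmorph0 mulr0 raddf0.
have := uhp_stable_logderiv (z := 0) (uhp_stable_derivn sf st).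
rewrite raddf0 lexx -derivnS !derivn_horner0 => /(_ isT).
rewrite mulrn_eq0 negb_or fk0 -lt0n fact_gt0 => /(_ isT).
have -> : f`_k.+1 *+ k.+1`! / (f`_k *+ k`!) =
    (k.+1%:R * `|f`_k| ^- 2) * (f`_k.+1 * (f`_k)^*).
  have nz : (k`!)%:R != 0 :> C by rewrite pnatr_eq0 -lt0n fact_gt0.
  rewrite factS -[f`_k.+1 *+ _]mulr_natr -[f`_k *+ _]mulr_natr natrM invfM.
  rewrite (invC_norm f`_k) -[RHS]mulr1 -[X in _ = _ * X](divff nz).
  move: (`|_| ^- 2) ((k`!)%:R^-1) => a b; ring.
rewrite ImMl ?realM ?realV ?realX ?normr_real ?realn //.
by rewrite pmulr_rle0 // mulr_gt0 ?ltr0n // invr_gt0 exprn_gt0 // normr_gt0.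
Qed.

(** The inequality of [uhp_stable_coef] for P + iQ, whose imaginary part is
    the 2 x 2 minor formed by the coefficients of P and Q: one half of the
    Hermite-Biehler theorem. *)
Lemma uhp_stable_real_pair (C : numClosedFieldType) (P Q : {poly C}) k :
  (forall i, P`_i \is Num.real) -> (forall i, Q`_i \is Num.real) ->
  (k < size (P + 'i *: Q)%R)%N -> uhp_stable (P + 'i *: Q) ->
  Q`_k.+1 * P`_k <= P`_k.+1 * Q`_k.
Proof.
move=> Pr Qr sf st; have := uhp_stable_coef sf st.
rewrite !coefD !coefZ rmorphD rmorphM /= conjCi !conj_Creal //.
have -> : (P`_k.+1 + 'i * Q`_k.+1) * (P`_k + - 'i * Q`_k) =
   (P`_k.+1 * P`_k - 'i ^+ 2 * Q`_k.+1 * Q`_k) + 'i * (Q`_k.+1 * P`_k - P`_k.+1 * Q`_k).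
  by ring.
rewrite sqrCi Im_rect ?subr_le0 //.
  by rewrite rpredB ?rpredM ?rpredN ?rpred1.
by rewrite rpredB ?rpredM.
Qed.

Definition hform (C : numClosedFieldType) (n : nat) (S : 'M[C]_n)
    (v : 'I_n -> C) : C :=
  \sum_i \sum_j v i * S i j * (v j)^*.

Lemma hform_real (C : numClosedFieldType) (n : nat) (S : 'M[C]_n)
    (v : 'I_n -> C) :
  (forall i j, S i j \is Num.real) -> (forall i j, S i j = S j i) ->
  hform S v \is Num.real.
Proof.
move=> Sr Ss; apply/CrealP; rewrite /hform rmorph_sum [RHS]exchange_big.
apply: eq_bigr => i _; rewrite rmorph_sum; apply: eq_bigr => j _.
by rewrite !rmorphM /= conjCK (CrealP (Sr _ _)) Ss mulrC mulrA mulrAC.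
Qed.

(** A singular matrix M has a left null vector v, and the equation is [v M v^*
    = 0]. *)
Lemma det0_hform (C : numClosedFieldType) (n : nat) (S : 'M[C]_n)
    (xi : 'I_n -> C) (z : C) :
  (forall i, xi i \is Num.real) ->
  \det (z%:M + S + \matrix_(i, j) ('i * xi i * xi j)) = 0 ->
  exists2 v : 'I_n -> C, 0 < \sum_i v i * (v i)^* &
    z * (\sum_i v i * (v i)^*) + hform S v
      + 'i * (`|\sum_i v i * xi i| ^+ 2) = 0.
Proof.
move=> xr /eqP /det0P[v v0 vM]; exists (v 0).
- have ge0 i : true -> 0 <= v 0 i * (v 0 i)^* by move=> _; rewrite mul_conjC_ge0.
  rewrite lt_def sumr_ge0 // andbT; apply: contra v0 => /eqP s0.
  apply/eqP/rowP => i; rewrite mxE; apply/eqP; rewrite -mul_conjC_eq0.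
  by move/psumr_eq0P: s0 => ->.
have : (v *m (z%:M + S + \matrix_(i, j) ('i * xi i * xi j))) *m
       (\col_j (v 0 j)^*) = 0 by rewrite vM mul0mx.
move=> /matrixP /(_ 0 0); rewrite !mulmxDr !mulmxDl mul_mx_scalar -scalemxAl.
rewrite !mxE => vMv; apply: etrans vMv; congr (_ * _ + _ + _).
- by apply: eq_bigr => i _; rewrite !mxE.
- rewrite /hform exchange_big; apply: eq_bigr => j _.
  by rewrite !mxE mulr_suml; apply: eq_bigr => i _.
rewrite normCK rmorph_sum mulrA [LHS]mulr_sumr; apply: eq_bigr => j _.
rewrite !mxE rmorphM /= (CrealP (xr j)) !mulr_sumr !mulr_suml.
apply: eq_bigr => i _; rewrite mxE; ring.
Qed.

(** Otherwise the imaginary part of the equation in [det0_hform] would say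
    that Im z |v|^2 + |v.xi|^2 = 0. *)
Lemma det_shift_neq0 (C : numClosedFieldType) (n : nat) (S : 'M[C]_n)
    (xi : 'I_n -> C) (z : C) :
  (forall i j, S i j \is Num.real) -> (forall i j, S i j = S j i) ->
  (forall i, xi i \is Num.real) -> 0 < 'Im z ->
  \det (z%:M + S + \matrix_(i, j) ('i * xi i * xi j)) != 0.
Proof.
move=> Sr Ss xr z0; apply/eqP => /(det0_hform xr)[v N0].
move: z0 => /[swap] /(congr1 (fun x : C => 'Im x)) /=.
rewrite !raddfD /= raddf0 ImMr ?gtr0_real // (Creal_ImP _ (hform_real _ _ _)) //.
rewrite addr0 -['i * _]add0r Im_rect ?realX ?normr_real // => /eqP.
rewrite addr_eq0 => /eqP H; rewrite -(pmulr_lgt0 _ N0) H oppr_gt0.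
by rewrite le_gtF // exprn_ge0.
Qed.

Lemma det_shift0_neq0 (C : numClosedFieldType) (n : nat) (S : 'M[C]_n) (z : C) :
  (forall i j, S i j \is Num.real) -> (forall i j, S i j = S j i) ->
  0 < 'Im z -> \det (z%:M + S) != 0.
Proof.
move=> Sr Ss z0; have := det_shift_neq0 (xi := fun=> 0) Sr Ss _ z0.
rewrite (_ : \matrix_(i, j) _ = 0) ?addr0; first exact.
by apply/matrixP => i j; rewrite !mxE mulr0.
Qed.

Lemma hform_rect (C : numClosedFieldType) (n : nat) (S : 'M[C]_n)
    (v : 'I_n -> C) : (forall i j, S i j = S j i) ->
  hform S v = \sum_i \sum_j 'Re (v i) * S i j * 'Re (v j)
    + \sum_i \sum_j 'Im (v i) * S i j * 'Im (v j).
Proof.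
move=> Ss; rewrite /hform.
have -> : \sum_i \sum_j v i * S i j * (v j)^* =
  (\sum_i \sum_j 'Re (v i) * S i j * 'Re (v j)
    + \sum_i \sum_j 'Im (v i) * S i j * 'Im (v j)) +
   'i * (\sum_i \sum_j 'Im (v i) * S i j * 'Re (v j)
          - \sum_i \sum_j 'Re (v i) * S i j * 'Im (v j)).
  rewrite -sumrB -big_split mulr_sumr -big_split; apply: eq_bigr => i _ /=.
  rewrite -sumrB -big_split mulr_sumr -big_split; apply: eq_bigr => j _ /=.
  rewrite {1}(Crect (v i)) {1}(Crect (v j)) rmorphD rmorphM /= conjCi.
  rewrite !conj_Creal ?Creal_Re ?Creal_Im //.
  set a := 'Re _; set b := 'Im _; set c := 'Re _; set d := 'Im _.
  have -> : (a + 'i * b) * S i j * (c + - 'i * d) =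
    a * S i j * c - 'i ^+ 2 * (b * S i j * d)
     + 'i * (b * S i j * c - a * S i j * d) by ring.
  by rewrite sqrCi mulN1r opprK.
rewrite [X in 'i * (X - _)]exchange_big /= -sumrB [X in 'i * X]big1 ?mulr0 ?addr0 // => i _.
rewrite -sumrB big1 // => j _; rewrite Ss; ring.
Qed.

Lemma real_coef_conj_root (C : numClosedFieldType) (f : {poly C}) (r : C) :
  (forall i, f`_i \is Num.real) -> root f r -> root f r^*.
Proof.
move=> fr; rewrite !rootE !horner_coef => /eqP r0.
rewrite -(inj_eq (inv_inj (@conjCK C))) rmorph0 rmorph_sum; apply/eqP; apply: etrans r0.
by apply: eq_bigr => i _; rewrite rmorphM rmorphXn /= conjCK conj_Creal.
Qed.

(** The roots of f lie in the closed lower half-plane and come in conjugate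
    pairs. *)
Lemma uhp_stable_real_root (C : numClosedFieldType) (f : {poly C}) (r : C) :
  (forall i, f`_i \is Num.real) -> uhp_stable f -> root f r -> r \is Num.real.
Proof.
move=> fr st rr; apply/Creal_ImP/le_anti/andP; split.
  rewrite real_leNgt ?Creal_Im //; apply/negP => /st; by rewrite -rootE rr.
rewrite -oppr_le0 -Im_conj real_leNgt ?Creal_Im //; apply/negP => /st.
by rewrite -rootE real_coef_conj_root.
Qed.

(** The roots are real, hence negative since f is positive on [0, oo); and f_1
    / f_0 is the sum of their -1/r. *)
Lemma uhp_stable_coef_gt0 (C : numClosedFieldType) (f : {poly C}) :
  (1 < size f)%N -> uhp_stable f -> (forall i, 0 <= f`_i) -> 0 < f`_0 ->
  0 < f`_1.
Proof.
move=> sf st f_ge0 f0.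
have fr i : f`_i \is Num.real by rewrite ger0_real.
have [s Es] := closed_field_poly_normal f.
have neg r : r \in s -> r < 0.
  move=> rs; have rr : root f r.
    by rewrite Es rootZ ?root_prod_XsubC // lead_coef_eq0 -size_poly_gt0 ltnW.
  rewrite real_ltNge ?(uhp_stable_real_root fr st rr) //; apply/negP => r0.
  move: rr; rewrite rootE horner_coef -(prednK (ltnW sf)) big_ord_recl.
  rewrite expr0 mulr1 gt_eqF // ltr_wpDr // sumr_ge0 // => i _.
  by rewrite mulr_ge0 ?exprn_ge0.
have lf : lead_coef f != 0 by rewrite lead_coef_eq0 -size_poly_gt0 ltnW.
have fz : f.[0] != 0 by rewrite horner_coef0 gt_eqF.
have : 0 < f^`().[0] / f.[0].
  move: (fz); rewrite Es derivZ !hornerZ mulf_eq0 negb_or => /andP[_ gz].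
  rewrite -mulf_div divff // mul1r horner_prod_logderiv //.
  have: (0 < size s)%N.
    by move: sf; rewrite Es size_scale // size_prod_XsubC ltnS.
  case: s neg {Es gz} => // r s neg _.
  rewrite big_cons ltr_pwDl // ?sub0r ?invr_gt0 ?oppr_gt0 ?neg ?mem_head //.
  rewrite big_seq sumr_ge0 // => q qs.
  by rewrite sub0r invr_ge0 oppr_ge0 ltW // neg // in_cons qs orbT.
by rewrite !horner_coef0 coef_deriv mulr1n pmulr_lgt0 // invr_gt0.
Qed.

Lemma nonpos_roots_coef_ge0 (C : numDomainType) (s : seq C) i :
  (forall r, r \in s -> r <= 0) -> 0 <= (\prod_(r <- s) ('X - r%:P))`_i.
Proof.
elim: s i => [|r s IH] i neg; first by rewrite big_nil coef1 ler0n.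
have IHs k : 0 <= (\prod_(r <- s) ('X - r%:P))`_k.
  by apply: IH => q qs; apply: neg; rewrite in_cons qs orbT.
rewrite big_cons mulrBl coefB coefXM coefCM subr_ge0 (@le_trans _ _ 0) //.
  by rewrite mulr_le0_ge0 // neg // mem_head.
by case: ifP.
Qed.

(** * The p-traces and their first derivatives *)

Definition minor_sum (K : comNzRingType) (n p : nat) (S : 'M[K]_n) : K :=
  \sum_(A : {set 'I_n} | #|A| == p) \det (trunc_mx A S).

(** The partial derivative of T_p with respect to S_ij: for i outside A, row i
    of the truncated matrix is constant. *)
Definition minor_deriv (K : comNzRingType) (n p : nat) (i j : 'I_n)
    (S : 'M[K]_n) : K :=
  \sum_(A : {set 'I_n} | (#|A| == p) && (i \in A)) cofactor (trunc_mx A S) i j.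

(** T_p is affine in each single entry. *)
Lemma minor_sum_delta (K : comNzRingType) (n p : nat) (i j : 'I_n)
    (S : 'M[K]_n) (t : K) :
  minor_sum p (S + t *: delta_mx i j) = minor_sum p S + t * minor_deriv p i j S.
Proof.
rewrite /minor_sum /minor_deriv mulr_sumr [X in _ = _ + X]big_mkcondr -big_split.
apply: eq_bigr => A _; case: ifPn => iA /=.
  rewrite -det_delta_mx; congr (\det _); apply/matrixP => a b; rewrite !mxE.
  case: ifPn => // aA; have /negPf -> : a != i by apply: contraNneq aA => ->.
  by rewrite mulr0 addr0.
rewrite addr0; congr (\det _); apply/matrixP => a b; rewrite !mxE.
case: ifPn => // aA; have /negPf -> : a != i by apply: contraNneq iA => <-.
by rewrite mulr0 addr0.
Qed.

Lemma minor_sum0 (K : comNzRingType) (n : nat) (S : 'M[K]_n) :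
  minor_sum 0 S = 1.
Proof.
rewrite /minor_sum (big_pred1 finset.set0) => [|A]; last by rewrite /= cards_eq0.
rewrite -[RHS](det1 K n); congr (\det _).
by apply/matrixP => i j; rewrite !mxE inE.
Qed.

Lemma minor_deriv0 (K : comNzRingType) (n : nat) (i j : 'I_n) (S : 'M[K]_n) :
  minor_deriv 0 i j S = 0.
Proof.
rewrite /minor_deriv big1 // => A /andP[]; rewrite cards_eq0 => /eqP ->.
by rewrite inE.
Qed.

(** Euler's identity for the p-homogeneous T_p: the minor of A is expanded
    along each of its p rows. *)
Lemma minor_deriv_euler (K : comNzRingType) (n p : nat) (S : 'M[K]_n) :
  \sum_i \sum_j minor_deriv p i j S * S i j = p%:R * minor_sum p S.
Proof.
rewrite /minor_sum mulr_sumr.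
under eq_bigr => i _ do under eq_bigr => j _ do
  rewrite /minor_deriv mulr_suml big_mkcondr.
under eq_bigr => i _ do rewrite exchange_big /=.
rewrite exchange_big; apply: eq_bigr => A /eqP <-.
rewrite (bigID (mem A)) /= [X in _ + X]big1 ?addr0; last first.
  by move=> i /negPf ->; rewrite big1.
rewrite (eq_bigr (fun=> \det (trunc_mx A S))) => [|i iA].
  by rewrite sumr_const mulr_natl.
rewrite (expand_det_row _ i); apply: eq_bigr => j _.
by rewrite iA mxE iA mulrC.
Qed.

(** The characteristic polynomial of -S; its coefficients are the p-traces of
    S. *)
Definition shift_poly (K : comNzRingType) (n : nat) (S : 'M[K]_n) : {poly K} :=
  \det ('X%:M + map_mx polyC S).

Lemma size_shift_poly (K : comNzRingType) (n : nat) (S : 'M[K]_n) :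
  size (shift_poly S) = n.+1.
Proof.
rewrite -(size_char_poly (- S)) /char_poly /char_poly_mx /shift_poly.
by rewrite map_mxN opprK.
Qed.

Lemma coef_shift_poly (K : comNzRingType) (n p : nat) (S : 'M[K]_n) :
  (p <= n)%N -> (shift_poly S)`_(n - p) = minor_sum p S.
Proof.
move=> pn; rewrite /shift_poly det_scalar_add coef_sum /minor_sum [RHS]big_mkcond.
apply: eq_bigr => A _; have -> : trunc_mx A (map_mx polyC S) =
    map_mx polyC (trunc_mx A S).
  by apply/matrixP => i j; rewrite !mxE; case: ifP => //; rewrite polyC_natr.
rewrite det_map_mx coefMC coefXn.
have An : (#|A| <= n)%N by rewrite -[X in (_ <= X)%N]card_ord max_card.
case: (eqVneq #|A| p) => [->|nA]; first by rewrite eqxx mul1r.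
case: eqP => [e|]; last by rewrite mul0r.
by case/negP: nA; rewrite -(subKn An) -e subKn.
Qed.

(** Both sides are the increment caused by adding 1 to the entry S_ij. *)
Lemma coef_cofactor (K : comNzRingType) (n p : nat) (i j : 'I_n) (S : 'M[K]_n) :
  (p <= n)%N ->
  (cofactor ('X%:M + map_mx polyC S) i j)`_(n - p) = minor_deriv p i j S.
Proof.
move=> pn; have := minor_sum_delta p i j S 1.
rewrite scale1r mul1r -!coef_shift_poly // /shift_poly map_mxD map_delta_mx.
by rewrite addrA -[delta_mx i j]scale1r det_delta_mx mul1r coefD => /addrI.
Qed.

(** * Positivity and Newton inequalities for p-traces *)

Section real.
Variables (R : rcfType) (n : nat) (S : 'M[R]_n).
Hypothesis Ssym : forall i j, S i j = S j i.
Local Notation iota := (real_complex R).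

Let iota_real (x : R) : iota x \is Num.real.
Proof. by rewrite complex_real. Qed.

Let map_iota_real (f : {poly R}) i : (map_poly iota f)`_i \is Num.real.
Proof. by rewrite coef_map iota_real. Qed.

Lemma horner_shift_poly (z : R[i]) :
  (map_poly iota (shift_poly S)).[z] = \det (z%:M + map_mx iota S).
Proof.
transitivity (\det (map_mx (horner_eval z \o map_poly iota)
  ('X%:M + map_mx polyC S))); first by rewrite det_map_mx.
congr (\det _); apply/matrixP => i j; rewrite !mxE /= /horner_eval.
rewrite rmorphD rmorphMn /= map_polyC map_polyX hornerD hornerMn.
by rewrite hornerX hornerC.
Qed.

Lemma horner_cofactor (z : R[i]) (i j : 'I_n) :
  (map_poly iota (cofactor ('X%:M + map_mx polyC S) i j)).[z] =
  cofactor (z%:M + map_mx iota S) i j.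
Proof.
pose ev := horner_eval z \o map_poly iota.
transitivity (cofactor (map_mx ev ('X%:M + map_mx polyC S)) i j).
  by rewrite cofactor_map_mx.
congr (cofactor _ _ _); apply/matrixP => a b; rewrite !mxE /ev /= /horner_eval.
rewrite rmorphD rmorphMn /= map_polyC map_polyX hornerD hornerMn.
by rewrite hornerX hornerC.
Qed.

Lemma uhp_stable_shift_poly : uhp_stable (map_poly iota (shift_poly S)).
Proof.
move=> z z0; rewrite horner_shift_poly det_shift0_neq0 // => i j; rewrite !mxE //.
by rewrite Ssym.
Qed.

(** The derivative of order n-p-1 of det(X + S) is stable with nonnegative
    coefficients; its first two coefficients are multiples of T_(p+1) and T_p.
    *)
Lemma minor_sum_descent p : (p < n)%N ->
  (forall j, (j <= p.+1)%N -> 0 <= minor_sum j S) -> 0 < minor_sum p.+1 S ->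
  0 < minor_sum p S.
Proof.
move=> pn T_ge0 Tp.
pose f := (map_poly iota (shift_poly S))^`(n - p.+1).
have cf i : f`_i = iota ((shift_poly S)`_(n - p.+1 + i) *+ (n - p.+1 + i) ^_ (n - p.+1)).
  by rewrite /f coef_derivn coef_map /= -rmorphMn.
have ff k : (0 < (n - p.+1 + k) ^_ (n - p.+1))%N by rewrite ffact_gt0 leq_addr.
have e1 : (n - p.+1 + 1 = n - p)%N by rewrite addn1 subnSK.
have : 0 < f`_1.
  apply: uhp_stable_coef_gt0.
  - by rewrite /f size_derivn_gt // size_map_poly size_shift_poly add1n subnSK // ltnS leq_subr.
  - apply: uhp_stable_derivn; last exact: uhp_stable_shift_poly.
    by rewrite size_map_poly size_shift_poly ltnS leq_subr.
  - move=> i; rewrite cf -[0](rmorph0 iota) lecR mulrn_wge0 //.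
    have [ip|ip] := leqP i p.+1; last first.
      by rewrite nth_default // size_shift_poly; lia.
    have -> : (n - p.+1 + i = n - (p.+1 - i))%N by lia.
    rewrite coef_shift_poly ?T_ge0 ?leq_subr //.
    lia.
  - by rewrite cf addn0 coef_shift_poly // -[0](rmorph0 iota) ltcR pmulrn_lgt0 ?ffactnn ?fact_gt0.
rewrite cf e1 coef_shift_poly ?(ltnW pn) // -[0](rmorph0 iota) ltcR.
by rewrite pmulrn_lgt0 // -e1 ff.
Qed.

(** All roots of det(X + S) are nonpositive: det(r + S) = 0 gives r |v|^2 +
    S(v, v) = 0 for some v. *)
Lemma psd_minor_sum_ge0 p : (p <= n)%N ->
  (forall v : 'I_n -> R, 0 <= \sum_i \sum_j v i * S i j * v j) ->
  0 <= minor_sum p S.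
Proof.
move=> pn psd; rewrite -coef_shift_poly // -lecR rmorph0 -coef_map.
set f := map_poly _ _.
have sSr i j : map_mx iota S i j = map_mx iota S j i by rewrite !mxE Ssym.
have [s Es] := closed_field_poly_normal f.
have f1 : lead_coef f = 1.
  rewrite lead_coef_map /shift_poly; have := char_poly_monic (- S).
  by rewrite /char_poly /char_poly_mx map_mxN opprK => /monicP ->; rewrite rmorph1.
rewrite Es f1 scale1r; apply: nonpos_roots_coef_ge0 => r rs.
have : root f r by rewrite Es f1 scale1r root_prod_XsubC.
rewrite rootE horner_shift_poly => /eqP r0.
have [||v N0] := @det0_hform _ n (map_mx iota S) (fun=> 0) r.
- by move=> i; exact: rpred0.
- apply: etrans r0; congr (\det _); apply/matrixP => i j; rewrite !mxE.
  by rewrite /= !mulr0 addr0.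
rewrite [X in `|X|]big1 => [|i _]; last by rewrite mulr0.
rewrite normr0 expr0n mulr0 addr0 => /eqP; rewrite addr_eq0 => /eqP rN.
rewrite -(pmulr_lle0 _ N0) rN oppr_le0 hform_rect //.
have H (a : 'I_n -> R[i]) : (forall i, a i \is Num.real) ->
    0 <= \sum_i \sum_j a i * map_mx iota S i j * a j.
  move=> ar; have := psd (fun i => complex.Re (a i)); rewrite -lecR rmorph0.
  rewrite rmorph_sum; congr (_ <= _); apply: eq_bigr => i _.
  rewrite rmorph_sum; apply: eq_bigr => j _.
  by rewrite !rmorphM /= !RRe_real // mxE.
by rewrite addr_ge0 // H // => i; rewrite ?Creal_Re ?Creal_Im.
Qed.

(** The derivative of T_p in the direction [xi xi^T]. *)
Definition minor_deriv_form (xi : 'I_n -> R) (p : nat) : R :=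
  \sum_i \sum_j minor_deriv p i j S * xi i * xi j.

(** The polynomial det(X + S + i xi xi^T) = P + i Q has no zero in the upper
    half-plane. The coefficients of P = det(X + S) are the p-traces and those
    of Q their derivatives along [xi xi^T], so the inequality is that of
    [uhp_stable_real_pair]. *)
Lemma minor_sum_newton (xi : 'I_n -> R) p : (p < n)%N ->
  minor_deriv_form xi p * minor_sum p.+1 S <=
  minor_sum p S * minor_deriv_form xi p.+1.
Proof.
move=> pn.
pose Q := \sum_i \sum_j
  cofactor ('X%:M + map_mx polyC S) i j * (xi i)%:P * (xi j)%:P.
have cQ q : (q <= n)%N -> Q`_(n - q) = minor_deriv_form xi q.
  move=> qn; rewrite coef_sum; apply: eq_bigr => i _; rewrite coef_sum.
  by apply: eq_bigr => j _; rewrite !coefMC coef_cofactor.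
have := @uhp_stable_real_pair _ _ _ (n - p.+1)
  (map_iota_real (shift_poly S)) (map_iota_real Q).
rewrite !coef_map subnSK // !coef_shift_poly // ?(ltnW pn) // !cQ ?(ltnW pn) //.
rewrite -!rmorphM lecR; apply=> //.
  apply: (@leq_trans n); first exact: leq_subr.
  apply: ltnW.
  (* The coefficient of X^n in P + i Q is 1. *)
  rewrite ltnNge; apply/negP => /leq_sizeP /(_ (n - 0)%N).
  rewrite {1}subn0 leqnn => /(_ isT) /eqP; rewrite coefD coefZ !coef_map coef_shift_poly // cQ //.
  rewrite minor_sum0 (_ : minor_deriv_form xi 0 = 0) ?rmorph1 ?rmorph0 ?mulr0 ?addr0 ?oner_eq0 //.
  by apply: big1 => i _; apply: big1 => j _; rewrite minor_deriv0 !mul0r.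
move=> z z0; rewrite hornerD hornerZ horner_shift_poly.
have -> : (map_poly iota Q).[z] = \sum_i \sum_j
    cofactor (z%:M + map_mx iota S) i j * iota (xi i) * iota (xi j).
  rewrite /Q rmorph_sum horner_sum; apply: eq_bigr => i _.
  rewrite rmorph_sum horner_sum; apply: eq_bigr => j _.
  rewrite -horner_cofactor; move: (cofactor _ _ _) => c.
  by rewrite !rmorphM /= !map_polyC !hornerM !hornerC.
have dz : \det (z%:M + map_mx iota S) != 0.
  rewrite det_shift0_neq0 // => i j; rewrite !mxE //.
  by rewrite Ssym.
have iS a b : map_mx iota S a b \is Num.real by rewrite mxE.
have sS a b : map_mx iota S a b = map_mx iota S b a by rewrite !mxE Ssym.
have := det_shift_neq0 iS sS (fun a => iota_real (xi a)) z0.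
by rewrite (det_rank1 (fun a => iota (xi a))).
Qed.
End real.

(** The Newton inequalities say that D_k / T_k increases with k as long as the
    T_k are positive. *)
Lemma minor_deriv_form_mono (R : rcfType) (n : nat) (S : 'M[R]_n)
    (xi : 'I_n -> R) (l m : nat) :
  (forall i j, S i j = S j i) -> (l <= m)%N -> (m <= n)%N ->
  (forall p, (p <= m)%N -> 0 < minor_sum p S) ->
  minor_sum m S = minor_sum l S ->
  minor_deriv_form S xi l <= minor_deriv_form S xi m.
Proof.
move=> Ss lm mn T0 Tml.
suff H k : (l <= k)%N -> (k <= m)%N ->
   minor_deriv_form S xi l * minor_sum k S <=
   minor_sum l S * minor_deriv_form S xi k.
  by have := H m lm (leqnn m); rewrite Tml mulrC ler_pM2l // T0.
elim: k => [|k IH]; first by rewrite leqn0 => /eqP -> _; rewrite mulrC.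
rewrite leq_eqVlt => /predU1P[<- _|]; first by rewrite mulrC.
rewrite ltnS => lk km; have Tk := T0 k (ltnW km).
rewrite -(ler_pM2r Tk) mulrAC.
have H1 : minor_deriv_form S xi l * minor_sum k S * minor_sum k.+1 S <=
    minor_sum l S * minor_deriv_form S xi k * minor_sum k.+1 S.
  by rewrite ler_pM2r ?T0 // IH // ltnW.
apply: (le_trans H1); rewrite -!mulrA ler_pM2l ?T0 // [leRHS]mulrC.
by apply: minor_sum_newton => //; rewrite (leq_trans km).
Qed.

(** * Classes of functions stable under ring operations *)

(* The p-traces of a matrix-valued function and their derivatives are
   polynomials in its entries, so they stay in any class of functions that
   contains the constants and is closed under sums and products.
   Smoothness, bounded convergence and continuity up to the boundary are
   instances. *)
Section ring_class.
Variables (R : comNzRingType) (T : Type) (K : (T -> R) -> Prop).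
Hypotheses (K_cst : forall c, K (fun=> c))
  (K_add : forall f g, K f -> K g -> K (fun x => f x + g x))
  (K_mul : forall f g, K f -> K g -> K (fun x => f x * g x)).

Lemma ring_class_sum (I : Type) (r : seq I) (P : pred I) (F : I -> T -> R) :
  (forall i, P i -> K (F i)) -> K (fun x => \sum_(i <- r | P i) F i x).
Proof.
move=> H; elim: r => [|i r IH].
  by rewrite (_ : (fun x => _) = fun=> 0) //; apply/funext => x; rewrite big_nil.
have [Pi|Pi] := boolP (P i).
  rewrite (_ : (fun x => _) = fun x => F i x + \sum_(i <- r | P i) F i x).
    by apply: K_add => //; exact: H.
  by apply/funext => x; rewrite big_cons Pi.
rewrite (_ : (fun x => _) = fun x => \sum_(i <- r | P i) F i x) //.
by apply/funext => x; rewrite big_cons (negPf Pi).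
Qed.

Lemma ring_class_prod (I : Type) (r : seq I) (F : I -> T -> R) :
  (forall i, K (F i)) -> K (fun x => \prod_(i <- r) F i x).
Proof.
move=> H; elim: r => [|i r IH].
  by rewrite (_ : (fun x => _) = fun=> 1) //; apply/funext => x; rewrite big_nil.
rewrite (_ : (fun x => _) = fun x => F i x * \prod_(i <- r) F i x).
  exact: K_mul.
by apply/funext => x; rewrite big_cons.
Qed.

Variables (m : nat) (M : T -> 'M[R]_m).
Hypothesis K_M : forall i j, K (fun x => M x i j).

Lemma ring_class_trunc (A : {set 'I_m}) i j : K (fun x => trunc_mx A (M x) i j).
Proof.
rewrite (_ : (fun x => _) = fun x => if i \in A then M x i j else (i == j)%:R).
  by case: (i \in A).
by apply/funext => x; rewrite mxE.
Qed.
End ring_class.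

Section ring_class_minors.
Variables (R : comNzRingType) (T : Type) (K : (T -> R) -> Prop).
Hypotheses (K_cst : forall c, K (fun=> c))
  (K_add : forall f g, K f -> K g -> K (fun x => f x + g x))
  (K_mul : forall f g, K f -> K g -> K (fun x => f x * g x)).

Lemma ring_class_det (m : nat) (M : T -> 'M[R]_m) :
  (forall i j, K (fun x => M x i j)) -> K (fun x => \det (M x)).
Proof.
move=> H; apply: ring_class_sum => // s _; apply: K_mul => //.
exact: ring_class_prod.
Qed.

Lemma ring_class_cofactor (m : nat) (M : T -> 'M[R]_m) a b :
  (forall i j, K (fun x => M x i j)) -> K (fun x => cofactor (M x) a b).
Proof.
move=> H; apply: K_mul => //; apply: ring_class_det => i j.
rewrite (_ : (fun x => _) = fun x => M x (lift a i) (lift b j)) //.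
by apply/funext => x; rewrite !mxE.
Qed.

Lemma ring_class_minor_sum (m p : nat) (M : T -> 'M[R]_m) :
  (forall i j, K (fun x => M x i j)) -> K (fun x => minor_sum p (M x)).
Proof.
move=> H; apply: ring_class_sum => // A _; apply: ring_class_det.
exact: ring_class_trunc.
Qed.

Lemma ring_class_minor_deriv (m p : nat) i j (M : T -> 'M[R]_m) :
  (forall i j, K (fun x => M x i j)) -> K (fun x => minor_deriv p i j (M x)).
Proof.
move=> H; apply: ring_class_sum => // A _; apply: ring_class_cofactor.
exact: ring_class_trunc.
Qed.
End ring_class_minors.

(** * Lebesgue measure and integration on R^n *)

Lemma cvg_mxP (T : Type) (F : set_system T) (FF : Filter F) (R : realType)
    (m n : nat) (f : T -> 'M[R]_(m, n)) (M : 'M[R]_(m, n)) :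
  (forall i j, f x i j @[x --> F] --> M i j) -> f x @[x --> F] --> M.
Proof.
move=> cf; apply/cvg_ballP => e e0.
have H : \forall x \near F, forall ij : 'I_m * 'I_n,
    ball (M ij.1 ij.2) e (f x ij.1 ij.2).
  by apply: filter_forall => -[i j] /=; move/cvg_ballP: (cf i j); apply.
by apply: filterS H => x H; split => // i j; exact: (H (i, j)).
Qed.

Lemma ler_coord_norm (R : realType) (n : nat) (x : 'rV[R]_n) (i : 'I_n) :
  `|x 0 i| <= `|x|.
Proof.
rewrite /Num.Def.normr /= mx_normrE.
exact: (@le_bigmax _ _ _ _ (fun ij : 'I_1 * 'I_n => `|x ij.1 ij.2|) (0, i)).
Qed.

Lemma norm_delta_le1 (R : realType) (n : nat) (i : 'I_n) :
  `|delta_mx 0 i : 'rV[R]_n| <= 1.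
Proof.
rewrite /Num.Def.normr /= mx_normrE; apply/bigmax_leP; split => // -[a b] _ /=.
by rewrite mxE; case: (_ && _); rewrite ?normr1 ?normr0.
Qed.

Lemma mx_ball_rowP (R : realType) (n : nat) (x y : 'rV[R]_n) (e : R) :
  0 < e -> ball x e y <-> forall i, `|x 0 i - y 0 i| < e.
Proof.
move=> e0; split=> [[_ H] i|H]; first exact: H.
by split => // i j; rewrite ord1; exact: H.
Qed.

Section leb_measurability.
Variables (R : realType) (n : nat).
Local Notation tup := (n.-tuple (measurableTypeR R)).

(** An open set is the union of the boxes with rational centre and radius that
    it contains, since R^n carries the max norm. *)
Lemma measurable_open_row (U : set 'rV[R]_n) :
  open U -> measurable (@row_of_tuple R n @^-1` U).
Proof.
move=> oU.
pose A (q : 'rV[rat]_n * rat) (i : 'I_n) : set (measurableTypeR R) :=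
  [set` `](ratr (q.1 0 i) - ratr q.2 : R), (ratr (q.1 0 i) + ratr q.2 : R)[].
pose B (q : 'rV[rat]_n * rat) : set tup :=
  \bigcap_(i in [set: 'I_n]) ((fun t : tup => tnth t i) @^-1` A q i).
pose J := [set q : 'rV[rat]_n * rat | B q `<=` @row_of_tuple R n @^-1` U].
have mB q : measurable (B q).
  apply: fin_bigcap_measurable => [|i _]; first exact: finite_finset.
  rewrite -[X in measurable X]setTI; apply: measurable_tnth => //.
  exact: measurable_itv.
suff -> : @row_of_tuple R n @^-1` U = \bigcup_(q in J) B q.
  rewrite bigcup_mkcond; apply: countable_bigcupT_measurable => //.
  by move=> q; case: ifP.
apply/seteqP; split => [t Ut|t [q /= qJ]]; last by move=> /qJ.
have /nbhs_ballP[e /= e0 eU] : nbhs (row_of_tuple t) U by exact: open_nbhs_nbhs.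
have [r] := rat_in_itvoo (divr_gt0 e0 (ltr0n R 2)); rewrite in_itv /= => /andP[r0 re].
have Hq i : exists q : rat, `|ratr q - (tnth t i : R)| < ratr r.
  have [q] := @rat_in_itvoo R (tnth t i) (tnth t i + ratr r) (ltr_pwDr r0 (lexx _)).
  rewrite in_itv /= => /andP[tq qt]; exists q.
  by rewrite gtr0_norm ?subr_gt0 // ltrBlDr addrC.
pose q : 'rV[rat]_n := \row_i xchoose (Hq i).
have qE i : `|ratr (q 0 i) - (tnth t i : R)| < ratr r by rewrite mxE; exact: (xchooseP (Hq i)).
exists (q, r) => /=; last first.
  move=> i _; rewrite /A /= in_itv /=.
  have := qE i; rewrite ltr_distl => /andP[h1 h2].
  by rewrite ltrBlDr h2 /= -ltrBlDr h1.
move=> s Bs; apply: eU; apply/mx_ball_rowP => // i; rewrite !mxE.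
have := Bs i I; rewrite /A /= in_itv /= => /andP[s1 s2].
have := qE i; rewrite ltr_distl => /andP[q1 q2].
rewrite ltr_distl; apply/andP; split; lra.
Qed.

Lemma measurable_fun_open_row (U : set 'rV[R]_n) (f : 'rV[R]_n -> R) :
  open U -> (forall x, U x -> {for x, continuous f}) ->
  measurable_fun (@row_of_tuple R n @^-1` U) (f \o @row_of_tuple R n).
Proof.
move=> oU cf mU; apply: (measurability _ (RGenOInfty.measurableE R)) => //.
move=> _ [_ [x ->] <-]; rewrite [X in measurable X]
  (_ : _ = @row_of_tuple R n @^-1` (U `&` f @^-1` `]x, +oo[)) //.
apply: measurable_open_row; rewrite openE => y [Uy fy].
apply: filterI; first exact: open_nbhs_nbhs.
apply: (cf y Uy); apply: open_nbhs_nbhs; split => //.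
Qed.
End leb_measurability.

Definition box (R : realType) (n : nat) (M : R) :
    set (n.-tuple (measurableTypeR R)) :=
  [set t | forall i, `|tnth t i : R| <= M].
Arguments box {R} n M.

Lemma measurable_box (R : realType) (n : nat) (M : R) : measurable (@box R n M).
Proof.
rewrite (_ : box _ _ = \bigcap_(i in [set: 'I_n])
  ((fun t : n.-tuple (measurableTypeR R) => tnth t i) @^-1`
   ([set` `[- M, M]] : set (measurableTypeR R)))).
  apply: fin_bigcap_measurable => [|i _]; first exact: finite_finset.
  rewrite -[X in measurable X]setTI; apply: measurable_tnth => //.
apply/seteqP; split => t /= tM i; first by move=> _; rewrite /= in_itv /= -ler_norml.
by have := tM i I; rewrite /= in_itv /= -ler_norml.
Qed.

Lemma leb_box_lty (R : realType) (n : nat) (M : R) : (leb R n (box n M) < +oo)%E.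
Proof.
elim: n => [|n IH] /=; first by rewrite diracE ltry.
rewrite /leb_step /pushforward.
have -> : @cons_pair R n @^-1` box n.+1 M = [set` `[- M, M]] `*` box n M.
  apply/seteqP; split => -[x t] /=.
    move=> H; split; first by rewrite /= in_itv /= -ler_norml; exact: (H ord0).
    by move=> i; have := H (lift ord0 i); rewrite tnthS.
  move=> [x0 H] i; have [j ->|->] := unliftP ord0 i; first by rewrite tnthS.
  by move: x0; rewrite /= in_itv /= -ler_norml.
rewrite product_measure2E //; last exact: measurable_box.
rewrite lte_mul_pinfty // ?measure_ge0 //.
by rewrite /= lebesgue_measure_itv /=; case: ifP => _; rewrite ?EFinN -?EFinB.
Qed.

(** [leb] is a Fixpoint returning a measure; a name with the plain type of set
    functions is needed to attach sigma-finiteness to it. *)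
Definition lebM (R : realType) (n : nat) : set (n.-tuple (measurableTypeR R)) -> \bar R :=
  leb R n.

HB.instance Definition _ (R : realType) (n : nat) := Measure.on (@lebM R n).

Lemma sigma_finite_leb (R : realType) (n : nat) : sigma_finite setT (@lebM R n).
Proof.
exists (fun k : nat => box n k%:R).
  apply/esym/seteqP; split => // t _.
  pose M := \sum_i `|tnth t i : R|.
  have M0 : 0 <= M by rewrite sumr_ge0.
  exists (Num.truncn M).+1 => //= i.
  apply: (@le_trans _ _ M); first by rewrite /M (bigD1 i) //= lerDl sumr_ge0.
  by rewrite ltW // truncnS_gt.
by move=> k; split; [exact: measurable_box|exact: leb_box_lty].
Qed.

HB.instance Definition _ (R : realType) (n : nat) :=
  Measure_isSigmaFinite.Build _ _ _ (@lebM R n) (@sigma_finite_leb R n).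

Lemma integrable_bounded_support d (T : measurableType d) (R : realType)
    (mu : {measure set T -> \bar R}) (A : set T) (f : T -> R) (C : R) :
  measurable A -> (mu A < +oo)%E -> measurable_fun setT f ->
  (forall x, `|f x| <= C) -> (forall x, ~ A x -> f x = 0) ->
  mu.-integrable setT (EFin \o f).
Proof.
move=> mA Aoo mf fC f0.
apply: (@le_integrable _ _ _ _ _ _ _ (EFin \o (fun x => C * \1_A x))) => //.
- exact/measurable_EFinP.
- move=> x _ /=; rewrite lee_fin indicE.
  have [xA|xA] := boolP (x \in A); first by rewrite mulr1 (le_trans (fC x)) // ler_norm.
  by rewrite f0 ?normr0 //; move/negP: xA => xA Ax; apply: xA; exact: mem_set.
- have -> : EFin \o (fun x => C * \1_A x) = (fun x => C%:E * (\1_A x)%:E)%E.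
    by apply/funext => x /=; rewrite EFinM.
  apply: integrableZl => //; apply/integrableP; split; first exact/measurable_EFinP.
  rewrite (eq_integral (fun x => (\1_A x)%:E)); last first.
    by move=> t _; rewrite gee0_abs // lee_fin.
  by rewrite integral_indic // setIT.
Qed.

(** Closed balls being compact, the continuous functions of this kind are
    bounded, uniformly continuous and integrable. *)
Definition bsupp (R : realType) (n : nat) (f : 'rV[R]_n -> R) : Prop :=
  exists M : R, forall x, M < `|x| -> f x = 0.

Lemma closed_ball_compact (R : realType) (n : nat) (M : R) :
  compact [set x : 'rV[R]_n | `|x| <= M].
Proof.
apply: bounded_closed_compact.
  by exists M; split => [|N MN x /= xM]; [exact: num_real|rewrite (le_trans xM) // ltW].
apply: (closed_comp (f := fun x : 'rV[R]_n => `|x|)) (@closed_le _ M).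
by move=> x _; exact: norm_continuous.
Qed.

Lemma bsupp_bounded (R : realType) (n : nat) (f : 'rV[R]_n -> R) :
  continuous f -> bsupp f -> exists C, forall x, `|f x| <= C.
Proof.
move=> cf [M fM].
have /compact_bounded[C [_ HC]] : compact (f @` [set x | `|x| <= M]).
  apply: continuous_compact (@closed_ball_compact _ _ _).
  exact: continuous_subspaceT.
exists (Num.max (C + 1) 0) => x; rewrite le_max.
have [xM|Mx] := leP `|x| M; last by rewrite fM // normr0 lexx orbT.
by rewrite HC //= ?ltrDl //; exists x.
Qed.

Lemma bsupp_box (R : realType) (n : nat) (f : 'rV[R]_n -> R) :
  bsupp f -> exists M, forall t, ~ box n M t -> f (row_of_tuple t) = 0.
Proof.
move=> [M fM]; exists M => t tM; apply: fM; rewrite ltNge; apply/negP => H.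
by apply: tM => i; have := ler_coord_norm (row_of_tuple t) i; rewrite mxE => /le_trans; apply.
Qed.

Lemma integrable_continuous_bsupp (R : realType) (n : nat) (f : 'rV[R]_n -> R) :
  continuous f -> bsupp f ->
  (leb R n).-integrable setT (EFin \o (f \o @row_of_tuple R n)).
Proof.
move=> cf sf; have [C fC] := bsupp_bounded cf sf; have [M fM] := bsupp_box sf.
apply: (@integrable_bounded_support _ _ _ _ (box n M) _ C) => //.
- exact: measurable_box.
- exact: leb_box_lty.
- rewrite -(preimage_setT (@row_of_tuple R n)).
  by apply: measurable_fun_open_row; [exact: openT|move=> x _; exact: cf].
- by move=> t; exact: fC.
Qed.

(** The row counterpart of [cons_pair]. *)
Definition consr (R : realType) (n : nat) (x : R) (y : 'rV[R]_n) : 'rV[R]_n.+1 :=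
  \row_i (if unlift ord0 i is Some j then y 0 j else x).

Lemma row_of_cons_pair (R : realType) (n : nat)
    (p : measurableTypeR R * n.-tuple (measurableTypeR R)) :
  row_of_tuple (cons_pair p) = consr p.1 (row_of_tuple p.2).
Proof.
apply/rowP => i; rewrite !mxE; case: unliftP => [j ->|->]; last by [].
by rewrite tnthS !mxE.
Qed.

(* Both orders of integration are needed: the derivative may be taken in
   the first coordinate or in one of the others. *)
Section fubini_leb.
Variables (R : realType) (n : nat) (f : 'rV[R]_n.+1 -> R).
Hypotheses (cf : continuous f) (sf : bsupp f).
Local Notation mu1 := (@lebesgue_measure R).

Let g (p : measurableTypeR R * n.-tuple (measurableTypeR R)) : \bar R :=
  (f (consr p.1 (row_of_tuple p.2)))%:E.

Let gE : g = (EFin \o (f \o @row_of_tuple R n.+1)) \o @cons_pair R n.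
Proof. by apply/funext => p; rewrite /g /= row_of_cons_pair. Qed.

Let mf : measurable_fun setT (EFin \o (f \o @row_of_tuple R n.+1)).
Proof. exact: measurable_int (integrable_continuous_bsupp cf sf). Qed.

Let ig2 : (mu1 \x^ @lebM R n)%E.-integrable setT g.
Proof.
have [C fC] := bsupp_bounded cf sf; have [M fM] := bsupp_box sf.
apply: (@integrable_bounded_support _ _ _ _ (@cons_pair R n @^-1` box n.+1 M)
  (fun p => f (consr p.1 (row_of_tuple p.2))) C) => //.
- rewrite -[X in measurable X]setTI; apply: measurable_cons_pair => //.
  exact: measurable_box.
- exact: (@leb_box_lty R n.+1 M).
- apply/measurable_EFinP; rewrite (_ : _ \o _ = g) // gE.
  apply: measurableT_comp => //.
  exact: measurable_cons_pair.
- by move=> p Hp; rewrite -row_of_cons_pair fM.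
Qed.

Let ig1 : (mu1 \x @lebM R n)%E.-integrable setT g.
Proof.
move/integrableP: ig2 => [mg gint]; apply/integrableP; split => //.
rewrite (@eq_measure_integral _ _ _ _ (mu1 \x^ @lebM R n)%E) // => A mA _.
by apply: product_measure_unique => // B D mB mD /=; rewrite product_measure2E.
Qed.

Let intE : (\int[leb R n.+1]_t (f (row_of_tuple t))%:E =
  \int[(mu1 \x^ @lebM R n)%E]_p g p)%E.
Proof.
rewrite gE; have := integral_pushforward (@measurable_cons_pair R n) mf
  (mu := (mu1 \x^ @lebM R n)%E) (D := setT).
by rewrite preimage_setT -gE => /(_ ig2 measurableT).
Qed.

Lemma fubini_leb21 : (\int[leb R n.+1]_t (f (row_of_tuple t))%:E =
  \int[leb R n]_t \int[mu1]_x (f (consr x (row_of_tuple t)))%:E)%E.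
Proof. by rewrite intE -integral21_prod_meas2. Qed.

Lemma fubini_leb12 : (\int[leb R n.+1]_t (f (row_of_tuple t))%:E =
  \int[mu1]_x \int[leb R n]_t (f (consr x (row_of_tuple t)))%:E)%E.
Proof. by rewrite intE -integral12_prod_meas2. Qed.

End fubini_leb.

(** The two difference quotients are equal. *)
Lemma derive_affine (R : realType) (U V W : normedModType R) (E : U -> V)
    (f : V -> W) (u : U) (v : V) (y : U) :
  (forall h, E (h *: u + y) = h *: v + E y) ->
  ('D_u (f \o E) y = 'D_v f (E y)) * (derivable (f \o E) y u <-> derivable f (E y) v).
Proof.
move=> HE; rewrite /derive /derivable.
suff -> : (fun h : R => h^-1 *: ((f \o E \o shift y) (h *: u) - (f \o E) y)) =
       (fun h : R => h^-1 *: ((f \o shift (E y)) (h *: v) - f (E y))) by [].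
by apply/funext => h /=; rewrite HE.
Qed.

Lemma bsupp_partial (R : realType) (n : nat) (i : 'I_n) (f : 'rV[R]_n -> R) :
  bsupp f -> bsupp (partial i f).
Proof.
move=> [M fM]; exists M => x Mx; rewrite /partial (_ : 'D__ f x = 'D_(delta_mx 0 i) (cst 0) x).
  exact: derive_cst.
apply: near_eq_derive; near=> y; apply: fM; near: y.
apply: (open_nbhs_nbhs (A := [set y : 'rV[R]_n | M < `|y|])); split => //.
apply: (open_comp (f := fun x : 'rV[R]_n => `|x|)) (@open_gt _ M).
by move=> y _; exact: norm_continuous.
Unshelve. all: by end_near. Qed.

Lemma integral_derive1_bsupp0 (R : realType) (g : R -> R) (M : R) :
  (forall x, derivable g x 1) -> continuous (derive1 g) ->
  (forall x, M < `|x| -> g x = 0) ->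
  (\int[@lebesgue_measure R]_x (derive1 g x)%:E = 0)%E.
Proof.
move=> dg cg gM; pose N := Num.max M 0 + 1.
have MN : M < N by rewrite /N ltr_pwDr // le_max lexx.
have N0 : 0 < N by rewrite /N ltr_pwDr // le_max lexx orbT.
have g'0 x : M < `|x| -> derive1 g x = 0.
  move=> Mx; rewrite derive1E (_ : 'D__ g x = 'D_1 (cst 0) x); first exact: derive_cst.
  apply: near_eq_derive; near=> y; apply: gM; near: y.
  apply: (open_nbhs_nbhs (A := [set y : R | M < `|y|])); split => //.
  apply: (open_comp (f := fun x : R => `|x|)) (@open_gt _ M).
  by move=> y _; exact: norm_continuous.
have -> : (\int[@lebesgue_measure R]_x (derive1 g x)%:E =
   \int[@lebesgue_measure R]_(x in `[(- N)%R, N]) (derive1 g x)%:E)%E.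
  rewrite [RHS]integral_mkcond; apply: eq_integral => x _.
  rewrite patchE; case: ifPn => // xN; rewrite g'0 //.
  rewrite (lt_le_trans MN) // leNgt; apply/negP => H.
  by move/negP: xN; apply; rewrite inE /= in_itv /= -ler_norml ltW.
have cg0 : continuous g.
  by move=> x; apply: differentiable_continuous; apply/derivable1_diffP.
have H : derivable_oo_LRcontinuous g (- N) N.
  by split => //; [apply: cvg_at_right_filter|apply: cvg_at_left_filter]; exact: cg0.
have cgN : {within `[(- N), N], continuous (derive1 g)}.
  by apply: continuous_subspaceT => x; exact: cg.
have NN : - N < N by rewrite gtrN.
have := continuous_FTC2 NN cgN H (fun x _ => erefl).
by rewrite !gM ?subee // ?normrN gtr0_norm.
Unshelve. all: by end_near. Qed.

Section consr_calculus.
Variables (R : realType) (n : nat).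
Implicit Types (x : R) (y : 'rV[R]_n).

Lemma consr_shift0 x y h :
  consr (h *: (1 : R^o) + x) y = h *: delta_mx 0 ord0 + consr x y.
Proof.
apply/rowP => i; rewrite !mxE; case: unliftP => [j ->|->].
  by rewrite eq_sym (negPf (neq_lift _ _)) mulr0 add0r.
by rewrite eqxx.
Qed.

Lemma consr_shiftS x y h (i : 'I_n) :
  consr x (h *: delta_mx 0 i + y) = h *: delta_mx 0 (lift ord0 i) + consr x y.
Proof.
apply/rowP => k; rewrite !mxE; case: unliftP => [j ->|->].
  by rewrite !mxE (inj_eq lift_inj).
by rewrite (negPf (neq_lift _ _)) mulr0 add0r.
Qed.

Lemma continuous_consr_l y : continuous (fun x : R => consr x y).
Proof.
move=> x; apply: cvg_mxP => i j; under eq_fun do rewrite mxE.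
rewrite mxE; case: unliftP => [k _|_]; first exact: cvg_cst.
exact: cvg_id.
Qed.

Lemma continuous_consr_r x : continuous (fun y : 'rV[R]_n => consr x y).
Proof.
move=> y; apply: (@cvg_mxP _ (nbhs y) (nbhs_filter y)) => i j; under eq_fun do rewrite mxE.
rewrite mxE; case: unliftP => [k _|_]; last exact: cvg_cst.
exact: coord_continuous.
Qed.

Lemma ler_norm_consr_l x y : `|x| <= `|consr x y|.
Proof.
by have := ler_coord_norm (consr x y) ord0; rewrite mxE unlift_none.
Qed.

Lemma ler_norm_consr_r x y : `|y| <= `|consr x y|.
Proof.
rewrite {1}/Num.Def.normr /= mx_normrE; apply/bigmax_leP; split => // -[a i] _ /=.
have := ler_coord_norm (consr x y) (lift ord0 i).
by rewrite mxE liftK ord1.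
Qed.
End consr_calculus.

(** If the derivative is in the first coordinate, integrate in that variable
    first and use the fundamental theorem of calculus; otherwise fix the first
    coordinate and use induction. *)
Lemma integral_partial0 (R : realType) (n : nat) (i : 'I_n) (f : 'rV[R]_n -> R) :
  continuous f -> (forall x, derivable f x (delta_mx 0 i)) ->
  continuous (partial i f) -> bsupp f ->
  (\int[leb R n]_t (partial i f (row_of_tuple t))%:E = 0)%E.
Proof.
elim: n i f => [[] //|n IH] i f cf df cdf sf.
have sdf := bsupp_partial i sf.
have [M fM] := sf.
have [j ij|i0] := unliftP ord0 i.
  rewrite fubini_leb12 // integral0_eq // => x _.
  have aff y := @derive_affine R 'rV[R]_n 'rV[R]_n.+1 R (consr x) f
    (delta_mx 0 j) (delta_mx 0 (lift ord0 j)) y (fun h => consr_shiftS x y h j).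
  have E : partial j (f \o consr x) = partial i f \o consr x.
    by apply/funext => y; rewrite /partial /= (aff y).1 ij.
  have := IH j (f \o consr x); rewrite E; apply.
  - move=> y; apply: continuous_comp; [exact: continuous_consr_r|exact: cf].
  - by move=> y; apply/(aff y).2; rewrite -ij.
  - move=> y; apply: continuous_comp; [exact: continuous_consr_r|exact: cdf].
  - by exists M => y My; rewrite /= fM // (lt_le_trans My) // ler_norm_consr_r.
rewrite fubini_leb21 // integral0_eq // => t _; set y := row_of_tuple t.
have aff x := @derive_affine R R^o 'rV[R]_n.+1 R (fun x : R => consr x y) f
    1 (delta_mx 0 ord0) x (fun h => consr_shift0 x y h).
have E : derive1 (f \o (fun x : R => consr x y)) = partial i f \o (fun x : R => consr x y).
  by apply/funext => x; rewrite derive1E /partial /= (aff x).1 i0.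
have := @integral_derive1_bsupp0 R (f \o (fun x : R => consr x y)) M; rewrite E; apply.
- by move=> x; apply/(aff x).2; rewrite -i0.
- move=> x; apply: continuous_comp; [exact: continuous_consr_l|exact: cdf].
- by move=> x Mx; rewrite /= fM // (lt_le_trans Mx) // ler_norm_consr_l.
Qed.

(** * Mean values along coordinate lines *)

Lemma uniformly_continuous_bsupp (R : realType) (n : nat) (f : 'rV[R]_n -> R) :
  continuous f -> bsupp f ->
  forall e, 0 < e -> exists2 d, 0 < d & forall x y, `|x - y| < d -> `|f x - f y| < e.
Proof.
move=> cf [M fM] e e0.
have /compact_near_coveringP := @closed_ball_compact R n (M + 1).
move=> /(_ R (nbhs (0 : R)) (fun d x => forall y, `|x - y| < d -> `|f x - f y| < e)) [].
  move=> x _; have e2 : 0 < e / 2 by rewrite divr_gt0.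
  have /(@cvgrPdist_lt _ _ _ (nbhs x)) /(_ _ e2) /nbhs_ballP[r /= r0 xr] := cf x.
  have r2 : 0 < r / 2 by rewrite divr_gt0.
  exists (ball x (r / 2), ball (0 : R) (r / 2)); first by split; exact: nbhsx_ballx.
  move=> [x' d] [/= xx' d2] y x'y.
  move: xx' d2; rewrite -!ball_normE /= sub0r normrN => xx' d2.
  have d2' := le_lt_trans (ler_norm _) d2.
  have h1 : `|f x - f x'| < e / 2.
    by apply: xr; rewrite -ball_normE /=; apply: (lt_trans xx'); lra.
  have h2 : `|f x - f y| < e / 2.
    apply: xr; rewrite -ball_normE /= (_ : x - y = (x - x') + (x' - y)); last first.
      by rewrite addrA subrK.
    by apply: le_lt_trans (ler_normD _ _) _; lra.
  rewrite (_ : f x' - f y = (f x - f y) - (f x - f x')); last by ring.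
  by apply: le_lt_trans (ler_normB _ _) _; lra.
(* With d <= 1, x outside the ball of radius M + 1 puts y outside that of
   radius M. *)
move=> r /= r0 Hr; pose d := Num.min (r / 2) 1.
have d0 : 0 < d by rewrite lt_min ltr01 divr_gt0.
have dr : ball (0 : R) r d.
  rewrite -ball_normE /= sub0r normrN gtr0_norm //; apply: (@le_lt_trans _ _ (r / 2)); last by lra.
  by rewrite ge_min lexx.
exists d => // x y xy; have [xM|Mx] := leP `|x| (M + 1); first exact: (Hr d dr).
have My : M < `|y|.
  have : `|x| <= `|x - y| + `|y| by rewrite -{1}(subrK y x) ler_normD.
  have : `|x - y| < 1 by rewrite (lt_le_trans xy) // ge_min lexx orbT.
  lra.
by rewrite !fM // ?subrr ?normr0 // (lt_trans _ Mx) // ltrDl.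
Qed.

Section line.
Variables (R : realType) (n : nat).
Implicit Types (f : 'rV[R]_n -> R) (x v : 'rV[R]_n) (i : 'I_n).

Lemma line_derive f x v (t : R) :
  ('D_1 (fun s : R => f (s *: v + x)) t = 'D_v f (t *: v + x)) *
  (derivable (fun s : R => f (s *: v + x)) t 1 <-> derivable f (t *: v + x) v).
Proof.
apply: (@derive_affine R R^o 'rV[R]_n R (fun s : R => s *: v + x) f 1 v t).
by move=> h; rewrite scalerDl addrA /GRing.scale /= mulr1.
Qed.

Lemma line_MVT f x v (t : R) :
  (forall s : R, `|s| <= `|t| -> derivable f (s *: v + x) v) ->
  exists2 s : R, `|s| <= `|t| & f (t *: v + x) - f x = t * 'D_v f (s *: v + x).
Proof.
move=> df; pose g (s : R) := f (s *: v + x).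
have gd (s : R) : `|s| <= `|t| -> is_derive s 1 g ('D_v f (s *: v + x)).
  move=> st; rewrite -(line_derive f x v s).1; apply: derivableP.
  exact/(line_derive f x v s).2/df.
have cg (a b : R) : (forall s : R, s \in `[a, b] -> `|s| <= `|t|) ->
    {within `[a, b], continuous g}.
  move=> H; apply: derivable_within_continuous => s sab; by case: (gd s (H s sab)).
have [t0|t0] := leP 0 t.
  have [||c /[!in_itv] /= /andP[c0 ct]] := @MVT_segment R g (fun s => 'D_v f (s *: v + x)) 0 t t0.
  - move=> s; rewrite in_itv /= => /andP[s0 st]; apply: gd.
    by rewrite !ger0_norm // ltW.
  - by apply: cg => s; rewrite in_itv /= => /andP[s0 st]; rewrite !ger0_norm.
  rewrite /g scale0r add0r subr0 => ->; exists c; last by rewrite mulrC.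
  by rewrite !ger0_norm.
have [||c /[!in_itv] /= /andP[c0 ct]] := @MVT_segment R g (fun s => 'D_v f (s *: v + x)) t 0 (ltW t0).
- move=> s; rewrite in_itv /= => /andP[s0 st]; apply: gd.
  by rewrite !ler0_norm ?lerN2 // ltW.
- move=> {gd}; apply: cg => s; rewrite in_itv /= => /andP[s0 st].
  by rewrite !ler0_norm ?lerN2 // ltW.
rewrite /g scale0r add0r sub0r => H; exists c.
  by rewrite !ler0_norm ?lerN2 // ltW.
by rewrite -opprB H mulrN opprK mulrC.
Qed.
End line.

Section primitive.
Variables (R : realType) (phi : R -> R).
Hypothesis cphi : continuous phi.
Local Notation mu := (@lebesgue_measure R).

(** The lower bound -1 is arbitrary; starting below 0 makes the function
    differentiable at 0. *)
Definition primitive (y : R) : R := \int[mu]_(t in `[-1, y]) phi t.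

Lemma integrable_itv (a b : R) : mu.-integrable `[a, b] (EFin \o phi).
Proof.
apply: continuous_compact_integrable; first exact: segment_compact.
exact: continuous_subspaceT.
Qed.

Lemma primitive_derive (y : R) : -1 < y -> is_derive y 1 primitive (phi y).
Proof.
move=> y1; have yy : y < y + 1 by rewrite ltrDl.
have [d1 d2] := continuous_FTC1_closed yy (integrable_itv _ _) y1 (@cphi y).
by split; [exact: d1|rewrite -derive1E; exact: d2].
Qed.

Lemma primitive_derive_shift (t y : R) : -1 < y + t ->
  is_derive y 1 (fun s => primitive (s + t)) (phi (y + t)).
Proof.
move=> y1; have aff : forall h : R, (h *: (1 : R^o) + y) + t = h *: (1 : R^o) + (y + t).
  by move=> h; rewrite addrA.
have D := @derive_affine R R^o R^o R (fun s => s + t) primitive 1 1 y aff.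
have [p1 p2] := primitive_derive y1.
by split; [apply/D.2|rewrite -[LHS]/('D_1 (primitive \o (fun s => s + t)) y) D.1].
Qed.

Lemma integral_primitive (t h : R) : 0 < h -> -1 < t ->
  \int[mu]_(s in `[0, h]) phi (s + t) = primitive (h + t) - primitive t.
Proof.
move=> h0 t1; pose F (s : R) := primitive (s + t).
have dF (s : R) : 0 <= s -> is_derive s 1 F (phi (s + t)).
  by move=> s0; apply: primitive_derive_shift; rewrite (lt_le_trans t1) // lerDr.
have cF (s : R) : 0 <= s -> {for s, continuous F}.
  move=> /dF [d _]; apply: differentiable_continuous; exact/derivable1_diffP.
have LR : derivable_oo_LRcontinuous F 0 h.
  split.
  - by move=> s; rewrite in_itv /= => /andP[/ltW /dF[]].
  - by apply: cvg_at_right_filter; exact: cF.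
  - by apply: cvg_at_left_filter; apply: cF; exact: ltW.
have cp : {within `[0, h], continuous (fun s => phi (s + t))}.
  apply: continuous_subspaceT => s.
  apply: (@continuous_comp _ _ _ (fun s : R => s + t) phi); last exact: cphi.
  by apply: cvgD; [exact: cvg_id|exact: cvg_cst].
have F' : {in `]0, h[, derive1 F =1 (fun s => phi (s + t))}.
  move=> s; rewrite in_itv /= => /andP[/ltW /dF[_ <-] _].
  by rewrite derive1E.
rewrite /Rintegral (continuous_FTC2 h0 cp LR F') /F -EFinB /=.
by rewrite add0r.
Qed.
End primitive.

(** * Smoothing by Steklov means *)

Section steklov.
Variables (R : realType) (n : nat) (h : R) (i : 'I_n).
Hypothesis h0 : 0 < h.
Local Notation e := (delta_mx 0 i : 'rV[R]_n).
Local Notation mu := (@lebesgue_measure R).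
Implicit Types (f g : 'rV[R]_n -> R) (x v : 'rV[R]_n).

(** The mean over the segment [x, x + h e_i]. It preserves regularity and
    gains one derivative in the direction i, by the fundamental theorem of
    calculus. *)
Definition steklov f x : R := h^-1 * \int[mu]_(s in `[0, h]) f (s *: e + x).

Lemma continuous_line f x : continuous f -> continuous (fun s : R => f (s *: e + x)).
Proof.
move=> cf s; apply: (@continuous_comp _ _ _ (fun s : R => s *: e + x) f); last exact: cf.
by apply: cvgD; [apply: cvgZr_tmp; exact: cvg_id|exact: cvg_cst].
Qed.

Lemma steklov_primitive f x (t : R) : continuous f -> -1 < t ->
  steklov f (t *: e + x) =
  h^-1 * (primitive (fun s => f (s *: e + x)) (h + t) -
          primitive (fun s => f (s *: e + x)) t).
Proof.
move=> cf t1; rewrite -integral_primitive //; last exact: continuous_line.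
congr (_ * _); apply: eq_Rintegral => s _.
by rewrite scalerDl addrA.
Qed.

(** The mean value theorem; it turns pointwise estimates for f into estimates
    for its Steklov mean. *)
Lemma steklov_mean f x : continuous f ->
  exists2 s : R, `|s| <= h & steklov f x = f (s *: e + x).
Proof.
move=> cf; set phi := fun s : R => f (s *: e + x).
have cphi : continuous phi by exact: continuous_line.
have N1 : -1 < 0 :> R by rewrite ltrN10.
have := @steklov_primitive f x 0 cf N1; rewrite scale0r add0r addr0 -/phi.
have dp (y : R) : 0 <= y -> is_derive y 1 (primitive phi) (phi y).
  by move=> y0; apply: primitive_derive => //; apply: lt_le_trans y0.
have [||c] := @MVT_segment R (primitive phi) phi 0 h (ltW h0).
- by move=> y; rewrite in_itv /= => /andP[/ltW /dp].
- apply: derivable_within_continuous => y; rewrite in_itv /= => /andP[/dp dy _].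
  by case: dy.
rewrite in_itv /= subr0 => /andP[c0 ch] -> ->.
by exists c; rewrite ?ger0_norm // mulrCA mulVf ?mulr1 ?gt_eqF.
Qed.

Lemma integrable_line f x : continuous f ->
  mu.-integrable `[0, h] (EFin \o (fun s : R => f (s *: e + x))).
Proof. by move=> cf; apply: integrable_itv; exact: continuous_line. Qed.

Lemma steklovB f g x : continuous f -> continuous g ->
  steklov (fun y => f y - g y) x = steklov f x - steklov g x.
Proof.
move=> cf cg; have mI : measurable (`[0, h] : set (measurableTypeR R)) by exact: measurable_itv.
have E := RintegralB mI (integrable_line x cf) (integrable_line x cg).
by rewrite /steklov -mulrBr -E.
Qed.

Lemma steklovZ (k : R) f x : continuous f ->
  steklov (fun y => k * f y) x = k * steklov f x.
Proof.
move=> cf; have mI : measurable (`[0, h] : set (measurableTypeR R)) by exact: measurable_itv.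
have E := RintegralZl k mI (integrable_line x cf).
by rewrite /steklov mulrCA -E.
Qed.

Lemma steklov_shift f v x : steklov f (v + x) = steklov (fun y => f (v + y)) x.
Proof.
congr (_ * _); apply: eq_Rintegral => s _.
by rewrite addrCA.
Qed.

Lemma continuous_translate f v : continuous f -> continuous (fun y => f (v + y)).
Proof.
move=> cf y; apply: (@continuous_comp _ _ _ (fun y => v + y) f); last exact: cf.
by apply: (@cvgD _ _ _ (nbhs y)); [exact: cvg_cst|exact: cvg_id].
Qed.

Lemma steklov_continuous f : continuous f -> bsupp f -> continuous (steklov f).
Proof.
move=> cf sf x; apply/(@cvgrPdist_lt _ _ _ (nbhs x)) => eps eps0.
have [d d0 Hd] := uniformly_continuous_bsupp cf sf eps0.
apply/nbhs_ballP; exists d => // y; rewrite -ball_normE /= => xy.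
rewrite -(subrK x y) steklov_shift -steklovB //; last exact: continuous_translate.
have [|s _ ->] := @steklov_mean (fun z => f z - f (y - x + z)) x.
  by move=> z; apply: (@cvgB _ _ _ (nbhs z)); [exact: cf|exact: continuous_translate].
apply: Hd; rewrite opprD addrA addrAC subrr add0r opprB.
exact: xy.
Qed.

Lemma steklov_bsupp f : bsupp f -> bsupp (steklov f).
Proof.
move=> [M fM]; exists (M + h) => x xM; rewrite /steklov.
rewrite (@eq_Rintegral _ _ _ _ _ (cst 0)) ?Rintegral_cst ?mul0r ?mulr0 // => s.
rewrite inE /= in_itv /= => /andP[s0 sh]; rewrite fM //.
have E := norm_delta_le1 R i.
have : `|x| <= `|s *: e + x| + `|s *: e|.
  by rewrite -{1}(addKr (s *: e) x) addrC (le_trans (ler_normD _ _)) // normrN.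
have : `|s *: e| <= h.
  by rewrite normrZ ger0_norm // (le_trans _ sh) // ler_piMr.
lra.
Qed.

Lemma steklov_partial_same f x : continuous f ->
  is_derive x e (steklov f) (h^-1 * (f (h *: e + x) - f x)).
Proof.
move=> cf; set phi := fun s : R => f (s *: e + x).
have cphi : continuous phi by exact: continuous_line.
have H : is_derive (0 : R) 1 (fun t : R => steklov f (t *: e + x))
     (h^-1 * (f (h *: e + x) - f x)).
  apply: (@near_eq_is_derive _ _ _ (fun t : R =>
    h^-1 * (primitive phi (t + h) - primitive phi (t + 0)))).
    near=> t; rewrite steklov_primitive // ?addr0 1?(addrC h) //.
    near: t; apply: (open_nbhs_nbhs (A := [set t : R | -1 < t])).
    by split; [exact: open_gt|rewrite /= ltrN10].
  have -> : f (h *: e + x) - f x = phi (0 + h) - phi (0 + 0).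
    by rewrite /phi !add0r scale0r add0r.
  apply: is_deriveZ.
  apply: is_deriveB; apply: primitive_derive_shift => //.
    by rewrite add0r; apply: lt_trans h0; rewrite ltrN10.
  by rewrite add0r ltrN10.
have L := line_derive (steklov f) x e 0.
move: H => [H1 H2]; rewrite L.1 scale0r add0r in H2.
by split; [move/L.2: H1; rewrite scale0r add0r|exact: H2].
Unshelve. all: by end_near. Qed.

(** The error between the difference quotient of the mean and the mean of the
    derivative is a single value of [partial j f - (difference quotient of
    f)], which is small by uniform continuity of [partial j f]. *)
Lemma steklov_partial f (j : 'I_n) x : continuous f ->
  (forall y, derivable f y (delta_mx 0 j)) ->
  continuous (partial j f) -> bsupp f ->
  is_derive x (delta_mx 0 j) (steklov f) (steklov (partial j f) x).
Proof.
move=> cf df cdf sf.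
suff H : (fun t : R => t^-1 *: ((steklov f \o shift x) (t *: delta_mx 0 j) - steklov f x))
    @ 0^' --> steklov (partial j f) x.
  split; first by apply/cvg_ex; exists (steklov (partial j f) x).
  exact: cvg_lim H.
apply/cvgrPdist_lt => eps eps0.
have [d d0 Hd] := uniformly_continuous_bsupp cdf (bsupp_partial j sf) eps0.
near=> t.
have t0 : t != 0 by near: t; exact: nbhs_dnbhs_neq.
have td : `|t| < d.
  near: t; apply: nbhs_dnbhs; apply: (open_nbhs_nbhs (A := [set t : R | `|t| < d])).
  split; last by rewrite /= normr0.
  apply: (open_comp (f := fun x : R => `|x|)) (@open_lt _ d).
  by move=> y _; exact: norm_continuous.
rewrite /= steklov_shift -steklovB //; last exact: continuous_translate.
rewrite /GRing.scale /= -steklovZ; last first.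
  move=> y; apply: (@cvgB _ _ _ (nbhs y)); [exact: continuous_translate|exact: cf].
have cg : continuous (fun y : 'rV[R]_n => t^-1 * (f (t *: delta_mx 0 j + y) - f y)).
  move=> y; apply: (@cvgM _ _ (nbhs y)); first exact: cvg_cst.
  by apply: (@cvgB _ _ _ (nbhs y)); [exact: continuous_translate|exact: cf].
rewrite -steklovB //.
have [|s _ ->] := @steklov_mean (fun y => partial j f y - t^-1 * (f (t *: delta_mx 0 j + y) - f y)) x.
  by move=> y; apply: (@cvgB _ _ _ (nbhs y)); [exact: cdf|exact: cg].
set z := s *: e + x.
have [|r rt ->] := @line_MVT R n f z (delta_mx 0 j) t; first by move=> *; exact: df.
rewrite mulrA mulVf // mul1r; apply: Hd.
rewrite opprD addrCA subrr addr0 normrN normrZ.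
apply: le_lt_trans td; apply: le_trans rt; by rewrite ler_piMr // norm_delta_le1.
Unshelve. all: by end_near. Qed.

End steklov.

(** C^k on the whole space, by recursion on k; this form suits inductions
    better than quantification over all lists of at most k indices. *)
Fixpoint isC (R : realType) (n k : nat) (f : 'rV[R]_n -> R) : Prop :=
  continuous f /\
  if k is k'.+1 then
    forall i, (forall x, derivable f x (delta_mx 0 i)) /\ isC k' (partial i f)
  else True.

Lemma isC_continuous (R : realType) (n k : nat) (f : 'rV[R]_n -> R) :
  isC k f -> continuous f.
Proof. by case: k => [[]|k []]. Qed.

Lemma isC_pred (R : realType) (n k : nat) (f : 'rV[R]_n -> R) :
  isC k.+1 f -> isC k f.
Proof.
elim: k f => [|k IH] f [cf H]; split => // i; have [df /IH] := H i; by split.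
Qed.

Lemma isC_leq (R : realType) (n j k : nat) (f : 'rV[R]_n -> R) :
  (j <= k)%N -> isC k f -> isC j f.
Proof.
move=> /subnK <-; elim: (k - j)%N => [//|d IH]; rewrite addSn => /isC_pred.
exact: IH.
Qed.

Section smoothing.
Variables (R : realType) (n : nat) (h : R).
Hypothesis h0 : 0 < h.
Implicit Types (f : 'rV[R]_n -> R) (s : seq 'I_n).

Lemma steklov_isC k i f : isC k f -> bsupp f -> isC k (steklov h i f).
Proof.
elim: k f => [|k IH] f [cf H] sf.
  by split => //; exact: steklov_continuous.
split; first exact: steklov_continuous.
move=> j; have [df Cdf] := H j.
have D x := steklov_partial i h0 x cf df (isC_continuous Cdf) sf.
split; first by move=> x; case: (D x).
rewrite (_ : partial j _ = steklov h i (partial j f)).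
  by apply: IH => //; exact: bsupp_partial.
by apply/funext => x; case: (D x).
Qed.

Definition smoothing s f : 'rV[R]_n -> R := foldr (steklov h) f s.

Lemma smoothing_bsupp s f : bsupp f -> bsupp (smoothing s f).
Proof. by move=> sf; elim: s => //= i s IH; exact: steklov_bsupp. Qed.

Lemma smoothing_isC s k f : isC k f -> bsupp f -> isC k (smoothing s f).
Proof.
move=> Cf sf; elim: s => //= i s IH; apply: steklov_isC => //.
exact: smoothing_bsupp.
Qed.

Lemma smoothing_partial s f j : isC 1 f -> bsupp f ->
  partial j (smoothing s f) = smoothing s (partial j f).
Proof.
move=> Cf sf; elim: s => //= i s <-; apply/funext => x.
have [cg H] := smoothing_isC s Cf sf; have [dg [cdg _]] := H j.
by case: (steklov_partial i h0 x cg dg cdg (smoothing_bsupp s sf)).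
Qed.

Lemma smoothing_gain0 s f i : continuous f -> bsupp f -> i \in s ->
  (forall x, derivable (smoothing s f) x (delta_mx 0 i)) /\
  continuous (partial i (smoothing s f)).
Proof.
move=> cf sf; elim: s => //= j s IH.
have [cg _] : isC 0 (smoothing s f) by exact: smoothing_isC.
have sg := smoothing_bsupp s sf.
rewrite in_cons; have [-> _|ij /= /IH[dg cdg]] := eqVneq i j.
  have D x := steklov_partial_same j h0 x cg.
  split; first by move=> x; case: (D x).
  rewrite (_ : partial j _ = fun x => h^-1 * (smoothing s f (h *: delta_mx 0 j + x) - smoothing s f x)).
    move=> x; apply: (@cvgM _ _ (nbhs x)); first exact: cvg_cst.
    by apply: (@cvgB _ _ _ (nbhs x)); [exact: continuous_translate|exact: cg].
  by apply/funext => x; case: (D x).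
have D x := steklov_partial j h0 x cg dg cdg sg.
split; first by move=> x; case: (D x).
rewrite (_ : partial i _ = steklov h j (partial i (smoothing s f))).
  by apply: steklov_continuous => //; exact: bsupp_partial.
by apply/funext => x; case: (D x).
Qed.

(** Every direction occurs in s, so the derivatives of order k can be
    differentiated once more in any direction. *)
Lemma smoothing_gain s k f : (forall i, i \in s) -> isC k f -> bsupp f ->
  isC k.+1 (smoothing s f).
Proof.
move=> sT; elim: k f => [|k IH] f Cf sf.
  have cf := isC_continuous Cf.
  split; first by case: (smoothing_isC s Cf sf).
  by move=> i; have [d c] := smoothing_gain0 cf sf (sT i); split.
split; first by case: (smoothing_isC s Cf sf).
move=> i; have [_ /(_ i)[d _]] := smoothing_isC s Cf sf; split => //.
rewrite smoothing_partial //; last by apply: isC_leq Cf.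
by apply: IH; [case: Cf => _ /(_ i)[]|exact: bsupp_partial].
Qed.

Lemma smoothing_mean s f x : continuous f -> bsupp f ->
  exists2 z, `|z - x| <= h * (size s)%:R & smoothing s f x = f z.
Proof.
move=> cf sf; elim: s x => [|i s IH] x /=.
  by exists x => //; rewrite subrr normr0 mulr0.
have [cg _] : isC 0 (smoothing s f) by exact: smoothing_isC.
have [t th ->] := steklov_mean i h0 x cg.
have [z zx ->] := IH (t *: delta_mx 0 i + x); exists z => //.
rewrite -(subrK (t *: delta_mx 0 i + x) z) -addrA addrK -natr1 mulrDr mulr1.
apply: le_trans (ler_normD _ _) _; rewrite lerD // normrZ.
by rewrite (le_trans _ th) // ler_piMr // (norm_delta_le1 R).
Qed.
End smoothing.

Lemma smoothing_cvg (R : realType) (n : nat) (f : 'rV[R]_n -> R) s x :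
  continuous f -> bsupp f ->
  smoothing k.+1%:R^-1 s f x @[k --> \oo] --> f x.
Proof.
move=> cf sf; apply/cvgrPdist_lt => e e0.
have [d d0 Hd] := uniformly_continuous_bsupp cf sf e0.
near=> k.
have k0 : 0 < k.+1%:R^-1 :> R by rewrite invr_gt0.
have [z zx ->] := smoothing_mean k0 s x cf sf; apply: Hd.
rewrite distrC (le_lt_trans zx) // mulrC ltr_pdivrMr // -ltr_pdivrMl //.
near: k; exists (Num.truncn (d^-1 * (size s)%:R)).+1 => // k /= Hk.
apply: lt_le_trans (truncnS_gt _) _.
by rewrite ler_nat; apply: leq_trans Hk _.
Unshelve. all: by end_near. Qed.

Lemma smoothing_bounded (R : realType) (n : nat) (f : 'rV[R]_n -> R) :
  continuous f -> bsupp f -> exists C, forall s (k : nat) x,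
  `|smoothing k.+1%:R^-1 s f x| <= C.
Proof.
move=> cf sf; have [C fC] := bsupp_bounded cf sf; exists C => s k x.
have k0 : 0 < k.+1%:R^-1 :> R by rewrite invr_gt0.
by have [z _ ->] := smoothing_mean k0 s x cf sf.
Qed.

(** * Derivatives of determinants and Piola's identity *)

Lemma is_derive_prod (R : realType) (V : normedModType R) (I : eqType)
    (s : seq I) (f : I -> V -> R) (df : I -> R) (x v : V) :
  uniq s -> (forall i, is_derive x v (f i) (df i)) ->
  is_derive x v (fun y => \prod_(i <- s) f i y)
    (\sum_(k <- s) df k * \prod_(i <- s | i != k) f i x).
Proof.
move=> us Df; elim: s us => [_|a s IH /= /andP[as_ us]].
  rewrite big_nil (_ : (fun y => _) = cst 1); first exact: is_derive_cst.
  by apply/funext => y; rewrite big_nil.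
rewrite (_ : (fun y => _) = f a * (fun y => \prod_(i <- s) f i y)); last first.
  by apply/funext => y; rewrite big_cons.
have IHs := IH us; apply: (is_derive_eq (is_deriveM (Df a) IHs)).
rewrite /GRing.scale /= !big_cons eqxx addrC; congr (_ + _).
  rewrite mulrC; congr (_ * _); rewrite [RHS]big_seq_cond [LHS]big_seq.
  apply: eq_bigl => i; case: (boolP (i \in s)) => //= si.
  by apply/esym; apply: contraNneq as_ => <-.
rewrite mulr_sumr [LHS]big_seq [RHS]big_seq; apply: eq_bigr => k ks.
rewrite mulrCA big_cons; case: eqVneq => // ak.
by move: as_; rewrite ak ks.
Qed.

Definition setrow (K : comNzRingType) (n : nat) (k : 'I_n) (r : 'I_n -> K)
    (M : 'M[K]_n) : 'M[K]_n :=
  \matrix_(i, j) if i == k then r j else M i j.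

Lemma cofactor_setrow (K : comNzRingType) (n : nat) (k l : 'I_n)
    (r : 'I_n -> K) (M : 'M[K]_n) : cofactor (setrow k r M) k l = cofactor M k l.
Proof.
congr (_ * \det _); apply/matrixP => a b; rewrite !mxE.
by rewrite eq_sym (negPf (neq_lift _ _)).
Qed.

Lemma det_setrow (K : comNzRingType) (n : nat) (k : 'I_n) (r : 'I_n -> K)
    (M : 'M[K]_n) : \det (setrow k r M) = \sum_l r l * cofactor M k l.
Proof.
rewrite (expand_det_row _ k); apply: eq_bigr => l _.
by rewrite cofactor_setrow mxE eqxx.
Qed.

Lemma cofactor_det_setrow (K : comNzRingType) (n : nat) (i j : 'I_n)
    (M : 'M[K]_n) :
  cofactor M i j = \det (setrow i (fun l => (l == j)%:R) M).
Proof.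
rewrite det_setrow (bigD1 j) //= eqxx mul1r big1 ?addr0 // => l /negPf ->.
by rewrite mul0r.
Qed.

Lemma det_setrow_swap (K : comNzRingType) (n : nat) (i k : 'I_n)
    (a b : 'I_n -> K) (M : 'M[K]_n) : i != k ->
  \det (setrow k a (setrow i b M)) = - \det (setrow k b (setrow i a M)).
Proof.
move=> ik; have -> : setrow k a (setrow i b M) =
    xrow i k (setrow k b (setrow i a M)).
  apply/matrixP => c d; rewrite !mxE; case: tpermP => [->|->|/eqP ci /eqP ck].
  - by rewrite (negPf ik) !eqxx.
  - by rewrite !eqxx (negPf ik).
  by rewrite (negPf ci) (negPf ck).
by rewrite xrowE det_mulmx det_perm odd_tperm ik expr1 mulN1r.
Qed.

(** Jacobi's formula. *)
Lemma is_derive_det (R : realType) (V : normedModType R) (n : nat)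
    (M : V -> 'M[R]_n) (dM : 'M[R]_n) (x v : V) :
  (forall i j, is_derive x v (fun y => M y i j) (dM i j)) ->
  is_derive x v (fun y => \det (M y))
    (\sum_k \sum_l dM k l * cofactor (M x) k l).
Proof.
move=> DM.
have D (s : {perm 'I_n}) := is_derive_prod (x := x) (v := v) (index_enum_uniq _)
    (fun i => DM i (s i)).
have DS (s : {perm 'I_n}) : is_derive x v
    (fun y => (-1) ^+ s * \prod_i M y i (s i))
    ((-1) ^+ s * \sum_k dM k (s k) * \prod_(i | i != k) M x i (s i)).
  exact: is_deriveZ.
have H : forall r : seq {perm 'I_n}, is_derive x v
    (fun y => \sum_(s <- r) (-1) ^+ s * \prod_i M y i (s i))
    (\sum_(s <- r) (-1) ^+ s * \sum_k dM k (s k) * \prod_(i | i != k) M x i (s i)).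
  elim=> [|s r IH].
    rewrite big_nil (_ : (fun y => _) = cst 0); first exact: is_derive_cst.
    by apply/funext => y; rewrite big_nil.
  rewrite big_cons.
  rewrite (_ : (fun y => _) = (fun y => (-1) ^+ s * \prod_i M y i (s i)) +
      (fun y => \sum_(s <- r) (-1) ^+ s * \prod_i M y i (s i))); last first.
    by apply/funext => y; rewrite big_cons.
  exact: is_deriveD.
apply: is_derive_eq (H _) _.
under eq_bigr => s _ do rewrite mulr_sumr.
rewrite exchange_big /=; apply: eq_bigr => k _.
rewrite -det_setrow /determinant; apply: eq_bigr => s _; congr (_ * _).
rewrite [RHS](bigD1 k) //= mxE eqxx; congr (_ * _).
by apply: eq_bigr => i /negPf ik; rewrite mxE ik.
Qed.

(** The divergence of a row of the cofactor matrix of M. Row i does not enter;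
    differentiating row k in direction j and expanding gives a sum over j, l
    of d_j M_kl D_jkl with D antisymmetric in j, l, while d_j M_kl is
    symmetric in j, l by hypothesis. *)
Lemma piola (R : realType) (n : nat) (M : 'rV[R]_n -> 'M[R]_n)
    (dM : 'I_n -> 'M[R]_n) (x : 'rV[R]_n) (i : 'I_n) :
  (forall j k l, is_derive x (delta_mx 0 j) (fun y => M y k l) (dM j k l)) ->
  (forall j k l, dM j k l = dM l k j) ->
  \sum_j partial j (fun y => cofactor (M y) i j) x = 0.
Proof.
move=> DM curl.
pose D j k l := \det (setrow k (fun a => (a == l)%:R)
                       (setrow i (fun a => (a == j)%:R) (M x))).
have Dj j : partial j (fun y => cofactor (M y) i j) x =
    \sum_(k | k != i) \sum_l dM j k l * D j k l.
  rewrite /partial (_ : (fun y => _) =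
    fun y => \det (setrow i (fun a => (a == j)%:R) (M y))); last first.
    by apply/funext => y; rewrite cofactor_det_setrow.
  have := @is_derive_det R _ n (fun y => setrow i (fun a => (a == j)%:R) (M y))
    (setrow i (fun=> 0) (dM j)) x (delta_mx 0 j).
  case=> [a b|_ ->].
    rewrite /setrow mxE; case: (eqVneq a i) => ai.
      rewrite (_ : (fun y => _) = cst (b == j)%:R); first exact: is_derive_cst.
      by apply/funext => y; rewrite mxE ai eqxx.
    rewrite (_ : (fun y => _) = (fun y => M y a b)); first exact: DM.
    by apply/funext => y; rewrite mxE (negPf ai).
  rewrite (bigD1 i) //= [X in X + _]big1 ?add0r => [|l _]; last first.
    by rewrite mxE eqxx mul0r.
  apply: eq_bigr => k /negPf ki; apply: eq_bigr => l _.
  by rewrite mxE ki cofactor_det_setrow.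
under eq_bigr => j _ do rewrite Dj.
rewrite exchange_big big1 //= => k ki.
(* Exchanging j and l changes the sign of D. *)
set S := LHS; have : S = - S.
  rewrite {1}/S exchange_big -sumrN /=; apply: eq_bigr => j _.
  rewrite -sumrN; apply: eq_bigr => l _.
  by rewrite curl /D det_setrow_swap 1?eq_sym // mulrN.
move=> /eqP; rewrite -addr_eq0 -mulr2n mulrn_eq0 /=.
by move=> /eqP.
Qed.

Lemma ptraceE (R : realType) (n p : nat) (S : 'M[R]_n) :
  ptrace p S = minor_sum p S.
Proof.
by apply: eq_bigr => A _; rewrite det_trunc_mx.
Qed.

Lemma ptrace_derivE (R : realType) (n p : nat) (i j : 'I_n) (S : 'M[R]_n) :
  ptrace_deriv p i j S = minor_deriv p i j S.
Proof.
rewrite /ptrace_deriv /derive.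
have -> : (fun h : R => h^-1 *: (((@ptrace R n p) \o shift S) (h *: delta_mx i j) - ptrace p S))
  = (fun h : R => h^-1 * (h * minor_deriv p i j S)).
  apply/funext => h /=; rewrite !ptraceE (addrC (h *: _)) minor_sum_delta.
  by rewrite /GRing.scale /= addrAC subrr add0r.
apply: cvg_lim => //.
have : cst (minor_deriv p i j S) h @[h --> (0 : R)^'] --> minor_deriv p i j S.
  exact: cvg_cst.
apply: cvg_trans; apply: near_eq_cvg; near=> h.
have h0 : h != 0 by near: h; exact: nbhs_dnbhs_neq.
by rewrite mulrA mulVf ?mul1r.
Unshelve. all: by end_near. Qed.

(** * Functions of class C^k on R^n *)

(** The mean value theorem, applied first to the difference y |-> f(y + t v) -
    f(y) in direction u and then to the derivative of f along u in direction
    v. *)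
Lemma second_difference_MVT (R : realType) (n : nat) (f : 'rV[R]_n -> R)
    (x u v : 'rV[R]_n) (t : R) :
  (forall a b : R, `|a| <= `|t| -> `|b| <= `|t| ->
     derivable f (b *: v + (a *: u + x)) u /\
     derivable ('D_u f) (b *: v + (a *: u + x)) v) ->
  exists a b : R, [/\ `|a| <= `|t|, `|b| <= `|t| &
    f (t *: v + (t *: u + x)) - f (t *: u + x) - (f (t *: v + x) - f x) =
    t * (t * 'D_v ('D_u f) (b *: v + (a *: u + x)))].
Proof.
move=> H; pose g y := f (t *: v + y) - f y.
have aff y h : t *: v + (h *: u + y) = h *: u + (t *: v + y) by rewrite addrCA.
have D y := @derive_affine R _ _ R (fun y => t *: v + y) f u u y (aff y).
have Dg (a : R) : `|a| <= `|t| ->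
    is_derive (a *: u + x) u g ('D_u f (t *: v + (a *: u + x)) - 'D_u f (a *: u + x)).
  move=> at_; have [d1 _] := H a t at_ (lexx _).
  have b0 : `|0 : R| <= `|t| by rewrite normr0.
  have := H a 0 at_ b0; rewrite scale0r add0r => -[d0 _].
  apply: is_deriveB; last exact: derivableP d0.
  split; first exact: (proj2 (D (a *: u + x)).2 d1).
  exact: (D (a *: u + x)).1.
have [a at_ Ha] : exists2 a : R, `|a| <= `|t| &
    g (t *: u + x) - g x = t * 'D_u g (a *: u + x).
  by apply: line_MVT => a /Dg [].
have [b bt Hb] : exists2 b : R, `|b| <= `|t| &
    'D_u f (t *: v + (a *: u + x)) - 'D_u f (a *: u + x) =
    t * 'D_v ('D_u f) (b *: v + (a *: u + x)).
  apply: (@line_MVT R n ('D_u f) (a *: u + x) v t) => b bt; have [_ d2] := H a b at_ bt; exact: d2.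
exists a, b; split; [exact: at_|exact: bt|rewrite -Hb].
have [_ E] := Dg a at_.
by rewrite -E -Ha.
Qed.

Lemma continuous2_ball (R : realType) (n : nat) (U : set 'rV[R]_n)
    (A B : 'rV[R]_n -> R) (x : 'rV[R]_n) (e : R) : nbhs x U ->
  {for x, continuous A} -> {for x, continuous B} -> 0 < e ->
  exists2 r : R, 0 < r & forall y, ball x r y ->
    [/\ U y, `|A x - A y| < e & `|B x - B y| < e].
Proof.
move=> Ux cA cB e0; have /nbhs_ballP[r1 /= r10 H1] := Ux.
have /(@cvgrPdist_lt _ _ _ (nbhs x)) /(_ _ e0) /nbhs_ballP[r2 /= r20 H2] := cA.
have /(@cvgrPdist_lt _ _ _ (nbhs x)) /(_ _ e0) /nbhs_ballP[r3 /= r30 H3] := cB.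
exists (Num.min r1 (Num.min r2 r3)); first by rewrite !lt_min r10 r20 r30.
move=> y; rewrite -ball_normE /= !lt_min => /andP[y1 /andP[y2 y3]].
by split; [apply: H1|apply: H2|apply: H3]; rewrite -ball_normE.
Qed.

Lemma dist_lt_add (R : realType) (P Q Z e : R) :
  `|P - Z| < e -> `|Q - Z| < e -> `|P - Q| < e + e.
Proof.
move=> h1 h2; rewrite -[P](subrK Z) -addrA; apply: le_lt_trans (ler_normD _ _) _.
by rewrite ltrD // distrC.
Qed.

(** A second difference of f over a small square equals both mixed derivatives
    at two nearby points. *)
Lemma schwarz (R : realType) (n : nat) (U : set 'rV[R]_n) (f : 'rV[R]_n -> R)
    (x : 'rV[R]_n) (i j : 'I_n) : nbhs x U ->
  (forall k y, U y -> derivable f y (delta_mx 0 k)) ->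
  (forall k l y, U y -> derivable (partial k f) y (delta_mx 0 l)) ->
  {for x, continuous (partial j (partial i f))} ->
  {for x, continuous (partial i (partial j f))} ->
  partial j (partial i f) x = partial i (partial j f) x.
Proof.
move=> Ux df ddf cji cij.
have key e : 0 < e -> `|partial j (partial i f) x - partial i (partial j f) x| < e + e.
  move=> e0.
  have [r r0 Hr] := continuous2_ball Ux cji cij e0.
  pose t := r / 3.
  have t0 : 0 < t by rewrite divr_gt0.
  have B (k l : 'I_n) (a b : R) : `|a| <= `|t| -> `|b| <= `|t| ->
      ball x r (b *: delta_mx 0 l + (a *: delta_mx 0 k + x)).
    move=> at_ bt; rewrite -ball_normE /= addrA opprD addrCA subrr addr0 normrN.
    apply: le_lt_trans (ler_normD _ _) _; rewrite !normrZ.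
    have := ler_piMr (normr_ge0 a) (norm_delta_le1 R k).
    have := ler_piMr (normr_ge0 b) (norm_delta_le1 R l).
    move: at_ bt; rewrite (gtr0_norm t0) /t; lra.
  have [|a [b [at_ bt]]] := @second_difference_MVT R n f x (delta_mx 0 i) (delta_mx 0 j) t.
    by move=> a b at_ bt; have [Uy _ _] := Hr _ (B i j a b at_ bt); split; [exact: df|exact: (ddf _ _ _ Uy)].
  have [|a' [b' [at' bt']]] := @second_difference_MVT R n f x (delta_mx 0 j) (delta_mx 0 i) t.
    by move=> c d ct dt; have [Uy _ _] := Hr _ (B j i c d ct dt); split; [exact: df|exact: (ddf _ _ _ Uy)].
  have [_ h1 _] := Hr _ (B i j a b at_ bt).
  have [_ _ h2] := Hr _ (B j i a' b' at' bt').
  rewrite (addrCA (t *: delta_mx 0 i)) => E1 E2.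
  have E : partial j (partial i f) (b *: delta_mx 0 j + (a *: delta_mx 0 i + x)) =
           partial i (partial j f) (b' *: delta_mx 0 i + (a' *: delta_mx 0 j + x)).
    have tn : t != 0 by rewrite gt_eqF.
    apply: (mulfI tn); apply: (mulfI tn); rewrite -[LHS]E2 -[RHS]E1; ring.
  move: h1; rewrite E => h1; exact: (dist_lt_add h1 h2).
move: (partial j _ x) (partial i _ x) key => P Q key.
apply/eqP; rewrite -subr_eq0 -normr_eq0 eq_le normr_ge0 andbT leNgt.
apply/negP => d0; have := key _ (divr_gt0 d0 (ltr0n R 2)).
by rewrite -splitr ltxx.
Qed.

Lemma isC_partialC (R : realType) (n : nat) (f : 'rV[R]_n -> R) (i j : 'I_n) :
  isC 2 f -> partial j (partial i f) = partial i (partial j f).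
Proof.
move=> [_ H]; apply/funext => x; apply: (@schwarz R n setT) => //.
- exact: filterT.
- by move=> k y _; have [d _] := H k; exact: d.
- by move=> k l y _; have [_ [_ /(_ l)[d _]]] := H k; exact: d.
- by have [_ [_ /(_ j)[_ [c _]]]] := H i; exact: c.
- by have [_ [_ /(_ i)[_ [c _]]]] := H j; exact: c.
Qed.

Section isC_closure.
Variables (R : realType) (n : nat).
Implicit Types (f g : 'rV[R]_n -> R).

Lemma isC_cst k (c : R) : isC k (fun _ : 'rV[R]_n => c).
Proof.
elim: k c => [|k IH] c; first (split; [exact: cst_continuous|by []]).
split; first exact: cst_continuous.
move=> i; split; first by move=> x; exact: derivable_cst.
rewrite (_ : partial i _ = fun=> 0); first exact: IH.
by apply/funext => x; exact: derive_cst.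
Qed.

Lemma isC_D k f g : isC k f -> isC k g -> isC k (fun x => f x + g x).
Proof.
elim: k f g => [|k IH] f g [cf Hf] [cg Hg].
  split => // x; apply: (@cvgD _ _ _ (nbhs x)); [exact: cf|exact: cg].
split; first by move=> x; apply: (@cvgD _ _ _ (nbhs x)); [exact: cf|exact: cg].
move=> i; have [df Cf] := Hf i; have [dg Cg] := Hg i.
split; first by move=> x; apply: derivableD.
rewrite (_ : partial i _ = fun x => partial i f x + partial i g x); first exact: IH.
by apply/funext => x; exact: deriveD.
Qed.

Lemma partialM i f g x : derivable f x (delta_mx 0 i) ->
  derivable g x (delta_mx 0 i) ->
  partial i (fun y => f y * g y) x = f x * partial i g x + g x * partial i f x.
Proof. move=> df dg; exact: (deriveM df dg). Qed.

Lemma isC_M k f g : isC k f -> isC k g -> isC k (fun x => f x * g x).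
Proof.
elim: k f g => [|k IH] f g Hf Hg.
  have cf := isC_continuous Hf; have cg := isC_continuous Hg.
  split => // x; apply: (@cvgM _ _ (nbhs x)); [exact: cf|exact: cg].
have Hf' := isC_pred Hf; have Hg' := isC_pred Hg.
move: Hf Hg => [cf Hf] [cg Hg].
split; first by move=> x; apply: (@cvgM _ _ (nbhs x)); [exact: cf|exact: cg].
move=> i; have [df Cf] := Hf i; have [dg Cg] := Hg i.
split; first by move=> x; apply: derivableM.
rewrite (_ : partial i _ = fun x => f x * partial i g x + g x * partial i f x).
  by apply: isC_D; exact: IH.
by apply/funext => x; exact: partialM.
Qed.

Lemma isC_sum k (I : Type) (r : seq I) (P : pred I) (F : I -> 'rV[R]_n -> R) :
  (forall i, P i -> isC k (F i)) -> isC k (fun x => \sum_(i <- r | P i) F i x).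
Proof. exact: (ring_class_sum (isC_cst k) (@isC_D k)). Qed.

Lemma isC_cofactor_trunc k (A : {set 'I_n}) i j (M : 'rV[R]_n -> 'M[R]_n) :
  (forall i j, isC k (fun x => M x i j)) ->
  isC k (fun x => cofactor (trunc_mx A (M x)) i j).
Proof.
move=> CM; apply: (ring_class_cofactor (isC_cst k) (@isC_D k) (@isC_M k)) => a b.
exact: (ring_class_trunc (isC_cst k) CM).
Qed.

Lemma isC_minor_deriv k p i j (M : 'rV[R]_n -> 'M[R]_n) :
  (forall i j, isC k (fun x => M x i j)) ->
  isC k (fun x => minor_deriv p i j (M x)).
Proof. exact: (ring_class_minor_deriv (isC_cst k) (@isC_D k) (@isC_M k)). Qed.

Lemma isC_minor_sum k p (M : 'rV[R]_n -> 'M[R]_n) :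
  (forall i j, isC k (fun x => M x i j)) -> isC k (fun x => minor_sum p (M x)).
Proof. exact: (ring_class_minor_sum (isC_cst k) (@isC_D k) (@isC_M k)). Qed.

Lemma isC_hessian k f i j : isC k.+2 f -> isC k (fun x => hessian f x i j).
Proof.
move=> [_ H1]; have [_ [_ H2]] := H1 j; have [_ H] := H2 i.
rewrite (_ : (fun x => _) = partial i (partial j f)); first exact: H.
by apply/funext => x; rewrite mxE.
Qed.
End isC_closure.

(** * The weak form of the equation *)

Section bsupp_closure.
Variables (R : realType) (n : nat).
Implicit Types (f g : 'rV[R]_n -> R).

Lemma bsupp_Mr f g : bsupp g -> bsupp (fun x => f x * g x).
Proof. by move=> [M H]; exists M => x /H ->; rewrite mulr0. Qed.

Lemma bsupp_Ml f g : bsupp f -> bsupp (fun x => f x * g x).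
Proof. by move=> [M H]; exists M => x /H ->; rewrite mul0r. Qed.

Lemma bsupp_D f g : bsupp f -> bsupp g -> bsupp (fun x => f x + g x).
Proof.
move=> [M H] [N K]; exists (Num.max M N) => x; rewrite gt_max => /andP[/H -> /K ->].
by rewrite addr0.
Qed.

Lemma bsupp_sum (I : Type) (r : seq I) (F : I -> 'rV[R]_n -> R) :
  (forall i, bsupp (F i)) -> bsupp (fun x => \sum_(i <- r) F i x).
Proof.
move=> H; elim: r => [|i r IH].
  by exists 0 => x _; rewrite big_nil.
rewrite (_ : (fun x => _) = fun x => F i x + \sum_(i <- r) F i x).
  exact: bsupp_D.
by apply/funext => x; rewrite big_cons.
Qed.

Lemma intRn_setT f : intRn setT f = \int[leb R n]_t f (row_of_tuple t).
Proof. by rewrite /intRn preimage_setT. Qed.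

Lemma intRnD f g : continuous f -> bsupp f -> continuous g -> bsupp g ->
  intRn setT (fun x => f x + g x) = intRn setT f + intRn setT g.
Proof.
move=> cf sf cg sg; rewrite !intRn_setT; apply: RintegralD => //.
- exact: integrable_continuous_bsupp cf sf.
- exact: integrable_continuous_bsupp cg sg.
Qed.

Lemma intRnZ c f : continuous f -> bsupp f ->
  intRn setT (fun x => c * f x) = c * intRn setT f.
Proof.
move=> cf sf; rewrite !intRn_setT; apply: RintegralZl => //.
exact: integrable_continuous_bsupp cf sf.
Qed.

Lemma intRn_sum (I : Type) (r : seq I) (F : I -> 'rV[R]_n -> R) :
  (forall i, isC 0 (F i)) -> (forall i, bsupp (F i)) ->
  intRn setT (fun x => \sum_(i <- r) F i x) = \sum_(i <- r) intRn setT (F i).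
Proof.
move=> cF sF; elim: r => [|i r IH].
  rewrite big_nil (_ : (fun x => _) = fun=> 0).
    by rewrite /intRn /Rintegral integral0_eq.
  by apply/funext => x; rewrite big_nil.
rewrite big_cons -IH -intRnD.
- by congr intRn; apply/funext => x; rewrite big_cons.
- by case: (cF i).
- exact: sF.
- by apply: (isC_continuous (k := 0)); apply: isC_sum => j _; exact: cF.
- exact: bsupp_sum.
Qed.

Lemma intRn_partial0 i f : isC 1 f -> bsupp f -> intRn setT (partial i f) = 0.
Proof.
move=> [cf H] sf; have [df [cdf _]] := H i.
by rewrite intRn_setT /Rintegral integral_partial0.
Qed.

Lemma partial_sum (I : Type) (r : seq I) (P : pred I) (F : I -> 'rV[R]_n -> R) j x :
  (forall i, P i -> derivable (F i) x (delta_mx 0 j)) ->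
  partial j (fun x => \sum_(i <- r | P i) F i x) x =
  \sum_(i <- r | P i) partial j (F i) x.
Proof.
move=> dF.
suff [_ E] : is_derive x (delta_mx 0 j) (fun x => \sum_(i <- r | P i) F i x)
    (\sum_(i <- r | P i) partial j (F i) x) by exact: E.
elim: r => [|i r IH].
  rewrite big_nil (_ : (fun x => _) = cst 0); first exact: is_derive_cst.
  by apply/funext => y; rewrite big_nil.
rewrite big_cons; case: ifP => Pi; last first.
  rewrite (_ : (fun x => _) = (fun x => \sum_(i <- r | P i) F i x)); first exact: IH.
  by apply/funext => y; rewrite big_cons Pi.
rewrite (_ : (fun x => _) = F i + (fun x => \sum_(i <- r | P i) F i x)).
  by apply: is_deriveD; apply: derivableP; exact: dF.
by apply/funext => y; rewrite big_cons Pi.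
Qed.
End bsupp_closure.

Section weak_identity_C3.
Variables (R : realType) (n p : nat) (w phi : 'rV[R]_n -> R).
Hypotheses (Cw : isC 3 w) (Cphi : isC 1 phi) (sphi : bsupp phi).

Let H y := hessian w y.

Let CH i j : isC 1 (fun x => H x i j).
Proof. exact: isC_hessian. Qed.

Let Cw1 i : isC 2 (partial i w).
Proof. by case: Cw => _ /(_ i)[]. Qed.

Let CH2 i j : isC 1 (partial i (partial j w)).
Proof. by have [_ /(_ i)[_ C]] := Cw1 j. Qed.

Let HE i j : (fun y => H y i j) = partial i (partial j w).
Proof. by apply/funext => y; rewrite mxE. Qed.

Let Hsym i j : partial i (partial j w) = partial j (partial i w).
Proof. by apply: isC_partialC; exact: isC_leq Cw. Qed.

(** The rows of the truncated Hessian are gradients of functions or constant,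
    so Piola's identity applies to each principal minor. *)
Lemma piola_minor_deriv i x :
  \sum_j partial j (fun y => minor_deriv p i j (H y)) x = 0.
Proof.
have CA A j : isC 1 (fun y => cofactor (trunc_mx A (H y)) i j).
  by apply: isC_cofactor_trunc; exact: CH.
have E j : partial j (fun y => minor_deriv p i j (H y)) x =
    \sum_(A : {set 'I_n} | (#|A| == p) && (i \in A))
      partial j (fun y => cofactor (trunc_mx A (H y)) i j) x.
  apply: (@partial_sum R n _ _ _ (fun A y => cofactor (trunc_mx A (H y)) i j)).
  by move=> A _; have [_ /(_ j)[d _]] := CA A j; exact: d.
under eq_bigr => j _ do rewrite E.
rewrite exchange_big /= big1 // => A /andP[_ iA].
apply: (@piola R n (fun y => trunc_mx A (H y))
  (fun j => \matrix_(k, l) if k \in A then partial j (partial k (partial l w)) x else 0)).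
  move=> j k l; rewrite mxE.
  rewrite (_ : (fun y => _) = fun y => if k \in A then H y k l else (k == l)%:R); last first.
    by apply/funext => y; rewrite mxE.
  case: (k \in A); last exact: is_derive_cst.
  rewrite HE; apply: derivableP.
  have [_ /(_ j)[d _]] := CH2 k l. exact: d.
move=> j k l; rewrite [LHS]mxE [RHS]mxE; case: (k \in A); last by [].
by rewrite (Hsym k l) (isC_partialC l j (Cw1 k)) (Hsym k j).
Qed.

(** The divergence of the compactly supported field [T_p^ij w_i phi] has
    integral 0. By Piola's identity the derivative never falls on T_p^ij, so
    the divergence is [T_p^ij w_ij phi + T_p^ij w_i phi_j], and Euler's
    identity evaluates the first term. One derivative of T_p^ij, hence the
    third derivatives of w, are needed to write this. *)
Lemma weak_identity_C3 :
  intRn setT (fun x => \sum_i \sum_j minor_deriv p i j (H x) * partial i w x * partial j phi x)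
  = - (p%:R * intRn setT (fun x => phi x * minor_sum p (H x))).
Proof.
pose T i j y := minor_deriv p i j (H y).
have CT i j : isC 1 (T i j) by exact: isC_minor_deriv.
have Cwi i : isC 1 (partial i w) by exact: isC_pred.
pose F i j y := T i j y * partial i w y * phi y.
have CF i j : isC 1 (F i j) by do 2?apply: isC_M.
have sF i j : bsupp (F i j) by exact: bsupp_Mr.
have C0 f : isC 1 f -> continuous f by exact: isC_continuous.
have dC f j x : isC 1 f -> derivable f x (delta_mx 0 j).
  by move=> [_ /(_ j)[d _]]; exact: d.
have pF i j x : partial j (F i j) x =
   partial j (T i j) x * (partial i w x * phi x) +
   phi x * (T i j x * H x i j) + T i j x * partial i w x * partial j phi x.
  rewrite /F partialM; [|by apply: dC; exact: isC_M|exact: dC].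
  rewrite partialM; [|exact: dC|exact: dC].
  rewrite -[H x i j]/((fun y => H y i j) x) HE Hsym; ring.
have I0 : intRn setT (fun x => \sum_i \sum_j partial j (F i j) x) = 0.
  rewrite intRn_sum; last 2 first.
  - by move=> i; apply: isC_sum => j _; have [_ /(_ j)[]] := CF i j.
  - by move=> i; apply: bsupp_sum => j; exact: bsupp_partial.
  rewrite big1 // => i _; rewrite intRn_sum; last 2 first.
  - by move=> j; have [_ /(_ j)[]] := CF i j.
  - by move=> j; exact: bsupp_partial.
  by rewrite big1 // => j _; exact: intRn_partial0.
have E x : \sum_i \sum_j partial j (F i j) x =
    (\sum_i \sum_j T i j x * partial i w x * partial j phi x) +
     p%:R * (phi x * minor_sum p (H x)).
  under eq_bigr => i _ do (under eq_bigr => j _ do rewrite pF; rewrite !big_split /=).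
  rewrite !big_split /= addrC; congr (_ + _).
  rewrite [X in X + _]big1 ?add0r => [|i _]; last first.
    by rewrite -mulr_suml piola_minor_deriv mul0r.
  rewrite mulrCA -minor_deriv_euler mulr_sumr; apply: eq_bigr => i _.
  by rewrite mulr_sumr.
have CM : isC 1 (fun x => phi x * minor_sum p (H x)).
  by apply: isC_M => //; exact: isC_minor_sum.
have sM : bsupp (fun x => phi x * minor_sum p (H x)) by exact: bsupp_Ml.
move: I0; under eq_fun do rewrite E.
rewrite intRnD.
- by rewrite intRnZ //; [move=> /eqP; rewrite addr_eq0 => /eqP|exact: C0].
- apply: (isC_continuous (k := 0)); apply: isC_sum => i _; apply: isC_sum => j _.
  apply: isC_M; first by apply: isC_pred; exact: isC_M.
  by have [_ /(_ j)[]] := Cphi.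
- apply: bsupp_sum => i; apply: bsupp_sum => j; apply: bsupp_Mr.
  exact: bsupp_partial.
- by apply: C0; apply: isC_M CM; exact: isC_cst.
- exact: bsupp_Mr.
Qed.
End weak_identity_C3.

(** Bounded pointwise convergence: it passes to sums and products, and to
    integrals by dominated convergence. *)
Definition bcvg (R : realType) (T : Type) (g : nat -> T -> R) (f : T -> R) : Prop :=
  (exists C, forall k x, `|g k x| <= C) /\
  forall x, g k x @[k --> \oo] --> f x.

Section bcvg.
Variables (R : realType) (T : Type).
Implicit Types (g : nat -> T -> R) (f : T -> R).

Lemma bcvg_cst f : (exists C, forall x, `|f x| <= C) -> bcvg (fun _ => f) f.
Proof. by move=> [C H]; split; [exists C|move=> x; exact: cvg_cst]. Qed.

Lemma bcvg_const (c : R) : bcvg (fun _ (_ : T) => c) (fun=> c).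
Proof. by apply: bcvg_cst; exists `|c|. Qed.

Lemma bcvg_D g1 g2 f1 f2 : bcvg g1 f1 -> bcvg g2 f2 ->
  bcvg (fun k x => g1 k x + g2 k x) (fun x => f1 x + f2 x).
Proof.
move=> [[C1 b1] c1] [[C2 b2] c2]; split.
  by exists (C1 + C2) => k x; rewrite (le_trans (ler_normD _ _)) // lerD.
by move=> x; apply: cvgD; [exact: c1|exact: c2].
Qed.

Lemma bcvg_M g1 g2 f1 f2 : bcvg g1 f1 -> bcvg g2 f2 ->
  bcvg (fun k x => g1 k x * g2 k x) (fun x => f1 x * f2 x).
Proof.
move=> [[C1 b1] c1] [[C2 b2] c2]; split.
  by exists (C1 * C2) => k x; rewrite normrM ler_pM.
by move=> x; apply: cvgM; [exact: c1|exact: c2].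
Qed.

(* A sequence together with its limit is one function on option nat * T, the
   limit sitting at None; these functions form a class closed under the ring
   operations. *)
Let K (f : option nat * T -> R) : Prop :=
  bcvg (fun k x => f (Some k, x)) (fun x => f (None, x)).

Let join (A : Type) (G : nat -> T -> A) (F : T -> A) (q : option nat * T) : A :=
  if q.1 is Some k then G k q.2 else F q.2.

Let K_cst c : K (fun=> c). Proof. exact: bcvg_const. Qed.

Let K_D a b : K a -> K b -> K (fun q => a q + b q). Proof. exact: bcvg_D. Qed.

Let K_M a b : K a -> K b -> K (fun q => a q * b q). Proof. exact: bcvg_M. Qed.

Lemma bcvg_sum (I : Type) (r : seq I) (P : pred I) (G : I -> nat -> T -> R)
    (F : I -> T -> R) : (forall i, P i -> bcvg (G i) (F i)) ->
  bcvg (fun k x => \sum_(i <- r | P i) G i k x) (fun x => \sum_(i <- r | P i) F i x).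
Proof.
exact: (@ring_class_sum _ _ K K_cst K_D I r P (fun i => join (G i) (F i))).
Qed.

Lemma bcvg_minor_deriv m p i j (G : nat -> T -> 'M[R]_m) (F : T -> 'M[R]_m) :
  (forall i j, bcvg (fun k x => G k x i j) (fun x => F x i j)) ->
  bcvg (fun k x => minor_deriv p i j (G k x)) (fun x => minor_deriv p i j (F x)).
Proof.
exact: (@ring_class_minor_deriv _ _ K K_cst K_D K_M m p i j (join G F)).
Qed.

Lemma bcvg_minor_sum m p (G : nat -> T -> 'M[R]_m) (F : T -> 'M[R]_m) :
  (forall i j, bcvg (fun k x => G k x i j) (fun x => F x i j)) ->
  bcvg (fun k x => minor_sum p (G k x)) (fun x => minor_sum p (F x)).
Proof.
exact: (@ring_class_minor_sum _ _ K K_cst K_D K_M m p (join G F)).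
Qed.
End bcvg.

Lemma intRn_bcvg (R : realType) (n : nat) (g : nat -> 'rV[R]_n -> R)
    (f : 'rV[R]_n -> R) (M : R) :
  (forall k, continuous (g k)) -> continuous f -> bcvg g f ->
  (forall k x, M < `|x| -> g k x = 0) ->
  intRn setT (g k) @[k --> \oo] --> intRn setT f.
Proof.
move=> cg cf [[C gC] gf] gM.
have sg k : bsupp (g k) by exists M; exact: gM.
have sf : bsupp f.
  exists M => x Mx; apply/esym; apply: (@cvg_unique _ (@Rhausdorff R) (g k x @[k --> \oo])).
    rewrite (_ : (fun k => g k x) = cst 0); first exact: cvg_cst.
    by apply/funext => k; rewrite gM.
  exact: gf.
have ig k := integrable_continuous_bsupp (cg k) (sg k).
have if_ := integrable_continuous_bsupp cf sf.
pose D t := (C%:E * (\1_(box n M) t)%:E)%E : \bar R.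
have C0 : 0 <= C by apply: le_trans (gC 0%N 0).
have iD : (leb R n).-integrable setT D.
  apply: integrableZl => //; apply/integrableP; split.
    by apply/measurable_EFinP; apply: measurable_indic; exact: measurable_box.
  rewrite (eq_integral (fun x => (\1_(box n M) x)%:E)); last first.
    by move=> t _; rewrite gee0_abs // lee_fin.
  by rewrite integral_indic ?setIT; [exact: leb_box_lty| |exact: measurable_box].
have [] := @dominated_convergence _ _ R (leb R n) setT measurableT
  (fun k t => (g k (row_of_tuple t))%:E) (fun t => (f (row_of_tuple t))%:E) D.
- by move=> k; exact: measurable_int (ig k).
- exact: measurable_int if_.
- apply: aeW => t _; apply: cvg_EFin; last exact: gf.
  by near=> k.
- exact: iD.
- apply: aeW => t k _; rewrite /D /= -EFinM lee_fin indicE.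
  have [tM|tM] := boolP (t \in box n M); first by rewrite mulr1.
  rewrite mulr0 gM ?normr0 // ltNge; apply/negP => H; move/negP: tM; apply.
  apply/mem_set => i; have := ler_coord_norm (row_of_tuple t) i.
  by rewrite mxE => /le_trans; apply.
move=> _ _ cvI; under eq_fun do rewrite intRn_setT; rewrite intRn_setT.
apply: fine_cvg; rewrite fineK //.
exact: integrable_fin_num.
Unshelve. all: by end_near. Qed.

(** Both sides involve only two derivatives of w, and converge under smoothing
    of w. *)
Lemma weak_identity (R : realType) (n p : nat) (w phi : 'rV[R]_n -> R) :
  isC 2 w -> bsupp w -> isC 1 phi -> bsupp phi ->
  intRn setT (fun x => \sum_i \sum_j
     minor_deriv p i j (hessian w x) * partial i w x * partial j phi x)
  = - (p%:R * intRn setT (fun x => phi x * minor_sum p (hessian w x))).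
Proof.
move=> Cw sw Cphi sphi.
pose wk k := smoothing k.+1%:R^-1 (enum 'I_n) w.
have h0 k : 0 < k.+1%:R^-1 :> R by rewrite invr_gt0.
have Cwk k : isC 3 (wk k).
  by apply: smoothing_gain => // i; rewrite mem_enum.
have bc f : continuous f -> bsupp f ->
    bcvg (fun k => smoothing k.+1%:R^-1 (enum 'I_n) f) f.
  move=> cf sf; split.
    by have [C HC] := smoothing_bounded cf sf; exists C => k x; exact: HC.
  by move=> x; exact: smoothing_cvg.
have C1i i : isC 1 (partial i w) by have [_ /(_ i)[_ C]] := Cw.
have pw k i : partial i (wk k) = smoothing k.+1%:R^-1 (enum 'I_n) (partial i w).
  by apply: smoothing_partial => //; exact: isC_pred.
have ppw k i j : partial j (partial i (wk k)) =
    smoothing k.+1%:R^-1 (enum 'I_n) (partial j (partial i w)).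
  by rewrite pw smoothing_partial //; exact: bsupp_partial.
have bp i : bcvg (fun k => partial i (wk k)) (partial i w).
  rewrite (_ : (fun k => _) = fun k => smoothing k.+1%:R^-1 (enum 'I_n) (partial i w)).
    by apply: bc; [exact: isC_continuous (C1i i)|exact: bsupp_partial].
  by apply/funext => k; exact: pw.
have bh i j : bcvg (fun k x => hessian (wk k) x i j) (fun x => hessian w x i j).
  rewrite (_ : (fun k x => _) = fun k => smoothing k.+1%:R^-1 (enum 'I_n) (partial i (partial j w))).
    rewrite (_ : (fun x => _) = partial i (partial j w)); last first.
      by apply/funext => x; rewrite mxE.
    apply: bc; last by do 2?apply: bsupp_partial.
    by have [_ /(_ i)[_ []]] := C1i j.
  by apply/funext => k; apply/funext => x; rewrite mxE -ppw.
have CH k f : isC 2 f -> (k = 0)%N -> forall i j, isC k (fun x => hessian f x i j).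
  by move=> Cf -> i j; exact: isC_hessian.
have c1 i : isC 0 (partial i phi) by have [_ /(_ i)[]] := Cphi.
pose E f x := \sum_i \sum_j minor_deriv p i j (hessian f x) * partial i f x * partial j phi x.
pose Q f x := phi x * minor_sum p (hessian f x).
have cE f : isC 2 f -> continuous (E f).
  move=> Cf; apply: (isC_continuous (k := 0)); apply: isC_sum => i _; apply: isC_sum => j _.
  apply: isC_M (c1 j); apply: isC_M.
    by apply: isC_minor_deriv; exact: CH.
  by have [_ /(_ i)[_ C]] := Cf; exact: isC_pred.
have cQ f : isC 2 f -> continuous (Q f).
  move=> Cf; apply: (isC_continuous (k := 0)); apply: isC_M; first exact: isC_pred.
  by apply: isC_minor_sum; exact: CH.
have C2k k : isC 2 (wk k) by exact: isC_pred.
have [M pM] : exists M, forall x, M < `|x| -> phi x = 0 /\ forall j, partial j phi x = 0.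
  have H j := bsupp_partial j sphi; have [M0 HM0] := sphi.
  have [M' HM'] : exists M, forall x, M < `|x| -> forall j, partial j phi x = 0.
    exists (\sum_j Num.max 0 (sval (cid (H j)))) => x xM j.
    apply: (svalP (cid (H j))); apply: le_lt_trans xM.
    rewrite (bigD1 j) //= (@le_trans _ _ (Num.max 0 (sval (cid (H j))))) //.
      by rewrite le_max lexx orbT.
    by rewrite lerDl sumr_ge0 // => i _; rewrite le_max lexx.
  by exists (Num.max M0 M') => x; rewrite gt_max => /andP[/HM0 -> /HM' H'].
have bphi : bcvg (fun _ => phi) phi.
  by apply: bcvg_cst; apply: bsupp_bounded => //; exact: isC_continuous Cphi.
have bdphi j : bcvg (fun _ => partial j phi) (partial j phi).
  by apply: bcvg_cst; apply: bsupp_bounded; [exact: isC_continuous (c1 j)|exact: bsupp_partial].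
have lE : intRn setT (E (wk k)) @[k --> \oo] --> intRn setT (E w).
  apply: (@intRn_bcvg _ _ _ _ M).
  - move=> k; exact: (cE _ (C2k k)).
  - exact: (cE _ Cw).
  - apply: bcvg_sum => i _; apply: bcvg_sum => j _.
    apply: bcvg_M (bdphi j); apply: bcvg_M (bp i).
    exact: bcvg_minor_deriv.
  - move=> k x /pM[_ H]; rewrite /E big1 // => i _; rewrite big1 // => j _.
    by rewrite H mulr0.
have lQ : intRn setT (Q (wk k)) @[k --> \oo] --> intRn setT (Q w).
  apply: (@intRn_bcvg _ _ _ _ M).
  - move=> k; exact: (cQ _ (C2k k)).
  - exact: (cQ _ Cw).
  - by apply: bcvg_M bphi _; exact: bcvg_minor_sum.
  - by move=> k x /pM[H _]; rewrite /Q H mul0r.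
apply: (@cvg_unique _ (@Rhausdorff R) (intRn setT (E (wk k)) @[k --> \oo])); first exact: lE.
rewrite (_ : (fun k => _) = fun k => - (p%:R * intRn setT (Q (wk k)))).
  by apply: cvgN; apply: cvgM; [exact: cvg_cst|exact: lQ].
by apply/funext => k; exact: (weak_identity_C3 p (Cwk k) Cphi sphi).
Qed.

(** * Second-order conditions at extrema *)

(** The derivative q vanishes at 0; if its slope c were negative then q < 0
    just to the right of 0 and p would decrease. *)
Lemma second_order_min (R : realType) (p q : R -> R) (c r : R) :
  0 < r ->
  (forall t : R, `|t| < r -> is_derive t 1 p (q t)) ->
  is_derive (0 : R) 1 q c ->
  (forall t : R, `|t| < r -> p 0 <= p t) -> 0 <= c.
Proof.
move=> r0 dp dq pmin.
have q0 : q 0 = 0.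
  have rr : - r < r by lra.
  have h0 : (0 : R) \in `]- r, r[ by rewrite in_itv /=; lra.
  have dpr : {in `]- r, r[, forall x, derivable p x 1}.
    by move=> t; rewrite in_itv /= -ltr_norml => /dp[].
  have := @derive1_at_min R p (- r) r 0 (ltW rr) dpr h0.
  case=> [t|_ D]; first by rewrite in_itv /= -ltr_norml; exact: pmin.
  by have := dp 0; rewrite normr0 => /(_ r0)[_ <-].
rewrite leNgt; apply/negP => c0.
have [dq1 dq2] := dq.
have : (fun h : R => h^-1 *: ((q \o shift 0) (h *: 1) - q 0)) @ 0^' --> c.
  rewrite -dq2; exact: dq1.
move=> /cvgrPdist_lt /(_ (- c)); rewrite oppr_gt0 => /(_ c0).
rewrite /dnbhs /within /= => /nbhs_ballP[d /= d0 Hd].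
pose t := Num.min (r / 2) (d / 2).
have t0 : 0 < t by rewrite lt_min !divr_gt0.
have tr : t < r by rewrite (@le_lt_trans _ _ (r / 2)) ?ge_min ?lexx //; lra.
have td : t < d by rewrite (@le_lt_trans _ _ (d / 2)) ?ge_min ?lexx ?orbT //; lra.
have ab s : 0 <= s <= t -> `|s| < r by move=> ?; rewrite ger0_norm; lra.
have [||s] := @MVT R p q 0 t t0.
- by move=> s; rewrite in_itv /= => st; apply: dp; apply: ab; lra.
- apply: derivable_within_continuous => s; rewrite in_itv /= => st.
  by case: (dp s (ab s st)).
rewrite in_itv /= subr0 => /andP[s0 st] E.
have : q s < 0.
  have sn : s != 0 by rewrite gt_eqF.
  have := Hd s; rewrite -ball_normE /= sub0r normrN gtr0_norm // => /(_ (lt_trans st td) sn).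
  rewrite addr0 q0 subr0 /GRing.scale /= mulr1 => H.
  have : s^-1 * q s < 0.
    by move: H; rewrite ltr_distlC => /andP[_]; lra.
  by rewrite pmulr_rlt0 // invr_gt0.
have := pmin t; rewrite gtr0_norm // => /(_ tr); rewrite -subr_ge0 E.
by rewrite pmulr_lge0 // => /le_gtF ->.
Qed.

(** The chain rule in the form needed here: the increment along u + c e_k is
    the one along u followed by one along e_k, where the mean value theorem
    and the continuity of the k-th derivative apply. *)
Lemma is_derive_addv (R : realType) (n : nat) (g : 'rV[R]_n -> R)
    (x u : 'rV[R]_n) (k : 'I_n) (a c : R) (U : set 'rV[R]_n) : nbhs x U ->
  is_derive x u g a ->
  (forall y, U y -> derivable g y (delta_mx 0 k)) ->
  {for x, continuous (partial k g)} ->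
  is_derive x (u + c *: delta_mx 0 k) g (a + c * partial k g x).
Proof.
move=> Ux [du1 du2] dg cg; set e := delta_mx 0 k : 'rV[R]_n.
suff H : (fun t : R => t^-1 *: ((g \o shift x) (t *: (u + c *: e)) - g x)) @ 0^'
    --> a + c * partial k g x.
  split; first by apply/cvg_ex; exists (a + c * partial k g x).
  exact: cvg_lim H.
pose q1 (t : R) := t^-1 *: ((g \o shift x) (t *: u) - g x).
pose q2 (t : R) := t^-1 * (g ((t * c) *: e + (t *: u + x)) - g (t *: u + x)).
have -> : (fun t : R => t^-1 *: ((g \o shift x) (t *: (u + c *: e)) - g x)) =
    (fun t => q1 t + q2 t).
  apply/funext => t; rewrite /q1 /q2 /=.
  have -> : t *: (u + c *: e) + x = (t * c) *: e + (t *: u + x).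
    by rewrite scalerDr scalerA -addrA addrCA.
  rewrite /GRing.scale /=; ring.
apply: cvgD; first by rewrite -du2; exact: du1.
apply/cvgrPdist_lt => eps eps0.
pose L := `|u| + `|c| + 1; have L0 : 0 < L by rewrite /L ltr_pwDr // addr_ge0.
pose M := `|c| + 1; have M0 : 0 < M by rewrite /M ltr_pwDr.
have eM : 0 < eps / M by rewrite divr_gt0.
have [r r0 Hr] := continuous2_ball Ux cg cg eM.
near=> t.
have t0 : t != 0 by near: t; exact: nbhs_dnbhs_neq.
have tr : `|t| * L < r.
  rewrite -ltr_pdivlMr //; near: t; apply: nbhs_dnbhs.
  apply: (open_nbhs_nbhs (A := [set t : R | `|t| < r / L])).
  split; last by rewrite /= normr0 divr_gt0.
  apply: (open_comp (f := fun x : R => `|x|)) (@open_lt _ (r / L)).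
  by move=> y _; exact: norm_continuous.
have inb (s : R) : `|s| <= `|t * c| -> ball x r (s *: e + (t *: u + x)).
  move=> sc; rewrite -ball_normE /= addrA opprD addrCA subrr addr0 normrN.
  apply: le_lt_trans tr; apply: le_trans (ler_normD _ _) _.
  rewrite !normrZ /L !mulrDr mulr1.
  have := ler_piMr (normr_ge0 s) (norm_delta_le1 R k).
  move: sc; rewrite normrM; have := normr_ge0 t; rewrite -/e; lra.
have [|s sc E] := @line_MVT R n g (t *: u + x) e (t * c).
  by move=> s sc; have [Uy _ _] := Hr _ (inb s sc); exact: dg.
rewrite /q2 E mulrA mulrA mulVf // mul1r -/(partial k g _) -mulrBr normrM.
have [_ h _] := Hr _ (inb s sc).
apply: (@le_lt_trans _ _ (`|c| * (eps / M))).
  by rewrite ler_wpM2l // ltW.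
rewrite mulrCA -[X in _ < X]mulr1 ltr_pM2l // ltr_pdivrMr // mul1r.
by rewrite ltrDl.
Unshelve. all: by end_near. Qed.

(** The coordinates of v are added one at a time. *)
Lemma is_derive_gradient (R : realType) (n : nat) (g : 'rV[R]_n -> R)
    (x v : 'rV[R]_n) (U : set 'rV[R]_n) : nbhs x U ->
  (forall k y, U y -> derivable g y (delta_mx 0 k)) ->
  (forall k, {for x, continuous (partial k g)}) ->
  is_derive x v g (\sum_k v 0 k * partial k g x).
Proof.
move=> Ux dg cg; rewrite [v in is_derive _ v](row_sum_delta v).
have : forall s : seq 'I_n, is_derive x (\sum_(k <- s) v 0 k *: delta_mx 0 k) g
    (\sum_(k <- s) v 0 k * partial k g x).
  elim=> [|k s IH]; first by rewrite !big_nil; exact: is_derive0.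
  rewrite !big_cons (addrC (v 0 k *: _)) (addrC (v 0 k * _)).
  exact: (is_derive_addv (v 0 k) Ux IH (dg k) (@cg k)).
by apply.
Qed.

Lemma hessian_psd_min (R : realType) (n : nat) (U : set 'rV[R]_n)
    (f : 'rV[R]_n -> R) (x : 'rV[R]_n) (v : 'I_n -> R) : open U -> U x ->
  has_partials 2 U f ->
  (forall (s : seq 'I_n) y, (size s <= 2)%N -> U y -> {for y, continuous (partials s f)}) ->
  (forall y, U y -> f x <= f y) ->
  0 <= \sum_i \sum_j v i * hessian f x i j * v j.
Proof.
move=> oU Ux pf cf fmin; pose V : 'rV[R]_n := \row_i v i.
have /nbhs_ballP[r /= r0 Hr] : nbhs x U by exact: open_nbhs_nbhs.
pose L := `|V| + 1; have L0 : 0 < L by rewrite /L ltr_pwDr.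
have inU (t : R) : `|t| < r / L -> U (t *: V + x).
  rewrite ltr_pdivlMr // => tL; apply: Hr; rewrite -ball_normE /= opprD addrCA subrr addr0.
  rewrite normrN normrZ; apply: le_lt_trans tL.
  by rewrite ler_wpM2l // /L lerDl.
have nU y : U y -> nbhs y U by move=> Uy; apply: open_nbhs_nbhs.
pose p (t : R) := f (t *: V + x).
pose q (t : R) := \sum_k v k * partial k f (t *: V + x).
have dp (t : R) : `|t| < r / L -> is_derive t 1 p (q t).
  move=> tL; have Uy := inU t tL.
  have [d1 d2] : is_derive (t *: V + x) V f (\sum_k V 0 k * partial k f (t *: V + x)).
    apply: (is_derive_gradient _ (nU _ Uy)) => [k y Uy'|k].
      exact: (pf [::] k y).
    exact: (cf [:: k]).
  split; first exact: (proj2 (line_derive f x V t).2 d1).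
  rewrite (line_derive f x V t).1 d2; apply: eq_bigr => k _.
  by rewrite mxE.
have dq : is_derive (0 : R) 1 q (\sum_i \sum_j v i * hessian f x i j * v j).
  have -> : \sum_i \sum_j v i * hessian f x i j * v j =
      \sum_k v k *: (\sum_i V 0 i * partial i (partial k f) x).
    rewrite exchange_big; apply: eq_bigr => k _.
    rewrite /GRing.scale /= mulr_sumr; apply: eq_bigr => i _.
    by rewrite !mxE mulrC.
  have -> : q = \sum_k (fun t : R => v k *: partial k f (t *: V + x)).
    by apply/funext => t; rewrite /q fct_sumE.
  apply: is_derive_sum => k; apply: is_deriveZ.
  have [d1 d2] : is_derive x V (partial k f) (\sum_i V 0 i * partial i (partial k f) x).
    apply: (is_derive_gradient _ (nU _ Ux)) => [i y Uy'|i].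
      exact: (pf [:: k] i y).
    exact: (cf [:: i; k]).
  have LD := line_derive (partial k f) x V 0.
  rewrite scale0r add0r in LD.
  split; first exact: (proj2 LD.2 d1).
  by rewrite LD.1.
apply: (@second_order_min R p q _ (r / L)) => //; first by rewrite divr_gt0.
move=> t tL; rewrite /p scale0r add0r; apply: fmin; exact: inU.
Qed.

Lemma partial2_le0_max (R : realType) (n : nat) (U : set 'rV[R]_n)
    (f : 'rV[R]_n -> R) (x : 'rV[R]_n) (i : 'I_n) : open U -> U x ->
  has_partials 2 U f -> (forall y, U y -> f y <= f x) ->
  hessian f x i i <= 0.
Proof.
move=> oU Ux pf fmax; set e := delta_mx 0 i : 'rV[R]_n.
have /nbhs_ballP[r /= r0 Hr] : nbhs x U by exact: open_nbhs_nbhs.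
have inU (t : R) : `|t| < r -> U (t *: e + x).
  move=> tL; apply: Hr; rewrite -ball_normE /= opprD addrCA subrr addr0.
  rewrite normrN normrZ; apply: le_lt_trans tL.
  by rewrite ler_piMr // norm_delta_le1.
rewrite -oppr_ge0 mxE.
pose p (t : R) := - f (t *: e + x).
pose q (t : R) := - partial i f (t *: e + x).
apply: (@second_order_min R p q _ r) => //.
- move=> t tr; apply: is_deriveN.
  have d := pf [::] i (t *: e + x) isT (inU t tr).
  split; first exact: (proj2 (line_derive f x e t).2 d).
  exact: (line_derive f x e t).1.
- apply: is_deriveN.
  have d := pf [:: i] i x isT Ux.
  have LD := line_derive (partial i f) x e 0; rewrite scale0r add0r in LD.
  split; first exact: (proj2 LD.2 d).
  by rewrite LD.1.
- move=> t tr; rewrite /p lerN2 scale0r add0r; apply: fmax; exact: inU.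
Qed.

(** * Continuity up to the boundary *)

(** The regularity that the derivatives of the solution have: no derivative is
    defined at boundary points, and on a bounded U this suffices for
    boundedness. *)
Definition extends_cont (R : realType) (n : nat) (U : set 'rV[R]_n)
    (f : 'rV[R]_n -> R) : Prop :=
  exists g : 'rV[R]_n -> R, {within closure U, continuous g} /\
    forall x, U x -> g x = f x.

Section extends_cont.
Variables (R : realType) (n : nat) (U : set 'rV[R]_n).
Implicit Types (f g : 'rV[R]_n -> R).

Lemma extends_cont_cst c : extends_cont U (fun=> c).
Proof. by exists (fun=> c); split => //; apply: continuous_subspaceT; exact: cst_continuous. Qed.

Lemma extends_cont_D f g : extends_cont U f -> extends_cont U g ->
  extends_cont U (fun x => f x + g x).
Proof.
move=> [f' [/subspace_continuousP cf ff']] [g' [/subspace_continuousP cg gg']].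
exists (fun x => f' x + g' x); split; last by move=> x Ux; rewrite ff' // gg'.
apply/subspace_continuousP => x Ux.
by apply: (@cvgD _ _ _ (within (closure U) (nbhs x))); [exact: cf|exact: cg].
Qed.

Lemma extends_cont_M f g : extends_cont U f -> extends_cont U g ->
  extends_cont U (fun x => f x * g x).
Proof.
move=> [f' [/subspace_continuousP cf ff']] [g' [/subspace_continuousP cg gg']].
exists (fun x => f' x * g' x); split; last by move=> x Ux; rewrite ff' // gg'.
apply/subspace_continuousP => x Ux.
by apply: (@cvgM _ _ (within (closure U) (nbhs x))); [exact: cf|exact: cg].
Qed.

Hypotheses (oU : open U) (bU : bounded_set U).

Lemma extends_cont_continuous f x : extends_cont U f -> U x ->
  {for x, continuous f}.
Proof.
move=> [g [/subspace_continuousP cg gf]] Ux.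
have Ucl : closure U x by exact: subset_closure.
have nU : nbhs x U by exact: open_nbhs_nbhs.
have H : g @ nbhs x --> g x.
  move=> A gA; have H : \forall y \near x, closure U y -> A (g y) := cg x Ucl A gA.
  by apply: filterS2 nU H => y Uy; apply; exact: subset_closure.
suff : f @ nbhs x --> g x by rewrite (gf x Ux).
apply: cvg_trans H; apply: near_eq_cvg.
by apply: filterS nU => y; exact: gf.
Qed.

Lemma compact_closure_bounded : compact (closure U).
Proof.
apply: bounded_closed_compact; last exact: closed_closure.
have [M [Mr HM]] := bU; exists (M + 1); split; first exact: num_real.
move=> N MN x clx /=; rewrite leNgt; apply/negP => Nx.
have : nbhs x [set y : 'rV[R]_n | N < `|y|].
  apply: (open_nbhs_nbhs (A := [set y : 'rV[R]_n | N < `|y|])); split => //.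
  apply: (open_comp (f := fun x : 'rV[R]_n => `|x|)) (@open_gt _ N).
  by move=> y _; exact: norm_continuous.
move=> /clx[y [Uy /=]]; have := HM N _ y Uy; rewrite /= => HN.
by rewrite ltNge HN // (lt_trans _ MN) // ltrDl.
Qed.

Lemma extends_cont_bounded f : extends_cont U f ->
  exists C, forall x, U x -> `|f x| <= C.
Proof.
move=> [g [cg gf]].
have /compact_bounded[C [_ HC]] : compact (g @` closure U).
  by apply: continuous_compact; [exact: cg|exact: compact_closure_bounded].
exists (C + 1) => x Ux; rewrite -gf //; apply: HC; first by rewrite ltrDl.
by exists x => //; exact: subset_closure.
Qed.

Lemma extends_cont_measurable f : extends_cont U f ->
  measurable_fun (@row_of_tuple R n @^-1` U) (f \o @row_of_tuple R n).
Proof.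
move=> Kf; apply: measurable_fun_open_row => // x; exact: extends_cont_continuous.
Qed.

Lemma leb_bounded_lty : (leb R n (@row_of_tuple R n @^-1` U) < +oo)%E.
Proof.
have [M [Mr HM]] := bU.
apply: le_lt_trans (@leb_box_lty R n (M + 1)).
apply: le_measure; rewrite ?inE; [exact: measurable_open_row|exact: measurable_box|].
move=> t /= Ut i; have := HM (M + 1) _ _ Ut; rewrite /= ltrDl ltr01 => /(_ isT).
by apply: le_trans; have := ler_coord_norm (row_of_tuple t) i; rewrite mxE.
Qed.
End extends_cont.

(** * Positivity and ellipticity of the solution *)

Lemma minor_sum_pos (R : rcfType) (n m : nat) (S : 'M[R]_n) :
  (forall i j, S i j = S j i) -> (m <= n)%N ->
  (forall p, (p <= m)%N -> 0 <= minor_sum p S) -> 0 < minor_sum m S ->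
  forall p, (p <= m)%N -> 0 < minor_sum p S.
Proof.
move=> Ss mn T0 Tm p pm; rewrite -(subKn pm).
elim: (m - p)%N {-2}(m - p)%N (leqnn (m - p)) (leq_subr p m) => [|k IH] d.
  by rewrite leqn0 => /eqP -> _; rewrite subn0.
rewrite leq_eqVlt => /predU1P[-> km|]; last by rewrite ltnS => dk dm; exact: IH.
have e : (m - k = (m - k.+1).+1)%N by lia.
apply: minor_sum_descent => //; first by lia.
  by move=> j jm; apply: T0; lia.
by rewrite -e; apply: IH => //; exact: ltnW.
Qed.

Lemma minor_sum1 (R : comNzRingType) (n : nat) (S : 'M[R]_n) :
  minor_sum 1 S = \sum_i S i i.
Proof.
case: n S => [|n] S.
  rewrite big_ord0 /minor_sum big_pred0 // => A.
  by rewrite (_ : A = finset.set0) ?cards0 //; apply/setP => -[].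
have trS := char_poly_trace (- S) (ltn0Sn n); rewrite raddfN opprK in trS.
apply: etrans trS; rewrite -coef_shift_poly // subn1 /= /char_poly /char_poly_mx /shift_poly.
by rewrite map_mxN opprK.
Qed.

Section solution.
Variables (R : realType) (n m l : nat) (Om : set 'rV[R]_n) (w : 'rV[R]_n -> R).
Hypotheses (hlm : (l < m)%N) (hmn : (m <= n)%N).
Hypotheses (hOm : bounded_domain Om) (hw : dirichlet_solution m l Om w).

Let oOm : open Om. Proof. by case: hOm. Qed.
Let bOm : bounded_set Om. Proof. by case: hOm. Qed.

Let pw : has_partials 2 Om w.
Proof. by case: hw => -[]. Qed.

Lemma solution_extends_cont (s : seq 'I_n) : (size s <= 2)%N ->
  extends_cont Om (partials s w).
Proof. by move=> s2; case: hw => -[_ _ /(_ s s2)]. Qed.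

Lemma solution_continuous (s : seq 'I_n) x : (size s <= 2)%N -> Om x ->
  {for x, continuous (partials s w)}.
Proof.
by move=> s2 Ox; apply: (extends_cont_continuous oOm (solution_extends_cont s2)).
Qed.

Lemma hessian_extends_cont i j : extends_cont Om (fun x => hessian w x i j).
Proof.
rewrite (_ : (fun x => _) = partials [:: i; j] w); first exact: solution_extends_cont.
by apply/funext => x; rewrite mxE.
Qed.

Lemma T_extends_cont p : extends_cont Om (fun x => minor_sum p (hessian w x)).
Proof.
apply: (ring_class_minor_sum (@extends_cont_cst R n Om) (@extends_cont_D R n Om) (@extends_cont_M R n Om)).
exact: hessian_extends_cont.
Qed.

Lemma Tij_extends_cont p i j :
  extends_cont Om (fun x => minor_deriv p i j (hessian w x)).
Proof.
apply: (ring_class_minor_deriv (@extends_cont_cst R n Om) (@extends_cont_D R n Om) (@extends_cont_M R n Om)).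
exact: hessian_extends_cont.
Qed.

Lemma solution_hessian_sym x i j : Om x -> hessian w x i j = hessian w x j i.
Proof.
move=> Ox; rewrite !mxE.
apply: (@schwarz R n Om w x j i (open_nbhs_nbhs (conj oOm Ox))).
- by move=> k y Oy; exact: (@pw [::] k y isT Oy).
- by move=> k k' y Oy; exact: (@pw [:: k] k' y isT Oy).
- exact: (solution_continuous (s := [:: i; j])).
- exact: (solution_continuous (s := [:: j; i])).
Qed.

(** A quotient is 1 only if its denominator is not 0. *)
Lemma solution_T_eq x : Om x ->
  minor_sum m (hessian w x) = minor_sum l (hessian w x) /\
  minor_sum m (hessian w x) != 0.
Proof.
case: hw => _ /(_ x) H _ _ /H; rewrite /T_ !ptraceE => E.
have l0 : minor_sum l (hessian w x) != 0.
  by apply/eqP => l0; move: E; rewrite l0 invr0 mulr0 => /esym/eqP; rewrite oner_eq0.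
have ml : minor_sum m (hessian w x) = minor_sum l (hessian w x).
  by rewrite -[LHS](divfK l0) E mul1r.
by split; rewrite ?ml.
Qed.

(** If w attains its minimum over the closure only on the boundary, the
    minimum is 0 and w vanishes identically. *)
Lemma solution_interior_min : exists2 x0, Om x0 & forall x, Om x -> w x0 <= w x.
Proof.
have [[y Oy] _ _ _] := hOm.
have [[cw _ _] _ w0 wle0] := hw.
have cK := compact_closure_bounded bOm.
have cl0 : closure Om !=set0 by exists y; exact: subset_closure.
have [x clx xmin] := compact_EVT_min cl0 cK cw.
have [Ox|nOx] := pselect (Om x).
  by exists x => // z Oz; apply: xmin; rewrite inE; exact: subset_closure.
exists y => // z Oz; have clz : closure Om z by exact: subset_closure.
have wx : w x = 0.
  by apply: w0; split; [exact: set_mem|move/interior_subset].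
have := xmin z; rewrite inE wx => /(_ clz) wz.
by apply: le_trans wz; apply: wle0; exact: subset_closure.
Qed.

(** The set where T_0, ..., T_m are all positive is open. It is relatively
    closed: in its closure they are nonnegative and T_m does not vanish, so
    they are all positive by [minor_sum_pos]. It is nonempty: at an interior
    minimum of w the Hessian is positive semidefinite. Hence it is the whole
    connected domain. *)
Lemma solution_T_pos x p : Om x -> (p <= m)%N -> 0 < minor_sum p (hessian w x).
Proof.
move=> Ox pm; have [_ _ cOm _] := hOm.
pose B := [set x | Om x /\ forall p, (p <= m)%N -> 0 < minor_sum p (hessian w x)].
suff BO : B = Om by move: Ox; rewrite -BO => -[_]; apply.
have cT q y : Om y -> {for y, continuous (fun x => minor_sum q (hessian w x))}.
  by move=> Oy; exact: extends_cont_continuous (T_extends_cont q) Oy.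
have cone y : Om y -> (forall q, (q <= m)%N -> 0 <= minor_sum q (hessian w y)) -> B y.
  move=> Oy T0; split => // q; apply: (minor_sum_pos _ hmn T0).
    by move=> i j; exact: solution_hessian_sym.
  by rewrite lt_def T0 // (solution_T_eq Oy).2.
have Bopen : open B.
  rewrite openE => y [Oy By].
  suff : \forall z \near y, forall q : 'I_m.+1, 0 < minor_sum q (hessian w z).
    move=> H; have nO : nbhs y Om by exact: open_nbhs_nbhs.
    apply: filterS2 nO H => z Oz H; split; first exact: Oz.
    by move=> q qm; exact: (H (Ordinal (qm : (q < m.+1)%N))).
  apply: (@filter_forall _ _ (fun (q : 'I_m.+1) z => 0 < minor_sum q (hessian w z))
    (nbhs y) (nbhs_filter y)) => q.
  apply: (cT q y Oy [set r : R | 0 < r]).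
  apply: open_nbhs_nbhs; split; first exact: open_gt.
  by apply: By; rewrite -ltnS.
apply: cOm.
- have [x0 Ox0 xmin] := solution_interior_min; exists x0; apply: cone => // q qm.
  apply: psd_minor_sum_ge0; first by move=> i j; exact: solution_hessian_sym.
    exact: leq_trans hmn.
  move=> v; apply: (hessian_psd_min v oOm Ox0 pw) => // s y; exact: solution_continuous.
- by exists B => //; apply/seteqP; split => [z Bz|z []//]; split => //; case: Bz.
- exists (closure B); first exact: closed_closure.
  apply/seteqP; split => [z Bz|z [Oz clz]].
    by split; [case: Bz|exact: subset_closure].
  apply: cone => // q qm; rewrite leNgt; apply/negP => Tz.
  have nT : nbhs z [set y | minor_sum q (hessian w y) < 0].
    apply: (cT q z Oz [set r : R | r < 0]).
    by apply: open_nbhs_nbhs; split; first exact: open_lt.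
  have [y [[_ By] /=]] := clz _ nT.
  by rewrite ltNge ltW // By.
Qed.

(** At an interior zero w would have a maximum, contradicting T_1 > 0, the
    trace of the Hessian. *)
Lemma solution_lt0 x : Om x -> w x < 0.
Proof.
move=> Ox; have [_ _ _ wle0] := hw.
have cOx y : Om y -> closure Om y by move=> Oy; exact: subset_closure.
rewrite lt_def eq_sym wle0 ?andbT; last exact: cOx.
apply/eqP => w0.
have m0 : (0 < m)%N by exact: leq_ltn_trans hlm.
have := solution_T_pos Ox m0; rewrite minor_sum1 ltNge => /negP; apply.
apply: sumr_le0 => i _; apply: (partial2_le0_max i oOm Ox pw) => y Oy.
by rewrite w0; apply: wle0; exact: cOx.
Qed.

Lemma solution_elliptic x (xi : 'I_n -> R) : Om x ->
  \sum_i \sum_j minor_deriv l i j (hessian w x) * xi i * xi j <=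
  \sum_i \sum_j minor_deriv m i j (hessian w x) * xi i * xi j.
Proof.
move=> Ox; apply: (minor_deriv_form_mono (S := hessian w x)).
- by move=> i j; exact: solution_hessian_sym.
- exact: ltnW.
- exact: hmn.
- by move=> p pm; exact: solution_T_pos.
- by case: (solution_T_eq Ox).
Qed.
End solution.

(** * A C^2 cutoff of the solution *)

Section truncated_power.
Variable R : realType.
Implicit Types t : R.

Definition pos_part t : R := Num.max t 0.

Lemma pos_part_ge0 t : 0 <= pos_part t.
Proof. by rewrite le_max lexx orbT. Qed.

Lemma pos_part_pos t : 0 <= t -> pos_part t = t.
Proof. by move=> t0; apply/max_idPl. Qed.

Lemma pos_part_neg t : t <= 0 -> pos_part t = 0.
Proof. by move=> t0; apply/max_idPr. Qed.

Lemma pos_part_continuous : continuous pos_part.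
Proof.
move=> t; apply/cvgrPdist_lt => e e0; near=> s.
have ts : `|t - s| < e by near: s; exact: cvgr_dist_lt.
apply: le_lt_trans ts; rewrite /pos_part.
by case: (leP t 0) => t0; case: (leP s 0) => s0; rewrite ?subrr ?normr0 ?normr_ge0 //;
  rewrite !ler_norml; have := ler_norm (t - s); have := ler_norm (s - t);
  rewrite (distrC s t) => h1 h2; apply/andP; split; lra.
Unshelve. all: by end_near. Qed.

(** At 0 the difference quotient is at most |h|^(k+1). *)
Lemma is_derive_pos_part_exp k t :
  is_derive t 1 (fun s => pos_part s ^+ k.+2) (k.+2%:R * pos_part t ^+ k.+1).
Proof.
have [t0|t0|->] := ltgtP t 0.
- rewrite pos_part_neg ?ltW // expr0n /= mulr0.
  apply: (@near_eq_is_derive _ _ _ (cst 0)).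
  near=> s; have s0 : s < 0 by near: s; apply: (open_nbhs_nbhs (A := [set s : R | s < 0])); split => //; exact: open_lt.
  by rewrite pos_part_neg ?ltW // expr0n.
- rewrite pos_part_pos ?ltW //.
  apply: (@near_eq_is_derive _ _ _ (fun s : R => s ^+ k.+2)).
    near=> s; have s0 : 0 < s by near: s; apply: (open_nbhs_nbhs (A := [set s : R | 0 < s])); split => //; exact: open_gt.
    by rewrite pos_part_pos // ltW.
  split; first exact: exprn_derivable.
  by rewrite exp_derive /GRing.scale /= mulr1.
rewrite pos_part_neg // expr0n /= mulr0.
suff H : (fun h : R => h^-1 *: (((fun s => pos_part s ^+ k.+2) \o shift 0) (h *: 1) - pos_part 0 ^+ k.+2))
    @ 0^' --> (0 : R).
  by split; [apply/cvg_ex; exists 0|exact: cvg_lim H].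
apply/cvgrPdist_lt => e e0.
pose d := Num.min e 1.
have d0 : 0 < d by rewrite lt_min e0 ltr01.
near=> h.
have h0 : h != 0 by near: h; exact: nbhs_dnbhs_neq.
have hd : `|h| < d.
  near: h; apply: nbhs_dnbhs; apply: (open_nbhs_nbhs (A := [set t : R | `|t| < d])).
  split; last by rewrite /= normr0.
  apply: (open_comp (f := fun x : R => `|x|)) (@open_lt _ d).
  by move=> y _; exact: norm_continuous.
rewrite /= [pos_part 0]pos_part_neg // expr0n /= subr0 sub0r normrN addr0 /GRing.scale /= mulr1.
have ph : `|pos_part h| <= `|h|.
  by rewrite ger0_norm ?pos_part_ge0 // /pos_part ge_max ler_norm normr_ge0.
have he : `|h| < e by rewrite (lt_le_trans hd) // ge_min lexx.
have h1 : `|h| <= 1 by rewrite ltW // (lt_le_trans hd) // ge_min lexx orbT.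
apply: le_lt_trans he.
rewrite normrM normfV normrX exprS mulrA.
apply: (@le_trans _ _ (1 * `|pos_part h| ^+ k.+1)).
  apply: ler_wpM2r; first exact: exprn_ge0.
  by rewrite mulrC ler_pdivrMr ?normr_gt0 // mul1r.
rewrite mul1r exprS; apply: (le_trans _ ph); apply: ler_piMr => //.
by apply: exprn_ile1 => //; exact: le_trans ph h1.
Unshelve. all: by end_near. Qed.

(** The combination of truncated powers with knots 0, 1/2 and 1 that is affine
    beyond 1 for k = 3: the cubic and quadratic terms cancel. *)
Definition spline k (c : R) t : R :=
  c * (pos_part t ^+ k - 2 * pos_part (t - 2^-1) ^+ k + pos_part (t - 1) ^+ k).

Lemma spline_neg k c t : t <= 0 -> spline k.+1 c t = 0.
Proof.
by move=> t0; rewrite /spline !pos_part_neg ?expr0n /=; [ring|lra|lra|].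
Qed.

Lemma pos_part_exp_continuous k : continuous (fun t => pos_part t ^+ k).
Proof.
move=> t; elim: k => [|k IH].
  by rewrite (_ : (fun t => _) = cst 1) ?expr0; [exact: cvg_cst|apply/funext => s; rewrite expr0].
rewrite (_ : (fun t => _) = fun t => pos_part t * pos_part t ^+ k); last first.
  by apply/funext => s; rewrite exprS.
by apply: cvgM; [exact: pos_part_continuous|exact: IH].
Qed.

Lemma spline_continuous k c : continuous (spline k c).
Proof.
move=> t; have cs (a : R) : {for t, continuous (fun t => pos_part (t - a) ^+ k)}.
  apply: (@continuous_comp _ _ _ (fun t : R => t - a) (fun t => pos_part t ^+ k)).
    by apply: cvgB; [exact: cvg_id|exact: cvg_cst].
  exact: pos_part_exp_continuous.
apply: cvgM; first exact: cvg_cst.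
apply: cvgD; last exact: cs.
apply: cvgB; first exact: pos_part_exp_continuous.
by apply: cvgM; [exact: cvg_cst|exact: cs].
Qed.

Lemma is_derive_spline k c t :
  is_derive t 1 (spline k.+2 c) (spline k.+1 (c * k.+2%:R) t).
Proof.
have D (a : R) : is_derive t 1 (fun s => pos_part (s - a) ^+ k.+2)
    (k.+2%:R * pos_part (t - a) ^+ k.+1).
  have aff : forall h : R, (h *: (1 : R^o) + t) - a = h *: (1 : R^o) + (t - a).
    by move=> h; rewrite addrA.
  have L := @derive_affine R R^o R^o R (fun s => s - a) (fun s => pos_part s ^+ k.+2) 1 1 t aff.
  have [d1 d2] := is_derive_pos_part_exp k (t - a).
  by split; [exact: (proj2 L.2 d1)|exact: etrans L.1 d2].
have D0 : is_derive t 1 (fun s => pos_part s ^+ k.+2) (k.+2%:R * pos_part t ^+ k.+1).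
  exact: is_derive_pos_part_exp.
apply: (is_derive_eq (is_deriveZ c (is_deriveD (is_deriveB D0 (is_deriveZ 2 (D 2^-1))) (D 1)))).
rewrite /spline /GRing.scale /=; ring.
Qed.

(** A C^2 function that vanishes for t <= 0, equals t - 1/2 for t >= 1 and is
    nondecreasing with slope at most 1. *)
Definition cutoff := spline 3 (2 / 3).
Definition cutoff' := spline 2 2.
Definition cutoff'' := spline 1 4.

Lemma is_derive_cutoff t : is_derive t 1 cutoff (cutoff' t).
Proof.
apply: (is_derive_eq (is_derive_spline 1 (2 / 3) t)).
by rewrite /cutoff' (_ : 2 / 3 * 3%:R = 2) //; field.
Qed.

Lemma is_derive_cutoff' t : is_derive t 1 cutoff' (cutoff'' t).
Proof.
apply: (is_derive_eq (is_derive_spline 0 2 t)).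
by rewrite /cutoff'' (_ : 2 * 2%:R = 4) // -natrM.
Qed.

Lemma cutoff_affine t : 1 <= t -> cutoff t = t - 2^-1.
Proof.
by move=> t1; rewrite /cutoff /spline !pos_part_pos; [field|lra|lra|lra].
Qed.

Lemma cutoff'_01 t : 0 <= cutoff' t <= 1.
Proof.
have [t0|t0] := leP t 0; first by rewrite /cutoff' spline_neg // lexx ler01.
have [t1|t1] := leP 1 t.
  by rewrite /cutoff' /spline !pos_part_pos; [apply/andP; split; nra|lra|lra|lra].
have [th|th] := leP t 2^-1.
  rewrite /cutoff' /spline (pos_part_pos (ltW t0)) (@pos_part_neg (t - 2^-1)) ?(@pos_part_neg (t - 1)); try lra.
  by apply/andP; split; nra.
rewrite /cutoff' /spline (pos_part_pos (ltW t0)) (@pos_part_pos (t - 2^-1)) ?(@pos_part_neg (t - 1)); try lra.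
by apply/andP; split; nra.
Qed.

Lemma cutoff_bound t : 0 <= cutoff t <= pos_part t.
Proof.
have [t0|t0] := leP t 0; first by rewrite /cutoff spline_neg // pos_part_neg // lexx.
have [||c] := @MVT R cutoff cutoff' 0 t t0.
- by move=> s _; exact: is_derive_cutoff.
- apply: derivable_within_continuous => s _.
  by case: (is_derive_cutoff s).
move=> _; have -> : cutoff 0 = 0 by rewrite /cutoff spline_neg.
rewrite !subr0 => ->; rewrite pos_part_pos ?(ltW t0) //.
have /andP[h1 h2] := cutoff'_01 c.
by rewrite mulr_ge0 ?(ltW t0) //= ler_piMl // ltW.
Qed.

End truncated_power.

Lemma is_derive_comp1 (R : realType) (n : nat) (g : R -> R) (f : 'rV[R]_n -> R)
    (x v : 'rV[R]_n) (a b : R) :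
  is_derive x v f a -> is_derive (f x) 1 g b ->
  is_derive x v (fun y => g (f y)) (b * a).
Proof.
move=> [f1 f2] Dg.
have L := line_derive f x v 0; rewrite scale0r add0r in L.
have Df : is_derive (0 : R) 1 (fun s : R => f (s *: v + x)) a.
  by split; [exact: (proj2 L.2 f1)|exact: etrans L.1 f2].
have E : f x = (fun s : R => f (s *: v + x)) 0 by rewrite scale0r add0r.
rewrite E in Dg.
have [h1 h2] := is_derive1_comp (f := g) Dg Df.
have L' := line_derive (fun y => g (f y)) x v 0; rewrite scale0r add0r in L'.
by split; [exact: (proj1 L'.2 h1)|exact: etrans (esym L'.1) h2].
Qed.

Section cut.
Variables (R : realType) (n : nat) (Om : set 'rV[R]_n) (w : 'rV[R]_n -> R) (d : R).
Hypotheses (oOm : open Om) (bOm : bounded_set Om) (d0 : 0 < d).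
Hypotheses (cw : {within closure Om, continuous w}).
Hypotheses (w0 : forall x, boundary Om x -> w x = 0).

Definition extend0 (F : 'rV[R]_n -> R) : 'rV[R]_n -> R :=
  fun x => if x \in Om then F x else 0.

(** Such an F vanishes near the boundary, where w > -d, so that its extension
    by 0 is as smooth as F is in Om. *)
Definition inner (F : 'rV[R]_n -> R) : Prop :=
  forall x, Om x -> - d <= w x -> F x = 0.

Lemma extend0_in F x : Om x -> extend0 F x = F x.
Proof. by move=> Ox; rewrite /extend0 mem_set. Qed.

Lemma extend0_near_in F x : Om x -> \forall y \near x, F y = extend0 F y.
Proof.
move=> Ox; have nO : nbhs x Om by exact: open_nbhs_nbhs.
by apply: filterS nO => y Oy; rewrite extend0_in.
Qed.

Lemma extend0_near_out F x : inner F -> ~ Om x -> \forall y \near x, 0 = extend0 F y.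
Proof.
move=> iF nOx; have [clx|nclx] := pselect (closure Om x).
  have wx : w x = 0 by apply: w0; split => //; move/interior_subset.
  have dw : - d < w x by rewrite wx oppr_lt0.
  have /subspace_continuousP /(_ x clx) cx := cw.
  have H : \forall y \near x, closure Om y -> - d < w y.
    apply: (cx [set r : R | - d < r]); apply: open_nbhs_nbhs.
    by split; [exact: open_gt|exact: dw].
  apply: filterS H => y Hy; rewrite /extend0; case: ifPn => // /set_mem Oy.
  by rewrite iF // ltW // Hy //; exact: subset_closure.
have nO : nbhs x (~` closure Om).
  by apply: open_nbhs_nbhs; split => //; apply: closed_openC; exact: closed_closure.
apply: filterS nO => y ncl; rewrite /extend0; case: ifPn => // /set_mem Oy.
by case: ncl; exact: subset_closure.
Qed.

Lemma extend0_continuous F : inner F -> (forall x, Om x -> {for x, continuous F}) ->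
  continuous (extend0 F).
Proof.
move=> iF cF x; have [Ox|nOx] := pselect (Om x).
  rewrite /continuous_at (extend0_in F Ox).
  have H : F y @[y --> nbhs x] --> F x := cF x Ox.
  apply: cvg_trans H; apply: (@near_eq_cvg _ _ (nbhs x) (nbhs_filter x)).
  have nO : nbhs x Om by exact: open_nbhs_nbhs.
  by apply: filterS nO => y Oy; rewrite extend0_in.
rewrite /continuous_at {2}/extend0 memNset //.
have : cst (0 : R) y @[y --> nbhs x] --> (0 : R) by exact: cvg_cst.
apply: cvg_trans; apply: (@near_eq_cvg _ _ (nbhs x) (nbhs_filter x)).
by apply: filterS (extend0_near_out iF nOx) => y <-.
Qed.

Lemma extend0_derive F F' v : inner F -> inner F' ->
  (forall x, Om x -> is_derive x v F (F' x)) ->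
  forall x, is_derive x v (extend0 F) (extend0 F' x).
Proof.
move=> iF iF' DF x; have [Ox|nOx] := pselect (Om x).
  rewrite (extend0_in F' Ox).
  exact: near_eq_is_derive (extend0_near_in F Ox) (DF x Ox).
rewrite {2}/extend0 memNset //.
exact: near_eq_is_derive (extend0_near_out iF nOx) (is_derive_cst 0 x v).
Qed.

Lemma extend0_bsupp F : bsupp (extend0 F).
Proof.
have [M [Mr HM]] := bOm; exists (M + 1) => x xM; rewrite /extend0.
case: ifPn => // /set_mem Ox; have := HM (M + 1) _ x Ox.
by rewrite ltrDl ltr01 /= => /(_ isT); rewrite leNgt xM.
Qed.

Hypothesis pw : has_partials 2 Om w.
Hypothesis cpw : forall (s : seq 'I_n) x, (size s <= 2)%N -> Om x ->
  {for x, continuous (partials s w)}.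

Let arg x := - d^-1 * w x - 1.
(** w is cut off near the boundary by composing it with a function that is 0
    above -d and t + 3d/2 below -2d. The result is of class C^2 with compact
    support, its gradient is a multiple of that of w by a factor in [0, 1],
    and below -2d it differs from w by a constant. *)
Definition w_cut : 'rV[R]_n -> R := extend0 (fun x => - d * cutoff (arg x)).
Let D1 i : 'rV[R]_n -> R := fun x => cutoff' (arg x) * partial i w x.
Let D2 i j : 'rV[R]_n -> R := fun x =>
  cutoff' (arg x) * partial j (partial i w) x +
  - d^-1 * (cutoff'' (arg x) * (partial i w x * partial j w x)).

Let argE x : arg x = - w x / d - 1.
Proof. by rewrite /arg !mulNr mulrC. Qed.

Let arg_le0 x : - d <= w x -> arg x <= 0.
Proof. by move=> wx; rewrite argE subr_le0 ler_pdivrMr // mul1r lerNl. Qed.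

Let arg_continuous x : Om x -> {for x, continuous arg}.
Proof.
move=> Ox; apply: (@cvgB _ _ _ (nbhs x)); last exact: cvg_cst.
apply: (@cvgM _ _ (nbhs x)); first exact: cvg_cst.
exact: (cpw (s := [::])).
Qed.

Let arg_derive x i : Om x -> is_derive x (delta_mx 0 i) arg (- d^-1 * partial i w x).
Proof.
move=> Ox; have Dw : is_derive x (delta_mx 0 i) w (partial i w x).
  by apply: derivableP; exact: (@pw [::] i x isT Ox).
apply: (is_derive_eq (is_deriveB (is_deriveZ (- d^-1) Dw) (is_derive_cst (1 : R) x (delta_mx 0 i)))).
by rewrite subr0.
Qed.

Let F0_inner : inner (fun x => - d * cutoff (arg x)).
Proof. by move=> x _ /arg_le0 a0; rewrite /cutoff spline_neg // mulr0. Qed.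

Let D1_inner i : inner (D1 i).
Proof. by move=> x _ /arg_le0 a0; rewrite /D1 /cutoff' spline_neg // mul0r. Qed.

Let D2_inner i j : inner (D2 i j).
Proof.
move=> x _ /arg_le0 a0.
by rewrite /D2 /cutoff' /cutoff'' !spline_neg // !mul0r mulr0 addr0.
Qed.

Let spline_arg_continuous k c x : Om x -> {for x, continuous (fun y => spline k c (arg y))}.
Proof.
move=> Ox; apply: (@continuous_comp _ _ _ arg (spline k c)); first exact: arg_continuous.
exact: spline_continuous.
Qed.

Let F0_derive x i : Om x -> is_derive x (delta_mx 0 i) (fun x => - d * cutoff (arg x)) (D1 i x).
Proof.
move=> Ox; have Dc := is_derive_comp1 (arg_derive i Ox) (is_derive_cutoff (arg x)).
apply: (is_derive_eq (is_deriveZ (- d) Dc)); rewrite /D1 /GRing.scale /=.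
have dn0 : d != 0 by rewrite gt_eqF.
by field.
Qed.

Let D1_derive x i j : Om x -> is_derive x (delta_mx 0 j) (D1 i) (D2 i j x).
Proof.
move=> Ox; have Dc := is_derive_comp1 (arg_derive j Ox) (is_derive_cutoff' (arg x)).
have Dw : is_derive x (delta_mx 0 j) (partial i w) (partial j (partial i w) x).
  by apply: derivableP; exact: (@pw [:: i] j x isT Ox).
apply: (is_derive_eq (is_deriveM Dc Dw)); rewrite /D2 /GRing.scale /=.
by congr (_ + _); ring.
Qed.

Let w_cut_derive x i : is_derive x (delta_mx 0 i) w_cut (extend0 (D1 i) x).
Proof.
apply: extend0_derive; [exact: F0_inner|exact: D1_inner|].
by move=> y Oy; exact: F0_derive.
Qed.

Lemma partial_w_cut i : partial i w_cut =
  extend0 (fun x => cutoff' (- d^-1 * w x - 1) * partial i w x).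
Proof. by apply/funext => x; have [_ E] := w_cut_derive x i; exact: E. Qed.

Let extend0_D1_derive x i j : is_derive x (delta_mx 0 j) (extend0 (D1 i)) (extend0 (D2 i j) x).
Proof.
apply: extend0_derive; [exact: D1_inner|exact: D2_inner|].
by move=> y Oy; exact: D1_derive.
Qed.

Lemma w_cut_isC : isC 2 w_cut.
Proof.
have c1 i x : Om x -> {for x, continuous (partial i w)} by exact: (cpw (s := [:: i])).
have c2 i j x : Om x -> {for x, continuous (partial j (partial i w))}.
  exact: (cpw (s := [:: j; i])).
split.
  apply: extend0_continuous; first exact: F0_inner.
  move=> x Ox; apply: (@cvgM _ _ (nbhs x)); first exact: cvg_cst.
  exact: spline_arg_continuous.
move=> i; split; first by move=> x; have [E _] := w_cut_derive x i; exact: E.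
rewrite partial_w_cut; split.
  apply: extend0_continuous; first exact: D1_inner.
  move=> x Ox; apply: (@cvgM _ _ (nbhs x)); [exact: spline_arg_continuous|exact: c1].
move=> j; split; first by move=> x; have [E _] := extend0_D1_derive x i j; exact: E.
rewrite (_ : partial j _ = extend0 (D2 i j)); last first.
  by apply/funext => x; have [_ E] := extend0_D1_derive x i j; exact: E.
split; last by [].
apply: extend0_continuous; first exact: D2_inner.
move=> x Ox; apply: (@cvgD _ _ _ (nbhs x)).
  by apply: (@cvgM _ _ (nbhs x)); [exact: spline_arg_continuous|exact: c2].
apply: (@cvgM _ _ (nbhs x)); first exact: cvg_cst.
apply: (@cvgM _ _ (nbhs x)); first exact: spline_arg_continuous.
by apply: (@cvgM _ _ (nbhs x)); exact: c1.
Qed.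

Lemma w_cut_bsupp : bsupp w_cut.
Proof. exact: extend0_bsupp. Qed.

Lemma w_cut_bound x : Om x -> w x <= 0 -> 0 <= - w_cut x <= - w x.
Proof.
move=> Ox wx; rewrite /w_cut extend0_in // mulNr opprK.
have /andP[h1 h2] := cutoff_bound (arg x).
rewrite mulr_ge0 ?(ltW d0) //=.
have [a0|a0] := leP 0 (arg x); last first.
  by rewrite /cutoff (spline_neg _ _ (ltW a0)) mulr0 oppr_ge0.
rewrite pos_part_pos // in h2; apply: (le_trans (ler_wpM2l (ltW d0) h2)).
rewrite argE mulrBr mulr1 mulrCA mulfV ?gt_eqF // mulr1.
by rewrite gerBl ltW.
Qed.

Let deep_nbhs x : Om x -> w x < - (2 * d) ->
  \forall y \near x, Om y /\ w y < - (2 * d).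
Proof.
move=> Ox wx; have nO : nbhs x Om by exact: open_nbhs_nbhs.
have H : \forall y \near x, w y < - (2 * d).
  have cx : w y @[y --> nbhs x] --> w x := cpw (s := [::]) isT Ox.
  apply: (cx [set r : R | r < - (2 * d)]); apply: open_nbhs_nbhs.
  by split; [exact: open_lt|exact: wx].
by apply: filterS2 nO H => y Oy wy; split.
Qed.

(** For arg >= 1 the cutoff is affine: -d (arg - 1/2) = w + 3d/2. *)
Let deep_near x : Om x -> w x < - (2 * d) ->
  \forall y \near x, w y + 3 / 2 * d = w_cut y.
Proof.
move=> Ox wx; apply: filterS (deep_nbhs Ox wx) => y [Oy wy]; rewrite /w_cut extend0_in //.
have dn0 : d != 0 by rewrite gt_eqF.
rewrite cutoff_affine; first by rewrite argE; field.
by rewrite argE lerBrDr ler_pdivlMr //; lra.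
Qed.

Let partial_addr i (f : 'rV[R]_n -> R) c x : derivable f x (delta_mx 0 i) ->
  partial i (fun y => f y + c) x = partial i f x.
Proof.
move=> /derivableP Df; have [_] := is_deriveD Df (is_derive_cst c x (delta_mx 0 i)).
by rewrite addr0.
Qed.

Lemma partial_w_cut_deep i x : Om x -> w x < - (2 * d) ->
  partial i w_cut x = partial i w x.
Proof.
move=> Ox wx; rewrite /partial -(near_eq_derive _ (deep_near Ox wx)).
by apply: partial_addr; exact: (@pw [::] i x isT Ox).
Qed.

Lemma hessian_w_cut_deep x : Om x -> w x < - (2 * d) ->
  hessian w_cut x = hessian w x.
Proof.
move=> Ox wx; apply/matrixP => i j; rewrite [LHS]mxE [RHS]mxE.
apply: near_eq_derive.
by apply: filterS (deep_nbhs Ox wx) => y [Oy wy]; exact: partial_w_cut_deep.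
Qed.

Lemma w_cut_out x : (Om x -> - d <= w x) -> w_cut x = 0.
Proof.
by rewrite /w_cut /extend0; case: ifPn => // /set_mem Ox /(_ Ox) /(F0_inner Ox).
Qed.

Lemma partial_w_cut_out i x : (Om x -> - d <= w x) -> partial i w_cut x = 0.
Proof.
by rewrite partial_w_cut /extend0; case: ifPn => // /set_mem Ox /(_ Ox) /(D1_inner i Ox).
Qed.
End cut.

(** * Limits of integrals of products of square-integrable functions *)

Section square_integrable.
Context d (T : measurableType d) (R : realType) (mu : {measure set T -> \bar R}).
Variables (D : set T) (mD : measurable D).
Implicit Types (f g h F : T -> R).

Definition sq_integrable f : Prop :=
  measurable_fun D f /\ (\int[mu]_(x in D) (f x ^+ 2)%:E < +oo)%E.

Lemma sq_integrable_sqr f : sq_integrable f ->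
  mu.-integrable D (EFin \o (fun x => f x ^+ 2)).
Proof.
move=> [mf fo]; apply/integrableP; split.
  by apply/measurable_EFinP; exact: measurable_funX.
under eq_integral do rewrite gee0_abs ?lee_fin ?sqr_ge0 //.
exact: fo.
Qed.

Lemma sq_integrable_bounded f C : (mu D < +oo)%E -> measurable_fun D f ->
  (forall x, D x -> `|f x| <= C) -> sq_integrable f.
Proof.
move=> Doo mf fC; split => //.
have mf2 : measurable_fun D (fun x => f x ^+ 2) by exact: measurable_funX.
have : mu.-integrable D (EFin \o (fun x => f x ^+ 2)).
  apply: measurable_bounded_integrable => //.
  exists (C ^+ 2); split; first exact: num_real.
  move=> M CM x Dx /=; rewrite normrX; apply: le_trans (ltW CM).
  by rewrite ler_pXn2r // ?nnegrE ?fC // (le_trans _ (fC x Dx)).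
move=> /integrableP[_]; congr (_ < _)%E; apply: eq_integral => x _ /=.
by rewrite ger0_norm // sqr_ge0.
Qed.

Let integrable_add f g : mu.-integrable D (EFin \o f) -> mu.-integrable D (EFin \o g) ->
  mu.-integrable D (EFin \o (fun x => f x + g x)).
Proof. exact: (integrableD mD). Qed.

Let integrable_scale c f : mu.-integrable D (EFin \o f) ->
  mu.-integrable D (EFin \o (fun x => c * f x)).
Proof. exact: (integrableZl mD). Qed.

Let abs_mul_le (a b : R) : `|a * b| <= a ^+ 2 + b ^+ 2.
Proof. by rewrite ler_norml; apply/andP; split; nra. Qed.

Lemma sq_integrable_mul F C f g : measurable_fun D F ->
  (forall x, D x -> `|F x| <= C) -> sq_integrable f -> sq_integrable g ->
  mu.-integrable D (EFin \o (fun x => F x * f x * g x)).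
Proof.
move=> mF FC sf sg.
have I := integrable_scale C (integrable_add (sq_integrable_sqr sf) (sq_integrable_sqr sg)).
apply: (le_integrable mD _ _ I).
  apply/measurable_EFinP; apply: measurable_funM; last by case: sg.
  by apply: measurable_funM => //; case: sf.
move=> x Dx; rewrite /= lee_fin -mulrA normrM.
apply: le_trans (ler_norm _); apply: ler_pM => //; exact: FC.
Qed.

Lemma sq_integrableB f g : sq_integrable f -> sq_integrable g ->
  sq_integrable (fun x => f x - g x).
Proof.
move=> sf sg; have mfg : measurable_fun D (fun x => f x - g x).
  by apply: measurable_funB; [case: sf|case: sg].
split => //.
have I := integrable_scale 2 (integrable_add (sq_integrable_sqr sf) (sq_integrable_sqr sg)).
have : mu.-integrable D (EFin \o (fun x => (f x - g x) ^+ 2)).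
  apply: (le_integrable mD _ _ I); first by apply/measurable_EFinP; exact: measurable_funX.
  move=> x Dx; rewrite /= lee_fin [X in _ <= X]ger0_norm; last by nra.
  rewrite ger0_norm ?sqr_ge0 //; have := sqr_ge0 (f x + g x).
  by rewrite !expr2; nra.
move=> /integrableP[_]; congr (_ < _)%E; apply: eq_integral => x _ /=.
by rewrite ger0_norm // sqr_ge0.
Qed.

(** Here [G H - g h = (G - g) (H - h) + g (H - h) + h (G - g)]; the small factor
    e goes to the limits g and h, the large one 1/e to the differences. *)
Let product_gap (e C F G H g h : R) : 0 < e -> `|F| <= C ->
  `|F * G * H - F * g * h| <=
  C * ((1 + e^-1) * ((G - g) ^+ 2 + (H - h) ^+ 2) + e * (g ^+ 2 + h ^+ 2)).
Proof.
move=> e0 FC; rewrite -!mulrA -mulrBr normrM; apply: ler_pM => //.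
have young (a b : R) : `|a * b| <= e * a ^+ 2 + e^-1 * b ^+ 2.
  have en0 : e != 0 by rewrite gt_eqF.
  have K s : 0 <= e^-1 * (e * a + s * b) ^+ 2.
    by rewrite mulr_ge0 ?sqr_ge0 // invr_ge0 ltW.
  have E s : e^-1 * (e * a + s * b) ^+ 2 = e * a ^+ 2 + 2 * s * (a * b) + s ^+ 2 * (e^-1 * b ^+ 2).
    by field.
  have P : 0 <= e * a ^+ 2 by rewrite mulr_ge0 ?sqr_ge0 // ltW.
  have Q : 0 <= e^-1 * b ^+ 2 by rewrite mulr_ge0 ?sqr_ge0 // invr_ge0 ltW.
  have := K 1; have := K (-1); rewrite !E => h1 h2.
  by rewrite ler_norml; apply/andP; split; nra.
have -> : G * H - g * h = (G - g) * (H - h) + (g * (H - h) + h * (G - g)) by ring.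
apply: (le_trans (ler_normD _ _)).
apply: (le_trans (lerD (abs_mul_le _ _) (le_trans (ler_normD _ _) (lerD (young _ _) (young _ _))))).
by rewrite le_eqVlt; apply/orP; left; apply/eqP; ring.
Qed.

Lemma sq_integrable_cvg F C (G H : nat -> T -> R) g h : measurable_fun D F ->
  (forall x, D x -> `|F x| <= C) ->
  (forall k, sq_integrable (G k)) -> (forall k, sq_integrable (H k)) ->
  sq_integrable g -> sq_integrable h ->
  (\int[mu]_(x in D) ((G k x - g x) ^+ 2)%:E)%E @[k --> \oo] --> 0%E ->
  (\int[mu]_(x in D) ((H k x - h x) ^+ 2)%:E)%E @[k --> \oo] --> 0%E ->
  \int[mu]_(x in D) (F x * G k x * H k x) @[k --> \oo] -->
  \int[mu]_(x in D) (F x * g x * h x).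
Proof.
move=> mF FC sG sH sg sh /fine_cvg cG /fine_cvg cH.
pose a k := \int[mu]_(x in D) (G k x - g x) ^+ 2.
pose b k := \int[mu]_(x in D) (H k x - h x) ^+ 2.
have ca : a k @[k --> \oo] --> (0 : R) by exact: cG.
have cb : b k @[k --> \oo] --> (0 : R) by exact: cH.
pose S := \int[mu]_(x in D) (g x ^+ 2 + h x ^+ 2).
have S0 : 0 <= S by apply: Rintegral_ge0 => x _; rewrite addr_ge0 ?sqr_ge0.
have C0 : 0 <= `|C| by [].
have FC' x : D x -> `|F x| <= `|C| by move=> Dx; rewrite (le_trans (FC x Dx)) // ler_norm.
have bound e k : 0 < e ->
    `|\int[mu]_(x in D) (F x * g x * h x) - \int[mu]_(x in D) (F x * G k x * H k x)| <=
    `|C| * ((1 + e^-1) * (a k + b k) + e * S).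
  move=> e0.
  have I1 := sq_integrable_mul mF FC (sG k) (sH k).
  have I2 := sq_integrable_mul mF FC sg sh.
  have Ia := sq_integrable_sqr (sq_integrableB (sG k) sg).
  have Ib := sq_integrable_sqr (sq_integrableB (sH k) sh).
  have Iab := integrable_add Ia Ib.
  have Igh := integrable_add (sq_integrable_sqr sg) (sq_integrable_sqr sh).
  have J1 := integrable_scale (1 + e^-1) Iab.
  have J2 := integrable_scale e Igh.
  have J := integrable_scale `|C| (integrable_add J1 J2).
  rewrite distrC -(RintegralB mD I1 I2).
  have I12 : mu.-integrable D (EFin \o (fun x => F x * G k x * H k x - F x * g x * h x)).
    exact: (integrableB mD I1 I2).
  apply: (le_trans (le_normr_Rintegral mD I12)).
  have -> : `|C| * ((1 + e^-1) * (a k + b k) + e * S) =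
      \int[mu]_(x in D) (`|C| * ((1 + e^-1) * ((G k x - g x) ^+ 2 + (H k x - h x) ^+ 2)
        + e * (g x ^+ 2 + h x ^+ 2))).
    rewrite (RintegralZl _ mD (integrable_add J1 J2)) (RintegralD mD J1 J2).
    by rewrite (RintegralZl _ mD Iab) (RintegralZl _ mD Igh) (RintegralD mD Ia Ib).
  apply: (le_Rintegral mD _ J).
    have /integrable_norm := I12; exact.
  by move=> x Dx; apply: product_gap => //; exact: FC'.
apply/cvgrPdist_lt => e e0.
(* The parameter of Young's inequality is fixed first, then k. *)
pose t := e / (2 * (`|C| * S + 1)).
have K0 : 0 < `|C| * S + 1 by rewrite ltr_wpDl // mulr_ge0.
have t0 : 0 < t by rewrite divr_gt0 // mulr_gt0.
have cab : `|C| * ((1 + t^-1) * (a k + b k)) @[k --> \oo] --> (0 : R).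
  have c0 : (fun k => a k + b k) @ \oo --> (0 : R) by rewrite -[X in _ --> X](addr0 0); exact: cvgD ca cb.
  have cc (r : R) : (fun _ : nat => r) @ \oo --> r by exact: cvg_cst.
  have c1 : (fun k => (1 + t^-1) * (a k + b k)) @ \oo --> (1 + t^-1) * 0 by exact: cvgM (cc _) c0.
  have c2 : (fun k => `|C| * ((1 + t^-1) * (a k + b k))) @ \oo --> `|C| * ((1 + t^-1) * 0) by exact: cvgM (cc _) c1.
  by move: c2; rewrite !mulr0.
have /cvgrPdist_lt/(_ (e / 2)) := cab; rewrite divr_gt0 // => /(_ isT) H1.
apply: filterS H1 => k; rewrite sub0r normrN => /(le_lt_trans (ler_norm _)) H1.
apply: (le_lt_trans (bound t k t0)); rewrite mulrDr [ltRHS](splitr e).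
apply: (ltr_leD H1).
rewrite mulrCA /t -mulrA ler_pM2l // invfM -mulrA ler_piMr ?invr_ge0 //.
by rewrite mulrC ler_pdivrMr // mul1r lerDl.
Qed.
End square_integrable.

(** * The energy inequality for test functions *)

Lemma intRn_extend (R : realType) (n : nat) (Om : set 'rV[R]_n) (f g : 'rV[R]_n -> R) :
  (forall x, Om x -> f x = g x) -> (forall x, ~ Om x -> f x = 0) ->
  intRn setT f = intRn Om g.
Proof.
move=> fg f0; rewrite /intRn Rintegral_mkcond [RHS]Rintegral_mkcond.
apply: eq_Rintegral => t _; rewrite preimage_setT patch_setT /patch.
by case: ifPn => [/set_mem /fg|/negP tO]; last by apply: f0 => /mem_set.
Qed.

Lemma Ck_isC (R : realType) (n k : nat) (f : 'rV[R]_n -> R) : Ck k setT f -> isC k f.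
Proof.
elim: k f => [|k IH] f [df cf]; first by split => // x; exact: (cf [::]).
split; first by move=> x; exact: (cf [::]).
move=> i; split; first by move=> x; exact: (df [::]).
apply: IH; split=> [s j x sk _|s x sk _].
- rewrite (_ : partials s _ = partials (rcons s i) f); last by rewrite /partials foldr_rcons.
  by apply: df => //; rewrite size_rcons.
- rewrite (_ : partials s _ = partials (rcons s i) f); last by rewrite /partials foldr_rcons.
  by apply: cf => //; rewrite size_rcons.
Qed.

Lemma minor_sum_tr (K : comNzRingType) (n p : nat) (S : 'M[K]_n) :
  minor_sum p S^T = minor_sum p S.
Proof.
apply: eq_bigr => A _; rewrite !det_trunc_mx -[RHS]det_tr; congr (\det _).
by apply/matrixP => a b; rewrite !mxE.
Qed.

(** T_p is invariant under transposition and its derivatives are increments.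
    *)
Lemma minor_deriv_sym (K : comNzRingType) (n p : nat) (S : 'M[K]_n) i j :
  (forall a b, S a b = S b a) -> minor_deriv p i j S = minor_deriv p j i S.
Proof.
move=> Ssym; have ST : S^T = S by apply/matrixP => a b; rewrite mxE.
have := minor_sum_delta p i j S 1; rewrite -minor_sum_tr linearD linearZ /= ST trmx_delta.
by rewrite minor_sum_delta !mul1r => /addrI.
Qed.

(** Applied to the support of a test function and to w, this says how deep
    inside a cutoff of w has to begin. *)
Lemma compact_neg_gap (R : realType) (n : nat) (K : set 'rV[R]_n) (w : 'rV[R]_n -> R) :
  compact K -> {within K, continuous w} -> (forall x, K x -> w x < 0) ->
  exists2 d, 0 < d & forall x, K x -> w x < - (2 * d).
Proof.
move=> cK cw wlt; have [K0|/set0P/negP/negPn/eqP K0] := pselect (K !=set0).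
  have [c /set_mem Kc cmax] := compact_EVT_max K0 cK cw.
  have wc := wlt c Kc; exists (- w c / 4); first lra.
  by move=> x Kx; have := cmax x (mem_set Kx); lra.
by exists 1 => // x; rewrite K0.
Qed.

Section energy.
Variables (R : realType) (n m l : nat) (Om : set 'rV[R]_n) (w : 'rV[R]_n -> R).
Hypotheses (hlm : (l < m)%N) (hmn : (m <= n)%N).
Hypotheses (hOm : bounded_domain Om) (hw : dirichlet_solution m l Om w).

Let oOm : open Om. Proof. by case: hOm. Qed.
Let bOm : bounded_set Om. Proof. by case: hOm. Qed.
Let pw : has_partials 2 Om w. Proof. by case: hw => -[]. Qed.
Let cw : {within closure Om, continuous w}. Proof. by case: hw => -[]. Qed.
Let w0 x : boundary Om x -> w x = 0. Proof. by case: hw => _ _ /(_ x). Qed.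
Let cpw (s : seq 'I_n) x : (size s <= 2)%N -> Om x -> {for x, continuous (partials s w)}.
Proof. exact: (solution_continuous hOm hw). Qed.
Let wlt0 x : Om x -> w x < 0. Proof. exact: (solution_lt0 hlm hmn hOm hw). Qed.

Let H x := hessian w x.
Let v d := w_cut Om w d.

Let v_isC d : 0 < d -> isC 2 (v d).
Proof. by move=> d0; exact: (w_cut_isC oOm d0 cw w0 pw cpw). Qed.

Let v_bsupp d : bsupp (v d).
Proof. exact: (w_cut_bsupp w d bOm). Qed.

(** On the support of phi the cutoff of w has the same gradient and Hessian as
    w. *)
Lemma weak_identity_inside p d (phi : 'rV[R]_n -> R) : 0 < d -> isC 1 phi -> bsupp phi ->
  (forall x, (Om x -> - (2 * d) <= w x) -> phi x = 0 /\ forall j, partial j phi x = 0) ->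
  intRn Om (fun x => \sum_i \sum_j minor_deriv p i j (H x) * partial i w x * partial j phi x)
  = - (p%:R * intRn Om (fun x => phi x * minor_sum p (H x))).
Proof.
move=> d0 Cphi sphi phi0.
have WI := weak_identity p (v_isC d0) (@v_bsupp d) Cphi sphi.
have HE x : Om x -> w x < - (2 * d) -> hessian (v d) x = H x.
  by move=> Ox wx; exact: (hessian_w_cut_deep oOm d0 pw cpw Ox wx).
have DE i x : Om x -> w x < - (2 * d) -> partial i (v d) x = partial i w x.
  by move=> Ox wx; exact: (partial_w_cut_deep oOm d0 pw cpw i Ox wx).
have out x : ~ Om x -> phi x = 0 /\ forall j, partial j phi x = 0.
  by move=> nOx; apply: phi0 => Ox; case: nOx.
have E1 : intRn setT (fun x => phi x * minor_sum p (hessian (v d) x)) =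
    intRn Om (fun x => phi x * minor_sum p (H x)).
  apply: intRn_extend => x Ox; last by have [-> _] := out x Ox; rewrite mul0r.
  have [wx|wx] := ltP (w x) (- (2 * d)); first by rewrite (HE x Ox wx).
  have [P0 _] := phi0 x (fun=> wx); rewrite P0.
  exact: (etrans (mul0r _) (esym (mul0r _))).
have E2 : intRn setT (fun x => \sum_i \sum_j minor_deriv p i j (hessian (v d) x) *
      partial i (v d) x * partial j phi x) =
    intRn Om (fun x => \sum_i \sum_j minor_deriv p i j (H x) * partial i w x * partial j phi x).
  apply: intRn_extend => x Ox; last first.
    have [_ D0] := out x Ox.
    by apply: big1 => i _; apply: big1 => j _; rewrite D0 mulr0.
  apply: eq_bigr => i _; apply: eq_bigr => j _.
  have [wx|wx] := ltP (w x) (- (2 * d)); first by rewrite (HE x Ox wx) (DE i x Ox wx).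
  have [_ D0] := phi0 x (fun=> wx); rewrite D0.
  exact: (etrans (mulr0 _) (esym (mulr0 _))).
by move: WI; rewrite E1 E2.
Qed.
End energy.

Lemma quadratic_form_sub (K : comNzRingType) (n : nat) (F : 'I_n -> 'I_n -> K)
    (a b : 'I_n -> K) (c : K) : (forall i j, F i j = F j i) ->
  \sum_i \sum_j F i j * (a i - c * b i) * (a j - c * b j) =
  \sum_i \sum_j F i j * a i * a j - 2 * c * (\sum_i \sum_j F i j * b i * a j)
  + c ^+ 2 * (\sum_i \sum_j F i j * b i * b j).
Proof.
move=> Fsym.
have E : \sum_i \sum_j F i j * b i * a j = \sum_i \sum_j F i j * a i * b j.
  rewrite exchange_big; apply: eq_bigr => i _; apply: eq_bigr => j _.
  by rewrite Fsym -!mulrA [b j * _]mulrC.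
have -> : 2 * c * (\sum_i \sum_j F i j * b i * a j) =
    c * (\sum_i \sum_j F i j * b i * a j) + c * (\sum_i \sum_j F i j * a i * b j).
  by rewrite -E; ring.
rewrite opprD !mulr_sumr -!sumrN -!big_split /=; apply: eq_bigr => i _.
rewrite !mulr_sumr -!sumrN -!big_split /=; apply: eq_bigr => j _.
by ring.
Qed.

Section integral_on_domain.
Variables (R : realType) (n : nat) (Om : set 'rV[R]_n).
Hypotheses (oOm : open Om) (bOm : bounded_set Om).
Implicit Types f g : 'rV[R]_n -> R.

Let D := @row_of_tuple R n @^-1` Om.

Lemma measurable_domain : measurable D.
Proof. exact: measurable_open_row. Qed.

Lemma extends_cont_integrable f : extends_cont Om f ->
  (leb R n).-integrable D (EFin \o (f \o @row_of_tuple R n)).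
Proof.
move=> Kf; apply: measurable_bounded_integrable.
- exact: measurable_domain.
- exact: leb_bounded_lty.
- exact: extends_cont_measurable.
- have [C HC] := extends_cont_bounded bOm Kf.
  exists C; split; first exact: num_real.
  by move=> M CM t Dt; apply: le_trans (ltW CM); exact: HC.
Qed.

Lemma domain_intD f g : extends_cont Om f -> extends_cont Om g ->
  intRn Om (fun x => f x + g x) = intRn Om f + intRn Om g.
Proof.
move=> Kf Kg.
exact: (RintegralD measurable_domain (extends_cont_integrable Kf) (extends_cont_integrable Kg)).
Qed.

Lemma domain_intZ c f : extends_cont Om f ->
  intRn Om (fun x => c * f x) = c * intRn Om f.
Proof.
move=> Kf; exact: (RintegralZl c measurable_domain (extends_cont_integrable Kf)).
Qed.

Lemma domain_int_le f g : extends_cont Om f -> extends_cont Om g ->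
  (forall x, Om x -> f x <= g x) -> intRn Om f <= intRn Om g.
Proof.
move=> Kf Kg fg; apply: (le_Rintegral measurable_domain (extends_cont_integrable Kf) (extends_cont_integrable Kg)).
by move=> t Dt; exact: fg.
Qed.

Lemma domain_int_eq f g : (forall x, Om x -> f x = g x) -> intRn Om f = intRn Om g.
Proof. by move=> fg; apply: eq_Rintegral => t /set_mem Dt; exact: fg. Qed.

Lemma continuous_extends_cont f : continuous f -> extends_cont Om f.
Proof. by move=> cf; exists f; split=> //; exact: continuous_subspaceT. Qed.

Lemma extends_cont_form (F : 'I_n -> 'I_n -> 'rV[R]_n -> R) (a b : 'I_n -> 'rV[R]_n -> R) :
  (forall i j, extends_cont Om (F i j)) -> (forall i, extends_cont Om (a i)) ->
  (forall i, extends_cont Om (b i)) ->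
  extends_cont Om (fun x => \sum_i \sum_j F i j x * a i x * b j x).
Proof.
move=> KF Ka Kb.
have sumK := @ring_class_sum _ _ _ (@extends_cont_cst R n Om) (@extends_cont_D R n Om).
apply: (sumK) => i _; apply: (sumK) => j _.
apply: extends_cont_M; last exact: Kb.
apply: extends_cont_M; [exact: KF|exact: Ka].
Qed.
End integral_on_domain.

(** The complement of K is open. *)
Lemma partial_out_compact (R : realType) (n : nat) (K : set 'rV[R]_n)
    (phi : 'rV[R]_n -> R) j x : compact K ->
  (forall y, ~ K y -> phi y = 0) -> ~ K x -> partial j phi x = 0.
Proof.
move=> cK phi0 nKx; have oK : open (~` K).
  by apply: closed_openC; apply: compact_closed => //; exact: norm_hausdorff.
have E : \forall y \near x, cst 0 y = phi y.
  apply: (@filterS _ (nbhs x) _ (~` K)); first by move=> y nK; rewrite phi0.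
  exact: (open_nbhs_nbhs (conj oK nKx)).
by rewrite /partial -(near_eq_derive _ E) derive_cst.
Qed.

Lemma le_of_double (R : realFieldType) (P X Z : R) :
  Z <= X -> 0 <= P - 2 * X + Z -> X <= P.
Proof. by move=> *; lra. Qed.

Section energy_inequality.
Variables (R : realType) (n m l : nat) (Om : set 'rV[R]_n) (w : 'rV[R]_n -> R).
Hypotheses (hlm : (l < m)%N) (hmn : (m <= n)%N).
Hypotheses (hOm : bounded_domain Om) (hw : dirichlet_solution m l Om w).

Let oOm : open Om. Proof. by case: hOm. Qed.
Let bOm : bounded_set Om. Proof. by case: hOm. Qed.
Let pw : has_partials 2 Om w. Proof. by case: hw => -[]. Qed.
Let cw : {within closure Om, continuous w}. Proof. by case: hw => -[]. Qed.
Let w0 x : boundary Om x -> w x = 0. Proof. by case: hw => _ _ /(_ x). Qed.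
Let cpw (s : seq 'I_n) x : (size s <= 2)%N -> Om x -> {for x, continuous (partials s w)}.
Proof. exact: (solution_continuous hOm hw). Qed.
Let wlt0 x : Om x -> w x < 0. Proof. exact: (solution_lt0 hlm hmn hOm hw). Qed.

Let H x := hessian w x.
Let f x := minor_sum m (H x).
Let F i j x := minor_deriv m i j (H x) - minor_deriv l i j (H x).

Let Kf : extends_cont Om f. Proof. exact: (T_extends_cont hw). Qed.

Let Kdw i : extends_cont Om (partial i w).
Proof. exact: (solution_extends_cont hw (s := [:: i])). Qed.

Let Kw : extends_cont Om w.
Proof. exact: (solution_extends_cont hw (s := [::])). Qed.

Lemma energy_coef_extends_cont i j : extends_cont Om (F i j).
Proof.
apply: extends_cont_D; first exact: (Tij_extends_cont hw).
have -> : (fun x => - minor_deriv l i j (H x)) = fun x => (-1) * minor_deriv l i j (H x).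
  by apply/funext => x; rewrite mulN1r.
apply: extends_cont_M; [exact: extends_cont_cst|exact: (Tij_extends_cont hw)].
Qed.

(** The identities for m and l are subtracted; the right-hand sides agree up
    to the factors m and l since T_m[w] = T_l[w]. *)
Lemma weak_identity_difference d (phi : 'rV[R]_n -> R) : 0 < d -> isC 1 phi -> bsupp phi ->
  (forall x, (Om x -> - (2 * d) <= w x) -> phi x = 0 /\ forall j, partial j phi x = 0) ->
  intRn Om (fun x => \sum_i \sum_j F i j x * partial i w x * partial j phi x)
  = - ((m%:R - l%:R) * intRn Om (fun x => phi x * f x)).
Proof.
move=> d0 Cphi sphi phi0.
have Wm := weak_identity_inside hOm hw m d0 Cphi sphi phi0.
have Wl := weak_identity_inside hOm hw l d0 Cphi sphi phi0.
have Kphi j : extends_cont Om (partial j phi).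
  have [_ /(_ j) [_ [c _]]] := Cphi; exact: continuous_extends_cont c.
have KT p : extends_cont Om (fun x => \sum_i \sum_j
    minor_deriv p i j (H x) * partial i w x * partial j phi x).
  apply: extends_cont_form; [|exact: Kdw|exact: Kphi].
  by move=> i j; exact: (Tij_extends_cont hw).
have KT' : extends_cont Om (fun x => (-1) * \sum_i \sum_j
    minor_deriv l i j (H x) * partial i w x * partial j phi x).
  by apply: extends_cont_M; [exact: extends_cont_cst|exact: KT].
have -> : (fun x => \sum_i \sum_j F i j x * partial i w x * partial j phi x) =
   (fun x => \sum_i \sum_j minor_deriv m i j (H x) * partial i w x * partial j phi x +
     (-1) * \sum_i \sum_j minor_deriv l i j (H x) * partial i w x * partial j phi x).
  apply/funext => x; rewrite mulr_sumr -big_split; apply: eq_bigr => i _.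
  rewrite mulr_sumr -big_split; apply: eq_bigr => j _ /=.
  by rewrite /F; ring.
have Ef : intRn Om (fun x => phi x * minor_sum l (H x)) = intRn Om (fun x => phi x * f x).
  apply: domain_int_eq => x Ox; congr (_ * _).
  by have [e _] := solution_T_eq hw Ox; exact: esym e.
rewrite (domain_intD oOm bOm (KT m) KT') (domain_intZ oOm bOm _ (KT l)).
have Wm' : intRn Om (fun x => \sum_i \sum_j
   minor_deriv m i j (H x) * partial i w x * partial j phi x) =
   - (m%:R * intRn Om (fun x => phi x * f x)) by exact: Wm.
have Wl' : intRn Om (fun x => \sum_i \sum_j
   minor_deriv l i j (H x) * partial i w x * partial j phi x) =
   - (l%:R * intRn Om (fun x => phi x * f x)) by rewrite -Ef; exact: Wl.
by rewrite Wm' Wl'; ring.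
Qed.

(** The Cauchy-Schwarz inequality for the form F, with v, a cutoff of w whose
    gradient is that of w on the support K of phi. With F(a, b) the sum of the
    F^ij a_i b_j, for every c the function F(phi, phi) - 2 c F(w, phi) + c^2
    F(w, v) is nonnegative: on K it is the value of F at grad phi - c grad w,
    and off K the gradient of phi vanishes and F(w, v) is a nonnegative
    multiple of F(w, w). Its integral is evaluated by the weak identity, and c
    = - (integral of phi f) / I, with f = T_m[w], gives the claim. If I = 0
    then c = 0 by the convention 1/0 = 0, and the claim says that the integral
    of F(phi, phi) is nonnegative. *)
Lemma energy_inequality_test (K : set 'rV[R]_n) (phi : 'rV[R]_n -> R) :
  compact K -> K `<=` Om -> (forall x, ~ K x -> phi x = 0) -> isC 1 phi ->
  (m%:R - l%:R) / intRn Om (fun x => - w x * f x) *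
    intRn Om (fun x => phi x * f x) ^+ 2 <=
  intRn Om (fun x => \sum_i \sum_j F i j x * partial i phi x * partial j phi x).
Proof.
move=> cK KOm phi0 Cphi.
have [d d0 dK] : exists2 d, 0 < d & forall x, K x -> w x < - (2 * d).
  apply: compact_neg_gap cK _ _; last by move=> x Kx; exact: wlt0 (KOm x Kx).
  apply: continuous_subspaceW cw => x Kx; exact: subset_closure (KOm x Kx).
have Dphi0 j x : ~ K x -> partial j phi x = 0 by exact: partial_out_compact.
have sphi : bsupp phi.
  have [M [Mr HM]] := bOm; exists (M + 1) => x xM; apply: phi0 => Kx.
  have := HM (M + 1) _ x (KOm x Kx).
  by rewrite ltrDl ltr01 /= => /(_ isT); rewrite leNgt xM.
pose v := w_cut Om w d.
have vC : isC 2 v by exact: (w_cut_isC oOm d0 cw w0 pw cpw).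
have v1 : isC 1 v by exact: isC_leq vC.
have sv : bsupp v by exact: (w_cut_bsupp w d bOm).
pose I := intRn Om (fun x => - w x * f x).
pose a := intRn Om (fun x => phi x * f x).
have Iphi : intRn Om (fun x => \sum_i \sum_j F i j x * partial i w x * partial j phi x)
    = - ((m%:R - l%:R) * a).
  apply: (weak_identity_difference d0 Cphi sphi) => x wx.
  have nKx : ~ K x by move=> Kx; have := dK x Kx; rewrite ltNge wx //; exact: KOm.
  by split=> [|j]; [exact: phi0|exact: Dphi0].
have d4 : 0 < d / 4 by rewrite divr_gt0.
have Iv : intRn Om (fun x => \sum_i \sum_j F i j x * partial i w x * partial j v x)
    = - ((m%:R - l%:R) * intRn Om (fun x => v x * f x)).
  apply: (weak_identity_difference d4 v1 sv) => x wx.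
  have wx' : Om x -> - d <= w x by move=> /wx; lra.
  split=> [|j]; first exact: (w_cut_out d0 wx').
  exact: (partial_w_cut_out oOm d0 cw w0 pw j wx').
have mlE : 0 <= m%:R - l%:R :> R by rewrite subr_ge0 ler_nat ltnW.
have f0 x : Om x -> 0 <= f x.
  by move=> Ox; exact: ltW (solution_T_pos hmn hOm hw Ox (leqnn m)).
have vI : - intRn Om (fun x => v x * f x) <= I.
  have Kv : extends_cont Om v by exact: continuous_extends_cont (isC_continuous vC).
  have Kvf : extends_cont Om (fun x => v x * f x) by exact: extends_cont_M.
  have Kwf : extends_cont Om (fun x => - w x * f x).
    apply: extends_cont_M => //; rewrite (_ : (fun x => - w x) = fun x => (-1) * w x).
      by apply: extends_cont_M; [exact: extends_cont_cst|exact: Kw].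
    by apply/funext => x; rewrite mulN1r.
  rewrite -mulN1r -(domain_intZ oOm bOm _ Kvf); apply: domain_int_le => //.
    by apply: extends_cont_M; [exact: extends_cont_cst|exact: Kvf].
  move=> x Ox; rewrite mulN1r -mulNr; apply: ler_wpM2r; first exact: f0.
  by have /andP[_] := w_cut_bound d0 Ox (ltW (wlt0 Ox)).
have Kphi j : extends_cont Om (partial j phi).
  have [_ /(_ j) [_ [c _]]] := Cphi; exact: continuous_extends_cont c.
have Kv j : extends_cont Om (partial j v).
  have [_ /(_ j) [_ [c _]]] := v1; exact: continuous_extends_cont c.
pose A x := \sum_i \sum_j F i j x * partial i phi x * partial j phi x.
pose B x := \sum_i \sum_j F i j x * partial i w x * partial j phi x.
pose C x := \sum_i \sum_j F i j x * partial i w x * partial j v x.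
have KA : extends_cont Om A by exact: (extends_cont_form energy_coef_extends_cont Kphi Kphi).
have KB : extends_cont Om B by exact: (extends_cont_form energy_coef_extends_cont Kdw Kphi).
have KC : extends_cont Om C by exact: (extends_cont_form energy_coef_extends_cont Kdw Kv).
have ell x xi : Om x -> 0 <= \sum_i \sum_j F i j x * xi i * xi j.
  move=> Ox; have := solution_elliptic hlm hmn hOm hw xi Ox; rewrite -subr_ge0.
  congr (0 <= _); rewrite -sumrB; apply: eq_bigr => i _; rewrite -sumrB.
  by apply: eq_bigr => j _; rewrite !mulrBl.
have pointwise c x : Om x -> 0 <= A x + (- (2 * c)) * B x + c ^+ 2 * C x.
  move=> Ox; have [Kx|nKx] := pselect (K x); last first.
    (* phi vanishes near x, and the gradient of v is a multiple of that of w. *)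
    have -> : A x = 0.
      by apply: big1 => i _; apply: big1 => j _; rewrite (Dphi0 j x nKx) mulr0.
    have -> : B x = 0.
      by apply: big1 => i _; apply: big1 => j _; rewrite (Dphi0 j x nKx) mulr0.
    rewrite mulr0 !add0r mulr_ge0 ?sqr_ge0 //.
    have -> : C x = cutoff' (- d^-1 * w x - 1) *
        \sum_i \sum_j F i j x * partial i w x * partial j w x.
      rewrite mulr_sumr; apply: eq_bigr => i _; rewrite mulr_sumr; apply: eq_bigr => j _.
      rewrite (partial_w_cut oOm d0 cw w0 pw j) extend0_in //.
      by rewrite mulrCA.
    by have /andP[t0 _] := cutoff'_01 (- d^-1 * w x - 1); rewrite mulr_ge0 // ell.
  (* Here the gradients of v and w agree. *)
  have Fsym i j : F i j x = F j i x.
    have Hs a' b' : H x a' b' = H x b' a' by exact: (solution_hessian_sym hOm hw a' b' Ox).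
    by rewrite /F (minor_deriv_sym m i j Hs) (minor_deriv_sym l i j Hs).
  have -> : C x = \sum_i \sum_j F i j x * partial i w x * partial j w x.
    apply: eq_bigr => i _; apply: eq_bigr => j _.
    by rewrite (partial_w_cut_deep oOm d0 pw cpw j Ox (dK x Kx)).
  have := ell x (fun i => partial i phi x - c * partial i w x) Ox.
  by rewrite (quadratic_form_sub (fun i => partial i phi x) (fun i => partial i w x) c Fsym) mulNr.
have quadratic c : 0 <= intRn Om A - 2 * c * intRn Om B + c ^+ 2 * intRn Om C.
  have K1 : extends_cont Om (fun x => (- (2 * c)) * B x).
    by apply: extends_cont_M; [exact: extends_cont_cst|exact: KB].
  have K2 : extends_cont Om (fun x => c ^+ 2 * C x).
    by apply: extends_cont_M; [exact: extends_cont_cst|exact: KC].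
  have K3 : extends_cont Om (fun x => A x + (- (2 * c)) * B x) by exact: extends_cont_D.
  rewrite -mulNr -(domain_intZ oOm bOm _ KB) -(domain_intZ oOm bOm _ KC).
  rewrite -(domain_intD oOm bOm KA K1) -(domain_intD oOm bOm K3 K2).
  by apply: Rintegral_ge0 => t Dt; exact: pointwise.
have {quadratic} := quadratic (- (a / I)).
have -> : intRn Om B = - ((m%:R - l%:R) * a) by exact: Iphi.
have -> : intRn Om C = - ((m%:R - l%:R) * intRn Om (fun x => v x * f x)) by exact: Iv.
have E : (a / I) ^+ 2 * I = a ^+ 2 / I.
  have [->|I0] := eqVneq I 0; first by rewrite invr0 !mulr0.
  by field.
have : (- (a / I)) ^+ 2 * - ((m%:R - l%:R) * intRn Om (fun x => v x * f x)) <=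
    (m%:R - l%:R) * (a ^+ 2 / I).
  rewrite sqrrN -E -mulrN mulrCA; apply: ler_wpM2l => //.
  by apply: ler_wpM2l vI; exact: sqr_ge0.
have -> : (m%:R - l%:R) / I * a ^+ 2 = (m%:R - l%:R) * (a ^+ 2 / I).
  by rewrite -mulrA [I^-1 * _]mulrC.
have -> : 2 * - (a / I) * - ((m%:R - l%:R) * a) = 2 * ((m%:R - l%:R) * (a ^+ 2 / I)).
  by move: (m%:R - l%:R) {Iphi E} (a) I^-1 => q b J; ring.
change (intRn Om A) with (intRn Om (fun x => \sum_i \sum_j F i j x * partial i phi x * partial j phi x)).
exact: le_of_double.
Qed.
End energy_inequality.

(** * Passage to the limit *)

Lemma Rintegral_sum d (T : measurableType d) (R : realType)
    (mu : {measure set T -> \bar R}) (D : set T) (I : Type) (r : seq I) (F : I -> T -> R) :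
  measurable D -> (forall i, mu.-integrable D (EFin \o F i)) ->
  mu.-integrable D (EFin \o (fun x => \sum_(i <- r) F i x)) /\
  \int[mu]_(x in D) (\sum_(i <- r) F i x) = \sum_(i <- r) \int[mu]_(x in D) F i x.
Proof.
move=> mD IF; elim: r => [|i r [Ir IH]].
  have -> : (fun x => \sum_(i <- [::]) F i x) = cst 0 by apply/funext => x; rewrite big_nil.
  by rewrite big_nil; split; [exact: integrable0|rewrite /Rintegral integral0].
rewrite big_cons -IH -(RintegralD mD (IF i) Ir); split.
  rewrite (_ : EFin \o _ = fun x => ((F i x)%:E + (\sum_(j <- r) F j x)%R%:E)%E).
    exact: (integrableD mD (IF i) Ir).
  by apply/funext => x /=; rewrite big_cons.
by apply: eq_Rintegral => x _; rewrite big_cons.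
Qed.

Section limit.
Variables (R : realType) (n : nat) (Om : set 'rV[R]_n).
Hypotheses (oOm : open Om) (bOm : bounded_set Om).

Let D := @row_of_tuple R n @^-1` Om.

Lemma L2_extends_cont f : extends_cont Om f -> L2 Om f.
Proof.
move=> Kf; have [C HC] := extends_cont_bounded bOm Kf.
apply: (@sq_integrable_bounded _ _ _ (leb R n) D (measurable_domain oOm)
  (f \o @row_of_tuple R n) C); first exact: leb_bounded_lty.
- exact: extends_cont_measurable.
- by move=> t Dt; exact: HC.
Qed.

Lemma L2_product_cvg c (G H : nat -> 'rV[R]_n -> R) g h : extends_cont Om c ->
  (forall k, L2 Om (G k)) -> (forall k, L2 Om (H k)) -> L2 Om g -> L2 Om h ->
  eintRn Om (fun x => (G k x - g x) ^+ 2) @[k --> \oo] --> 0%E ->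
  eintRn Om (fun x => (H k x - h x) ^+ 2) @[k --> \oo] --> 0%E ->
  intRn Om (fun x => c x * G k x * H k x) @[k --> \oo] -->
  intRn Om (fun x => c x * g x * h x).
Proof.
move=> Kc LG LH Lg Lh cG cH; have [C HC] := extends_cont_bounded bOm Kc.
apply: (@sq_integrable_cvg _ _ _ (leb R n) D (measurable_domain oOm)
  (c \o @row_of_tuple R n) C (fun k => G k \o @row_of_tuple R n)
  (fun k => H k \o @row_of_tuple R n) (g \o @row_of_tuple R n)
  (h \o @row_of_tuple R n)) => //.
- exact: extends_cont_measurable.
- by move=> t Dt; exact: HC.
Qed.

Lemma L2_product_integrable c g h : extends_cont Om c -> L2 Om g -> L2 Om h ->
  (leb R n).-integrable D
    (EFin \o (fun t => c (row_of_tuple t) * g (row_of_tuple t) * h (row_of_tuple t))).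
Proof.
move=> Kc Lg Lh; have [C HC] := extends_cont_bounded bOm Kc.
apply: (@sq_integrable_mul _ _ _ (leb R n) D (measurable_domain oOm)
  (c \o @row_of_tuple R n) C (g \o @row_of_tuple R n) (h \o @row_of_tuple R n)) => //.
- exact: extends_cont_measurable.
- by move=> t Dt; exact: HC.
Qed.

Lemma domain_int_form (F : 'I_n -> 'I_n -> 'rV[R]_n -> R) (a : 'I_n -> 'rV[R]_n -> R) :
  (forall i j, extends_cont Om (F i j)) -> (forall i, L2 Om (a i)) ->
  intRn Om (fun x => \sum_i \sum_j F i j x * a i x * a j x) =
  \sum_i \sum_j intRn Om (fun x => F i j x * a i x * a j x).
Proof.
move=> KF La.
have I i j := L2_product_integrable (KF i j) (La i) (La j).
have S i := Rintegral_sum (index_enum 'I_n) (measurable_domain oOm) (I i).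
have [_ E] := Rintegral_sum (index_enum 'I_n) (measurable_domain oOm) (fun i => proj1 (S i)).
apply: (etrans E); apply: eq_bigr => i _; exact: (proj2 (S i)).
Qed.
End limit.

Theorem theorem5p2 (R : realType) (n m l : nat) (alpha : R)
    (Om : set 'rV[R]_n) (w : 'rV[R]_n -> R)
    (hlm : (l < m)%N) (hmn : (m <= n)%N)
    (halpha : 0 < alpha < 1)
    (hOm : bounded_domain Om)
    (hreg : Ckalpha_boundary 4 alpha Om)
    (hcurv : forall x, boundary Om x -> 0 < p_curvature m.-1 Om x)
    (hw : dirichlet_solution m l Om w)
    (u : 'rV[R]_n -> R) (Du : 'I_n -> 'rV[R]_n -> R)
    (hu : W12_0 Om u Du) :
  (m%:R - l%:R) / I_ m Om w * intRn Om (fun x => u x * T_ m w x) ^+ 2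
    + intRn Om
        (fun x => \sum_i \sum_j Tij_ l i j w x * Du i x * Du j x)
  <= intRn Om
        (fun x => \sum_i \sum_j Tij_ m i j w x * Du i x * Du j x).
Proof.
have [_ oOm _ bOm] := hOm.
have [[Lu LDu _] [phi [tphi cphi cDphi]]] := hu.
pose H x := hessian w x; pose f x := minor_sum m (H x).
pose F i j x := minor_deriv m i j (H x) - minor_deriv l i j (H x).
have Kf : extends_cont Om f by exact: (T_extends_cont hw).
have KT p i j : extends_cont Om (fun x => minor_deriv p i j (H x)).
  exact: (Tij_extends_cont hw).
have KF i j : extends_cont Om (F i j) by exact: (energy_coef_extends_cont hw).
have TE p : (fun x => \sum_i \sum_j Tij_ p i j w x * Du i x * Du j x) =
    (fun x => \sum_i \sum_j minor_deriv p i j (H x) * Du i x * Du j x).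
  apply/funext => x; apply: eq_bigr => i _; apply: eq_bigr => j _.
  by rewrite /Tij_ ptrace_derivE.
have fE : (fun x => u x * T_ m w x) = (fun x => u x * f x).
  by apply/funext => x; rewrite /T_ ptraceE.
have IE : I_ m Om w = intRn Om (fun x => - w x * f x).
  by rewrite /I_; congr (intRn Om _); apply/funext => x; rewrite /T_ ptraceE.
rewrite (TE m) (TE l) fE IE {TE fE IE}.
set c := (m%:R - l%:R) / _.
have FE : intRn Om (fun x => \sum_i \sum_j F i j x * Du i x * Du j x) =
    intRn Om (fun x => \sum_i \sum_j minor_deriv m i j (H x) * Du i x * Du j x) -
    intRn Om (fun x => \sum_i \sum_j minor_deriv l i j (H x) * Du i x * Du j x).
  rewrite (domain_int_form oOm bOm KF LDu) (domain_int_form oOm bOm (KT m) LDu).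
  rewrite (domain_int_form oOm bOm (KT l) LDu) -sumrB; apply: eq_bigr => i _.
  rewrite -sumrB; apply: eq_bigr => j _.
  have Im := L2_product_integrable oOm bOm (KT m i j) (LDu i) (LDu j).
  have Il := L2_product_integrable oOm bOm (KT l i j) (LDu i) (LDu j).
  apply: (etrans _ (RintegralB (measurable_domain oOm) Im Il)).
  by apply: eq_Rintegral => t _; rewrite /F !mulrBl.
rewrite -lerBrDr -FE.
have Cphi k : isC 1 (phi k) by have [Ck _] := tphi k; exact: Ck_isC (Ck 1%N).
have Kphi k : extends_cont Om (phi k) by exact: continuous_extends_cont (isC_continuous (Cphi k)).
have KDphi k i : extends_cont Om (partial i (phi k)).
  have [_ /(_ i) [_ [cp _]]] := Cphi k; exact: continuous_extends_cont cp.
have L1 : L2 Om (cst 1) by apply: L2_extends_cont => //; exact: extends_cont_cst.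
have Lphi k : L2 Om (phi k) by exact: L2_extends_cont.
have LDphi i k : L2 Om (partial i (phi k)) by exact: L2_extends_cont.
have cf : intRn Om (fun x => phi k x * f x) @[k --> \oo] --> intRn Om (fun x => u x * f x).
  have c1 : eintRn Om (fun x => (cst 1 x - cst 1 x : R) ^+ 2) @[k --> \oo] --> 0%E.
    rewrite (_ : eintRn _ _ = 0%E); first exact: cvg_cst.
    by rewrite /eintRn; apply: integral0_eq => t _; rewrite subrr expr0n.
  have := L2_product_cvg oOm bOm Kf Lphi (fun=> L1) Lu L1 cphi c1.
  have E g : intRn Om (fun x => f x * g x * cst 1 x) = intRn Om (fun x => g x * f x).
    by apply: domain_int_eq => x _; rewrite mulr1 mulrC.
  by rewrite E; under eq_fun do rewrite E.
have cF : intRn Om (fun x => \sum_i \sum_j F i j x * partial i (phi k) x * partial j (phi k) x)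
    @[k --> \oo] --> intRn Om (fun x => \sum_i \sum_j F i j x * Du i x * Du j x).
  rewrite (domain_int_form oOm bOm KF LDu).
  under eq_fun do rewrite (domain_int_form oOm bOm KF (fun i => LDphi i _)).
  apply: cvg_big => [|i _]; first exact: add_continuous.
  apply: cvg_big => [|j _]; first exact: add_continuous.
  exact: (L2_product_cvg oOm bOm (KF i j) (LDphi i) (LDphi j) (LDu i) (LDu j) (cDphi i) (cDphi j)).
have cl : c * intRn Om (fun x => phi k x * f x) ^+ 2 @[k --> \oo] -->
    c * intRn Om (fun x => u x * f x) ^+ 2.
  apply: cvgM; first exact: cvg_cst.
  by rewrite expr2; under eq_fun do rewrite expr2; exact: cvgM.
apply: (ler_cvg_to cl cF); near=> k.
have [_ [K [cK KOm phi0]]] := tphi k.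
exact: (energy_inequality_test hlm hmn hOm hw cK KOm phi0 (Cphi k)).
Unshelve. all: by end_near. Qed.
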